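(* Let $N = N(n) = o(n^{1/6})$ be an integer. Let $K > 0$ be a real number. Let $\varepsilon > 0$ be any positive number, and assume that for $1 \leqslant i < j < \infty$ we have numbers $c_{ij}$ and $c_{ij}'$ such that for all $i<j$, $$-K \leqslant c_{ij} < c_{ij}' \leqslant K, \qquad \inf_{i<j}\{c_{ij}' - c_{ij}\} \geqslant \varepsilon.$$ Let $I(t_{ij})$ be short for $I(c_{ij} < t_{ij} \leqslant c_{ij}')$, where $I$ denotes a characteristic function. Let $$G(N) = \left(\frac{1}{\sqrt{2\pi}}\right)^{\binom N2}\int_{-K}^K\cdots\int_{-K}^K \prod_{1 \leqslant i<j \leqslant N} I(t_{ij})e^{-t_{ij}^2/2}\, dt_{(N-1)N}\cdots dt_{12},$$ so that $G(N)$ is the probability that each Gaussian $X_{ij}$ in a collection $\{X_{ij} : 1 \leqslant i<j \leqslant N\}$ of independent standard Gaussians lies between $c_{ij}$ and $c_{ij}'$. Let $$P(N) = \sigma_{n-1}^N\left(\left\{(\mathbf{u}_1,\ldots,\mathbf{u}_N) \in (S^{n-1})^N : c_{ij} < \tilde\alpha_{ij} \leqslant c_{ij}' \text{ for } 1 \leqslant i<j \leqslant N\right\}\right),$$ where $\tilde\alpha_{ij} = \sqrt n\left(a(\mathbf{u}_i,\mathbf{u}_j) - \frac{\pi}{2}\right)$ and $\sigma_{n-1}^N$ denotes the $N$-fold product measure of the $(n-1)$-dimensional probability measure on $S^{n-1}$. Then, as $n \to \infty$, $$\frac{P(N)}{G(N)} = 1 + O_{K,\varepsilon}\left(\frac{N^3}{\sqrt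 n}\right).$$
   Context: $a(\mathbf{x},\mathbf{y}) \in [0,\pi]$ denotes the angle between nonzero vectors $\mathbf{x},\mathbf{y} \in \mathbb{R}^n$. The probability measure on $S^{n-1}$ is the uniform (rotation-invariant) one. $O_{K,\varepsilon}$ means that the implied constant depends only on $K$ and $\varepsilon$. *)

(* Defs.v *)
From HB Require Import structures.
From mathcomp Require Import all_boot all_order all_algebra.
From mathcomp Require Import all_classical all_reals all_analysis.

Set Implicit Arguments.
Unset Strict Implicit.
Unset Printing Implicit Defensive.

Import Order.TTheory GRing.Theory Num.Theory.
Import numFieldNormedType.Exports.

Local Open Scope classical_set_scope.
Local Open Scope ring_scope.

Section power_measure.
Context d (T : measurableType d) (R : realType) (P : probability T R).

Definition tcons N (p : T * N.-tuple T) : N.+1.-tuple T :=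
  [tuple of p.1 :: p.2].

Lemma measurable_tcons N : measurable_fun [set: T * N.-tuple T] (@tcons N).
Proof. exact: measurable_cons. Qed.

HB.instance Definition _ N := isMeasurableFun.Build _ _ _ _ (@tcons N)
  (@measurable_tcons N).

Fixpoint power_prob N : probability (N.-tuple T) R :=
  match N with
  | 0 => \d_([tuple] : 0.-tuple T)
  | N'.+1 => distribution (P \x power_prob N')%E (@tcons N')
  end.

Lemma power_probE N (A : 'I_N -> set T) : (forall i, measurable (A i)) ->
  power_prob N [set t | forall i, A i (tnth t i)] = (\prod_(i < N) P (A i))%E.
Proof.
elim: N A => [|N IH] A mA.
  by rewrite big_ord0 /= diracE mem_set// => -[].
have mB : measurable [set t : N.-tuple T | forall i, A (lift ord0 i) (tnth t i)].
  have -> : [set t : N.-tuple T | forall i, A (lift ord0 i) (tnth t i)] =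
      \bigcap_(i in [set: 'I_N]) ((@tnth _ T ^~ i) @^-1` A (lift ord0 i)).
    by apply/seteqP; split=> t tA i; [move=> _; exact: tA|exact: tA].
  apply: fin_bigcap_measurable => [|i _]; first exact: finite_finset.
  by rewrite -[X in measurable X]setTI; exact: measurable_tnth.
rewrite big_ord_recl -IH// /= /distribution /pushforward/=.
rewrite -product_measure1E//; congr (product_measure1 _ _ _).
apply/seteqP; split=> [[x t] tA|[x t] [/= xA tA] i].
  split => [|i]; first exact: (tA ord0).
  by have := tA (lift ord0 i); rewrite /= tnthS.
by case: (unliftP ord0 i) => [j ->|->] //=; rewrite tnthS.
Qed.

End power_measure.

Section sphere.
Context (R : realType) (n : nat).

(* Points of R^n are n-tuples: the sigma-algebra that these carry in the library
   is the product one, i.e. the Borel sets of R^n. *)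
Local Notation Rn := (n.-tuple (measurableTypeR R)).

Definition dot (x y : Rn) : R := \sum_(i < n) tnth x i * tnth y i.

(* The library norm on vectors is the sup norm. *)
Definition enorm (x : Rn) : R := Num.sqrt (dot x x).

Definition angle (x y : Rn) : R := acos (dot x y / (enorm x * enorm y)).

Definition usphere : set Rn := [set x | enorm x = 1].

Definition lin_act (M : 'M[R]_n) (x : Rn) : Rn :=
  [tuple \sum_(j < n) M i j * tnth x j | i < n].

(* The uniform probability measure on the sphere, as a Borel measure on R^n
   carried by the sphere. Invariance under the whole of O(n), rather than only
   SO(n), makes it unique for n = 1 as well. *)
Definition uniform_on_usphere (sigma : probability Rn R) : Prop :=
  sigma usphere = 1%E /\
  forall M : 'M[R]_n, M *m M^T = 1%:M ->
    forall A : set Rn, measurable A -> sigma (lin_act M @^-1` A) = sigma A.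

End sphere.

Section spherical_side.
Context (R : realType) (n : nat).
Local Notation Rn := (n.-tuple (measurableTypeR R)).

Definition alpha_tilde (x y : Rn) : R :=
  Num.sqrt n%:R * (angle x y - pi / 2).

(* Here and below indices start from 0. *)
Definition angle_event N (c c' : nat -> nat -> R) : set (N.-tuple Rn) :=
  [set u | (forall i : 'I_N, usphere (tnth u i)) /\
           forall i j : 'I_N, (i < j)%N ->
             c i j < alpha_tilde (tnth u i) (tnth u j) <= c' i j].

Definition sphere_prob (sigma : probability Rn R) N c c' : R :=
  fine (power_prob sigma N (angle_event c c')).

End spherical_side.

Section gaussian_side.
Context (R : realType).

(* The pairs i < j < N in lexicographic order. *)
Definition index_pairs (N : nat) : seq (nat * nat) :=
  [seq (i, j) | i <- iota 0 N, j <- iota i.+1 (N - i.+1)].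

(* Integrates F over the coordinates listed in s, each in [-K, K]; the head of s
   is the outermost variable, and t gives the values of the others. *)
Fixpoint iterated_integral (K : R) (s : seq (nat * nat))
    (F : (nat * nat -> R) -> R) (t : nat * nat -> R) : R :=
  match s with
  | [::] => F t
  | p :: s' => \int[lebesgue_measure]_(x in `[- K, K])
                 iterated_integral K s' F (fun q => if q == p then x else t q)
  end.

Definition gauss_prob (K : R) (N : nat) (c c' : nat -> nat -> R) : R :=
  (Num.sqrt (2 * pi))^-1 ^+ 'C(N, 2) *
  iterated_integral K (index_pairs N)
    (fun t => \prod_(p <- index_pairs N)
       (\1_(`]c p.1 p.2, c' p.1 p.2] : set R) (t p) * expR (- (t p) ^+ 2 / 2)))
    (fun=> 0).

End gaussian_side.

(* Main.v *)
Require Import Defs.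
From HB Require Import structures.
From mathcomp Require Import all_boot all_order all_algebra.
From mathcomp Require Import all_classical all_reals all_analysis.
From mathcomp Require Import measurable_realfun ring lra.

(** The vectors are revealed one at a time. Given k vectors on the sphere of R^n whose
    pairwise angles lie in their windows, the probability that a further uniform vector
    makes the prescribed angles with all of them is the product of k Gaussian window
    probabilities, up to a factor 1 + O(N^2 / sqrt n) that is uniform in the given
    vectors ([next_vector_bounds]). Over N steps the relative errors add up to
    O(N^3 / sqrt n) ([angle_event_bounds], [ratio_sub1_le]), while the products multiply
    to the iterated Gaussian integral ([gauss_prob_window]).

    For one step the uniform vector is replaced by a standard Gaussian vector of R^n. Its
    law is invariant under enough rotations to move any direction to any other one
    ([gauss_isom_axis]; plane rotations are products of shears), and a double count of the
    pairs of vectors that are close to each other shows that two such laws give the same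
    mass to cones, up to a small enlargement of the cone ([kernel_compare],
    [uniform_gauss_compare]).

    A QR decomposition ([gauss_isom_triangular]) then makes the k given vectors lower
    triangular. They are nearly orthogonal, all scalar products being O(1 / sqrt n), so
    their matrix is close to the identity ([triangular_offdiag_le]). If the Gaussian
    vector had length exactly sqrt n and the matrix were the identity, the angle
    conditions would say that its first k coordinates, which are independent standard
    Gaussians, lie in the windows. In general the cone of vectors that satisfy the
    conditions lies between two boxes, obtained by moving the endpoints of the windows by
    eta = A * (N / sqrt n + |rho / n - 1|), where rho is the squared length of the
    remaining coordinates ([cone_sub_box], [box_sub_cone]). These coordinates are
    independent of the first k. Since every window has mass bounded below in terms of K
    and eps, a margin eta costs a relative error O(eta) in each of the k factors
    ([gauss_itv_prod_widen], [gauss_itv_prod_shrink]), and the exponential moments of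
    (rho - m) / sqrt n, for m remaining coordinates, bound the average of the total
    ([gauss_vec_mgf_le], [gauss_box_le], [gauss_box_ge]). *)

Set Implicit Arguments.
Unset Strict Implicit.
Unset Printing Implicit Defensive.

Import Order.TTheory GRing.Theory Num.Theory.
Import numFieldNormedType.Exports.

Local Open Scope classical_set_scope.
Local Open Scope ring_scope.

(** * Measurability of sets given by inequalities *)

Section measurable_sets.
Context d (T : measurableType d) (R : realType).
Implicit Types f g h : T -> R.

Lemma measurable_preimage d' (U : measurableType d') (f : T -> U) (A : set U) :
  measurable_fun setT f -> measurable A -> measurable (f @^-1` A).
Proof. by move=> mf mA; rewrite -[X in measurable X]setTI; exact: mf. Qed.

Lemma measurable_setb (b : T -> bool) : measurable_fun setT b -> measurable [set x | b x].
Proof.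
move=> mb; have := measurable_preimage mb (I : measurable [set true]).
by congr measurable; apply/seteqP; split => x /= ->.
Qed.

Lemma measurable_forall_ord k (A : 'I_k -> set T) : (forall i, measurable (A i)) ->
  measurable [set x | forall i, A i x].
Proof.
move=> mA; have -> : [set x | forall i, A i x] = \bigcap_(i in [set: 'I_k]) A i.
  by apply/seteqP; split => x xA i; [move=> _; exact: xA|exact: xA].
by apply: fin_bigcap_measurable => // i _; exact: mA.
Qed.

Lemma measurable_between_oo f g h :
  measurable_fun setT f -> measurable_fun setT g -> measurable_fun setT h ->
  measurable [set x | f x < g x < h x].
Proof.
by move=> mf mg mh; apply: measurable_setb; apply: measurable_and; exact: measurable_fun_ltr.
Qed.

Lemma measurable_between_oc f g h :
  measurable_fun setT f -> measurable_fun setT g -> measurable_fun setT h ->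
  measurable [set x | f x < g x <= h x].
Proof.
move=> mf mg mh; apply: measurable_setb; apply: measurable_and.
  exact: measurable_fun_ltr.
exact: measurable_fun_ler.
Qed.

Lemma measureE_indic (P : {measure set T -> \bar R}) (A : set T) :
  measurable A -> P A = (\int[P]_x (\1_A x)%:E)%E.
Proof. by move=> mA; rewrite integral_indic// setIT. Qed.

End measurable_sets.

(** * Densities and translations *)

Section density.
Context d (T : measurableType d) (R : realType).
Variables (mu nu : {measure set T -> \bar R}) (p : T -> R).
Hypotheses (p0 : forall x, 0 <= p x) (mp : measurable_fun setT p).
Hypothesis nuE : forall A, measurable A -> nu A = (\int[mu]_(x in A) (p x)%:E)%E.

Import HBNNSimple.

Let density_indic A : measurable A ->
  (\int[nu]_x (\1_A x)%:E = \int[mu]_x ((\1_A x)%:E * (p x)%:E))%E.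
Proof.
move=> mA; rewrite integral_indic// setIT nuE// integral_mkcond/=.
apply: eq_integral => x _; rewrite patchE indicE.
by case: ifPn => xA; rewrite ?mul1e ?mul0e.
Qed.

Let density_nnsfun (f : {nnsfun T >-> R}) :
  (\int[nu]_x (f x)%:E = \int[mu]_x ((f x)%:E * (p x)%:E))%E.
Proof.
under [LHS]eq_integral do rewrite fimfunE -fsumEFin//.
rewrite [LHS]ge0_integral_fsum//; last 2 first.
  - by move=> r; exact/measurable_EFinP/measurableT_comp.
  - by move=> n x _; rewrite EFinM nnfun_muleindic_ge0.
under [RHS]eq_integral.
  move=> x xD; rewrite fimfunE -fsumEFin// muleC ge0_mule_fsumr; last first.
    by move=> r; rewrite EFinM nnfun_muleindic_ge0.
  over.
rewrite [RHS]ge0_integral_fsum//; last 2 first.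
  - move=> r; apply: emeasurable_funM; first exact/measurable_EFinP.
    by apply/measurable_EFinP/measurable_funM.
  - move=> n x _; rewrite EFinM mule_ge0//; last by rewrite nnfun_muleindic_ge0.
    by rewrite lee_fin.
apply: eq_fsbigr => r _.
rewrite integralZl_indic_nnsfun// density_indic//.
have [r0|r0] := leP 0 r.
  rewrite -ge0_integralZl//.
  - by apply: eq_integral => x _; rewrite EFinM muleA [RHS]muleC.
  - by apply: emeasurable_funM; exact/measurable_EFinP.
  - by move=> x _; rewrite mule_ge0// lee_fin.
rewrite !integral0_eq ?mule0// => x _; rewrite preimage_nnfun0// indicE in_set0 ?mulr0 ?mule0//.
by rewrite mul0e.
Qed.

(** Indicators satisfy the identity by hypothesis, hence so do simple functions, and
    monotone convergence passes to the limit on both sides. *)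
Lemma ge0_integral_density (f : T -> \bar R) :
  measurable_fun setT f -> (forall x, 0 <= f x)%E ->
  (\int[nu]_x f x = \int[mu]_x (f x * (p x)%:E))%E.
Proof.
move=> mf f0.
pose f_ := nnsfun_approx measurableT mf.
have cf x : (f_ n x)%:E @[n --> \oo] --> f x by exact: cvg_nnsfun_approx.
transitivity (lim (\int[nu]_x (f_ n x)%:E @[n --> \oo])%E).
  rewrite -monotone_convergence//=.
  - by apply: eq_integral => x _; apply/esym/cvg_lim => //=.
  - by move=> n; exact/measurable_EFinP/measurable_funTS.
  - by move=> n ? _; rewrite lee_fin.
  - by move=> ? _ ? ? mn; rewrite lee_fin; exact/lefP/nd_nnsfun_approx.
transitivity (lim (\int[mu]_x ((f_ n x)%:E * (p x)%:E) @[n --> \oo])%E).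
  by apply: congr_lim; apply/funext => n /=; exact: density_nnsfun.
rewrite -monotone_convergence//=.
- by apply: eq_integral => x _; apply/cvg_lim => //=; apply: cvgeZr.
- by move=> n; apply: emeasurable_funM; exact/measurable_EFinP.
- by move=> n x _; rewrite mule_ge0// lee_fin.
- move=> x _ a b ab; rewrite lee_wpmul2r ?lee_fin//.
  exact/lefP/nd_nnsfun_approx.
Qed.

End density.

Lemma lebesgue_measure_shift (R : realType) (a : R) (A : set R) : measurable A ->
  pushforward lebesgue_measure (fun x : measurableTypeR R => (x + a : measurableTypeR R)) A = lebesgue_measure A.
Proof.
move=> mA; apply/esym.
have ms : measurable_fun setT (fun x : measurableTypeR R => (x + a : measurableTypeR R)).
  exact: measurable_funD.
pose s := HB.pack_for {mfun measurableTypeR R >-> measurableTypeR R}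
  (fun x : measurableTypeR R => (x + a : measurableTypeR R))
  (isMeasurableFun.Build _ _ _ _ _ ms).
apply: (@lebesgue_measure_unique _ (pushforward lebesgue_measure s)) => //= _ [[b c]] _ <-.
rewrite /pushforward.
rewrite (_ : _ @^-1` _ = `]b - a, c - a]%classic).
  rewrite !lebesgue_measure_itv/= !lte_fin ltrD2r; case: ifPn => // _.
  by rewrite -!EFinD; congr EFin; lra.
by apply/seteqP; split => x /=; rewrite !in_itv/= ltrBlDr lerBrDr.
Qed.

Lemma ge0_integral_shift (R : realType) (a : R) (f : R -> \bar R) :
  measurable_fun setT f -> (forall x, 0 <= f x)%E ->
  (\int[lebesgue_measure]_x f (x + a)%R = \int[lebesgue_measure]_x f x)%E.
Proof.
move=> mf f0.
have ms : measurable_fun setT (fun x : measurableTypeR R => (x + a : measurableTypeR R)).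
  exact: measurable_funD.
have := @ge0_integral_pushforward _ _ _ _ _ _ ms lebesgue_measure setT f measurableT mf (fun y _ => f0 y).
rewrite preimage_setT => <-.
apply: eq_measure_integral => A mA _.
exact: lebesgue_measure_shift.
Qed.

(** * Rotations of the Gaussian plane *)

Section plane.
Context (R : realType).
Local Notation T := (measurableTypeR R).
Local Notation leb := (@lebesgue_measure R).
Implicit Types F : T * T -> \bar R.

Lemma integral_shear_snd (a : R) F :
  measurable_fun setT F -> (forall z, 0 <= F z)%E ->
  (\int[leb]_x \int[leb]_y F (x, y + a * x)%R = \int[leb]_x \int[leb]_y F (x, y))%E.
Proof.
move=> mF F0; apply: eq_integral => x _.
apply: (ge0_integral_shift (a * x) (f := fun y => F (x, y))) => //.
by apply: measurableT_comp => //; exact: measurable_pair1.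
Qed.

Lemma measurable_shear_fst (a : R) :
  measurable_fun setT (fun z : T * T => ((z.1 + a * z.2)%R : T, z.2)).
Proof.
apply/measurable_fun_pairP; split => /=; last exact: measurable_snd.
apply: measurable_funD => //.
exact: measurable_funM.
Qed.

Lemma measurable_shear_snd (a : R) :
  measurable_fun setT (fun z : T * T => (z.1, (z.2 + a * z.1)%R : T)).
Proof.
apply/measurable_fun_pairP; split => /=; first exact: measurable_fst.
apply: measurable_funD => //.
exact: measurable_funM.
Qed.

(** After Tonelli the inner integral is over the first coordinate, and the shear
    translates it. *)
Lemma integral_shear_fst (a : R) F :
  measurable_fun setT F -> (forall z, 0 <= F z)%E ->
  (\int[leb]_x \int[leb]_y F (x + a * y, y)%R = \int[leb]_x \int[leb]_y F (x, y))%E.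
Proof.
move=> mF F0.
have mF1 : measurable_fun setT (fun z : T * T => F ((z.1 + a * z.2)%R, z.2)).
  exact: (measurableT_comp mF (measurable_shear_fst a)).
have -> := @fubini_tonelli _ _ T T R leb leb _ mF1 (fun z => F0 _).
rewrite (fubini_tonelli F mF F0).
apply: eq_integral => y _.
apply: (ge0_integral_shift (a * y) (f := fun x => F (x, y))) => //.
by apply: measurableT_comp => //; exact: measurable_pair2.
Qed.

(** A rotation with s != 0 is a product of three shears, with slopes t, s and t for
    t = (c - 1) / s, and each shear preserves Lebesgue measure. *)
Lemma integral_rotation (c s : R) F : c ^+ 2 + s ^+ 2 = 1 -> s != 0 ->
  measurable_fun setT F -> (forall z, 0 <= F z)%E ->
  (\int[leb]_x \int[leb]_y F (c * x - s * y, s * x + c * y)%R =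
   \int[leb]_x \int[leb]_y F (x, y))%E.
Proof.
move=> cs s0 mF F0; pose t := (c - 1) / s.
have mF1 : measurable_fun setT (fun z : T * T => F ((z.1 + t * z.2)%R, z.2)).
  by apply: measurableT_comp => //; exact: measurable_shear_fst.
have mF2 := measurableT_comp mF1 (measurable_shear_snd s).
rewrite -(integral_shear_fst t mF F0).
rewrite -(integral_shear_snd s mF1 (fun z => F0 _)).
rewrite -(integral_shear_fst t mF2 (fun z => F0 _)) /=.
apply: eq_integral => x _; apply: eq_integral => y _; congr (F (_, _)).
  have ts : t * s = c - 1 by rewrite divfK.
  have tc : t * (1 + c) = - s.
    apply: (mulIf s0); rewrite mulrAC ts mulNr -expr2.
    by have -> : s ^+ 2 = 1 - c ^+ 2; [rewrite -cs|]; ring.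
  transitivity (x * (1 + t * s) + y * (t * (1 + (1 + t * s)))); last by ring.
  have -> : 1 + t * s = c by rewrite ts; ring.
  by rewrite tc; ring.
have ts : t * s = c - 1 by rewrite divfK.
transitivity (y * (1 + t * s) + s * x); last by ring.
by rewrite ts; ring.
Qed.

Definition std_gauss : probability T R := normal_prob (0 : R) 1.

Lemma std_gaussE (A : set T) :
  std_gauss A = (\int[leb]_(x in A) (normal_pdf 0 1 x)%:E)%E.
Proof. by []. Qed.

Lemma integral_std_gauss (f : T -> \bar R) :
  measurable_fun setT f -> (forall x, 0 <= f x)%E ->
  (\int[std_gauss]_x f x = \int[leb]_x (f x * (normal_pdf 0 1 x)%:E))%E.
Proof.
move=> mf f0; apply: ge0_integral_density => //.
  exact: normal_pdf_ge0.
exact: measurable_normal_pdf.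
Qed.

Lemma normal_pdf01 (x : R) :
  normal_pdf 0 1 x = (Num.sqrt (2 * pi))^-1 * expR (- x ^+ 2 / 2).
Proof.
rewrite normal_pdfE ?oner_neq0// /normal_peak /normal_fun subr0 !expr1n mul1r.
by rewrite -mulr_natl.
Qed.

Lemma integral2_std_gauss F :
  measurable_fun setT F -> (forall z, 0 <= F z)%E ->
  (\int[std_gauss]_x \int[std_gauss]_y F (x, y) =
   \int[leb]_x \int[leb]_y (F (x, y) * (normal_pdf 0 1 x * normal_pdf 0 1 y)%:E))%E.
Proof.
move=> mF F0.
rewrite integral_std_gauss; last 2 first.
  exact: (measurable_fun_fubini_tonelli_F F).
  by move=> x; apply: integral_ge0.
apply: eq_integral => x _.
have mFx : measurable_fun setT (fun y => F (x, y)).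
  by apply: measurableT_comp => //; exact: measurable_pair1.
rewrite integral_std_gauss// -ge0_integralZr//=; last 3 first.
  - apply: emeasurable_funM => //; apply/measurable_EFinP.
    exact: measurable_normal_pdf.
  - by move=> y _; rewrite mule_ge0// lee_fin normal_pdf_ge0.
  - by rewrite lee_fin normal_pdf_ge0.
by apply: eq_integral => y _; rewrite -muleA -EFinM (mulrC (normal_pdf 0 1 x)).
Qed.

Let integral_std_gauss_rotation_neq0 (c s : R) F : c ^+ 2 + s ^+ 2 = 1 -> s != 0 ->
  measurable_fun setT F -> (forall z, 0 <= F z)%E ->
  (\int[std_gauss]_x \int[std_gauss]_y F (c * x - s * y, s * x + c * y)%R =
   \int[std_gauss]_x \int[std_gauss]_y F (x, y))%E.
Proof.
move=> cs s0 mF F0.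
have mr : measurable_fun setT (fun z : T * T =>
    ((c * z.1 - s * z.2)%R : T, (s * z.1 + c * z.2)%R : T)).
  apply/measurable_fun_pairP; split => /=.
    by apply: measurable_funB; apply: measurable_funM.
  by apply: measurable_funD; apply: measurable_funM.
rewrite (integral2_std_gauss (measurableT_comp mF mr) (fun z => F0 _)).
rewrite (integral2_std_gauss mF F0).
rewrite -(integral_rotation cs s0 (F := fun z =>
   F z * (normal_pdf 0 1 z.1 * normal_pdf 0 1 z.2)%:E)%E)/=.
- apply: eq_integral => x _; apply: eq_integral => y _; congr (_ * _%:E)%E.
  rewrite !normal_pdf01 mulrACA [RHS]mulrACA -!expRD; congr (_ * expR _).
  rewrite -!mulNr -!mulrDl; congr (_ / _).
  transitivity (- (c ^+ 2 + s ^+ 2) * (x ^+ 2 + y ^+ 2)); last by ring.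
  by rewrite cs; ring.
- apply: emeasurable_funM => //; apply/measurable_EFinP.
  apply: measurable_funM; apply: measurableT_comp => //; exact: measurable_normal_pdf.
- by move=> z; rewrite mule_ge0// lee_fin mulr_ge0// normal_pdf_ge0.
Qed.

(** The density of a pair of independent standard Gaussians is a function of
    x ^ 2 + y ^ 2 alone. When s = 0 the rotation is the identity or the half-turn; the
    latter is the square of a quarter-turn, which is a product of shears. *)
Lemma integral_std_gauss_rotation (c s : R) F : c ^+ 2 + s ^+ 2 = 1 ->
  measurable_fun setT F -> (forall z, 0 <= F z)%E ->
  (\int[std_gauss]_x \int[std_gauss]_y F (c * x - s * y, s * x + c * y)%R =
   \int[std_gauss]_x \int[std_gauss]_y F (x, y))%E.
Proof.
move=> cs mF F0; have [s0|s0] := eqVneq s 0; last exact: integral_std_gauss_rotation_neq0.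
have : (c - 1) * (c + 1) = 0 by rewrite -[RHS](subrr 1) -[X in _ = X - _]cs s0; ring.
move/eqP; rewrite mulf_eq0 => /orP[|]; rewrite (subr_eq0, addr_eq0) => /eqP c1.
  apply: eq_integral => x _; apply: eq_integral => y _.
  by rewrite s0 c1 !mul1r !mul0r subr0 add0r.
have mr : measurable_fun setT (fun z : T * T => ((0 * z.1 - 1 * z.2)%R : T, (1 * z.1 + 0 * z.2)%R : T)).
  apply/measurable_fun_pairP; split => /=.
    by apply: measurable_funB; apply: measurable_funM.
  by apply: measurable_funD; apply: measurable_funM.
have c01 : (0 : R) ^+ 2 + 1 ^+ 2 = 1 by ring.
rewrite -(integral_std_gauss_rotation_neq0 c01 (oner_neq0 _) mF F0).
rewrite -(integral_std_gauss_rotation_neq0 c01 (oner_neq0 _) (measurableT_comp mF mr)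
  (fun z => F0 _)) /=.
apply: eq_integral => x _; apply: eq_integral => y _; congr (F (_, _)); rewrite s0 c1; ring.
Qed.

End plane.
Arguments std_gauss {R}.

(** * Integration against a power of a probability measure *)

Section power_integral.
Context d (T : measurableType d) (R : realType) (P : probability T R).
Implicit Types N : nat.

Lemma integral_power_probS N (F : N.+1.-tuple T -> \bar R) :
  measurable_fun setT F -> (forall t, 0 <= F t)%E ->
  (\int[power_prob P N.+1]_t F t =
   \int[P]_x \int[power_prob P N]_v F (tcons (x, v)))%E.
Proof.
move=> mF F0.
have mFc := measurableT_comp mF (@measurable_tcons _ T N).
transitivity (\int[(P \x power_prob P N)%E]_z (F \o @tcons _ T N) z)%E.
  exact: (ge0_integral_distribution (P := (P \x power_prob P N)%E) (@tcons _ T N)).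
by rewrite (fubini_tonelli1 _ mFc (fun z => F0 _)).
Qed.

Lemma integral_power_probS_swap N (F : N.+1.-tuple T -> \bar R) :
  measurable_fun setT F -> (forall t, 0 <= F t)%E ->
  (\int[power_prob P N.+1]_t F t =
   \int[power_prob P N]_v \int[P]_x F (tcons (x, v)))%E.
Proof.
move=> mF F0.
have mFc := measurableT_comp mF (@measurable_tcons _ T N).
rewrite integral_power_probS//.
exact: (fubini_tonelli _ mFc (fun z => F0 _)).
Qed.

Lemma measurable_tcons_r N x : measurable_fun setT (fun v : N.-tuple T => tcons (x, v)).
Proof. by apply: measurableT_comp; [exact: measurable_tcons|exact: measurable_pair1]. Qed.

Lemma measurable_tcons_l N (v : N.-tuple T) : measurable_fun setT (fun x : T => tcons (x, v)).
Proof. by apply: measurableT_comp; [exact: measurable_tcons|exact: measurable_pair2]. Qed.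

Lemma measurable_tcons2 N : measurable_fun setT
  (fun z : (T * T) * N.-tuple T => tcons (z.1.1, tcons (z.1.2, z.2))).
Proof.
apply: (measurableT_comp (f := @tcons _ T N.+1)); first exact: measurable_tcons.
apply/measurable_fun_pairP; split => /=.
  exact: (measurableT_comp measurable_fst measurable_fst).
apply: (measurableT_comp (f := @tcons _ T N)); first exact: measurable_tcons.
apply/measurable_fun_pairP; split => /=; last exact: measurable_snd.
exact: (measurableT_comp measurable_snd measurable_fst).
Qed.

Lemma integral_power_probSS N (F : N.+2.-tuple T -> \bar R) :
  measurable_fun setT F -> (forall t, 0 <= F t)%E ->
  (\int[power_prob P N.+2]_t F t = \int[P]_x \int[P]_y
     (fun z => \int[power_prob P N]_v F (tcons (z.1, tcons (z.2, v)))) (x, y))%E.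
Proof.
move=> mF F0; rewrite integral_power_probS//; apply: eq_integral => x _.
rewrite integral_power_probS//.
exact: (measurableT_comp mF (measurable_tcons_r x)).
Qed.

Lemma measurable_integral_tcons2 N (F : N.+2.-tuple T -> \bar R) :
  measurable_fun setT F -> (forall t, 0 <= F t)%E ->
  measurable_fun setT (fun z : T * T =>
     \int[power_prob P N]_v F (tcons (z.1, tcons (z.2, v))))%E.
Proof.
move=> mF F0; have mFc := measurableT_comp mF (@measurable_tcons2 N).
exact: (measurable_fun_fubini_tonelli_F _ mFc (fun z => F0 _)).
Qed.

Lemma tnth_tcons0 n (x : T) (v : n.-tuple T) : tnth (tcons (x, v)) ord0 = x.
Proof. by []. Qed.

Lemma tnth_tconsS n (x : T) (v : n.-tuple T) i :
  tnth (tcons (x, v)) (lift ord0 i) = tnth v i.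
Proof. by rewrite /tcons tnthS. Qed.

Lemma tcons_eta n (x : n.+1.-tuple T) :
  x = tcons (tnth x ord0, [tuple tnth x (lift ord0 i) | i < n]).
Proof.
apply: eq_from_tnth => i; case: (unliftP ord0 i) => [j ->|->].
  by rewrite tnth_tconsS tnth_mktuple.
by rewrite tnth_tcons0.
Qed.

End power_integral.

(** * Linear maps of tuples *)

Section linear_action.
Context (R : realType).
Local Notation T := (measurableTypeR R).

Lemma tnth_lin_act n (M : 'M[R]_n) (x : n.-tuple T) i :
  tnth (lin_act M x) i = \sum_(j < n) M i j * tnth x j.
Proof. by rewrite tnth_mktuple. Qed.

Lemma measurable_lin_act n (M : 'M[R]_n) :
  measurable_fun setT (lin_act M : n.-tuple T -> n.-tuple T).
Proof.
apply/measurable_fun_tnthP => i.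
rewrite (_ : _ \o _ = fun x : n.-tuple T => \sum_(j < n) M i j * tnth x j); last first.
  by apply/funext => x /=; rewrite tnth_lin_act.
apply: measurable_sum => j; apply: measurable_funM => //.
exact: measurable_tnth.
Qed.

Lemma lin_actM n (M M' : 'M[R]_n) x : lin_act (M *m M') x = lin_act M (lin_act M' x).
Proof.
apply: eq_from_tnth => i; rewrite !tnth_lin_act.
under eq_bigr do rewrite mxE big_distrl/=.
rewrite exchange_big/=; apply: eq_bigr => j _.
by rewrite tnth_lin_act big_distrr/=; apply: eq_bigr => k _; rewrite mulrA.
Qed.

Lemma dot_lin_act n (M : 'M[R]_n) x y : M *m M^T = 1%:M ->
  dot (lin_act M x) (lin_act M y) = dot x y.
Proof.
move=> /mulmx1C MM; rewrite /dot.
transitivity (\sum_j \sum_k (M^T *m M) j k * (tnth x j * tnth y k)).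
  under eq_bigr do rewrite !tnth_lin_act big_distrlr/=.
  rewrite exchange_big/=; apply: eq_bigr => j _.
  rewrite exchange_big/=; apply: eq_bigr => k _.
  rewrite mxE big_distrl/=; apply: eq_bigr => i _.
  by rewrite mxE mulrACA.
rewrite MM; apply: eq_bigr => j _; rewrite (bigD1 j)//= mxE eqxx mul1r.
by rewrite big1 ?addr0// => k kj; rewrite mxE eq_sym (negbTE kj) mul0r.
Qed.

Lemma enorm_lin_act n (M : 'M[R]_n) x : M *m M^T = 1%:M ->
  enorm (lin_act M x) = enorm x.
Proof. by move=> MM; rewrite /enorm dot_lin_act. Qed.

Definition cons_mx n (M : 'M[R]_n) : 'M[R]_n.+1 :=
  (block_mx (1%:M : 'M[R]_1) 0 0 M : 'M[R]_(1 + n)).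

Lemma cons_mx_orth n (M : 'M[R]_n) : M *m M^T = 1%:M ->
  cons_mx M *m (cons_mx M)^T = 1%:M.
Proof.
move=> MM; rewrite /cons_mx (@tr_block_mx _ 1 n 1 n) (@mulmx_block _ 1 n 1 n 1 n).
rewrite !trmx0 !mul0mx !mulmx0 !addr0 !add0r MM trmx1 mulmx1.
by rewrite -scalar_mx_block.
Qed.

Lemma cons_mxE n (M : 'M[R]_n) :
  [/\ cons_mx M ord0 ord0 = 1,
      forall k, cons_mx M ord0 (lift ord0 k) = 0,
      forall k, cons_mx M (lift ord0 k) ord0 = 0 &
      forall j k, cons_mx M (lift ord0 j) (lift ord0 k) = M j k].
Proof.
have e0 : (ord0 : 'I_n.+1) = lshift n (ord0 : 'I_1) by exact/val_inj.
have e1 (k : 'I_n) : (lift ord0 k : 'I_n.+1) = rshift 1 k by exact/val_inj.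
split=> [|k|k|j k]; rewrite ?e1 ?e0 /cons_mx.
- by rewrite (@block_mxEul _ 1 n 1 n) mxE.
- by rewrite (@block_mxEur _ 1 n 1 n) mxE.
- by rewrite (@block_mxEdl _ 1 n 1 n) mxE.
- by rewrite (@block_mxEdr _ 1 n 1 n).
Qed.

Lemma lin_act_cons_mx n (M : 'M[R]_n) x v :
  lin_act (cons_mx M) (tcons (x, v)) = tcons (x, lin_act M v).
Proof.
have [m00 m01 m10 m11] := cons_mxE M.
apply: eq_from_tnth => i; rewrite tnth_lin_act big_ord_recl tnth_tcons0.
under eq_bigr do rewrite tnth_tconsS.
case: (unliftP ord0 i) => [j ->|->]; rewrite ?tnth_tconsS ?tnth_tcons0.
  rewrite m10 mul0r add0r tnth_lin_act.
  by apply: eq_bigr => k _; rewrite m11.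
by rewrite m00 mul1r big1 ?addr0// => k _; rewrite m01 mul0r.
Qed.

(** Rotation of the plane through the angle with cosine c and sine s. *)
Definition rot2 (c s : R) : 'M[R]_2 :=
  \matrix_(i, j) (if i == j then c else if i == ord0 then - s else s).

Definition rot_mx n (c s : R) : 'M[R]_n.+2 :=
  (block_mx (rot2 c s) 0 0 1%:M : 'M[R]_(2 + n)).

Lemma rot2_orth c s : c ^+ 2 + s ^+ 2 = 1 -> rot2 c s *m (rot2 c s)^T = 1%:M.
Proof.
move=> cs; apply/matrixP => i j; rewrite !mxE !big_ord_recl big_ord0 addr0 !mxE.
case: i => [] [|[|//]] // i2; case: j => [] [|[|//]] // j2; rewrite -!val_eqE /=.
- by rewrite mulrNN -!expr2.
- ring.
- ring.
- by rewrite -!expr2 addrC.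
Qed.

Lemma rot_mx_orth n c s : c ^+ 2 + s ^+ 2 = 1 ->
  rot_mx n c s *m (rot_mx n c s)^T = 1%:M.
Proof.
move=> cs; rewrite /rot_mx (@tr_block_mx _ 2 n 2 n) (@mulmx_block _ 2 n 2 n 2 n).
rewrite !trmx0 !mul0mx !mulmx0 !addr0 !add0r rot2_orth// trmx1 mulmx1.
by rewrite -scalar_mx_block.
Qed.

Lemma rot_mxE n c s :
  [/\ rot_mx n c s ord0 ord0 = c /\ rot_mx n c s ord0 (lift ord0 ord0) = - s,
      rot_mx n c s (lift ord0 ord0) ord0 = s /\
        rot_mx n c s (lift ord0 ord0) (lift ord0 ord0) = c,
      forall k, rot_mx n c s ord0 (lift ord0 (lift ord0 k)) = 0 /\
        rot_mx n c s (lift ord0 ord0) (lift ord0 (lift ord0 k)) = 0,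
      forall k, rot_mx n c s (lift ord0 (lift ord0 k)) ord0 = 0 /\
        rot_mx n c s (lift ord0 (lift ord0 k)) (lift ord0 ord0) = 0 &
      forall j k, rot_mx n c s (lift ord0 (lift ord0 j)) (lift ord0 (lift ord0 k)) =
        (j == k)%:R].
Proof.
have e0 : (ord0 : 'I_n.+2) = lshift n (ord0 : 'I_2) by exact/val_inj.
have e1 : (lift ord0 ord0 : 'I_n.+2) = lshift n (lift ord0 ord0 : 'I_2) by exact/val_inj.
have e2 (k : 'I_n) : (lift ord0 (lift ord0 k) : 'I_n.+2) = rshift 2 k by exact/val_inj.
split=> [||k|k|j k]; [split|split|split|split|]; rewrite ?e2 ?e1 ?e0 /rot_mx.
all: by rewrite ?(@block_mxEul _ 2 n 2 n) ?(@block_mxEur _ 2 n 2 n)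
  ?(@block_mxEdl _ 2 n 2 n) ?(@block_mxEdr _ 2 n 2 n) mxE.
Qed.

Lemma lin_act_rot_mx n c s (x y : T) (v : n.-tuple T) :
  lin_act (rot_mx n c s) (tcons (x, tcons (y, v))) =
  tcons (c * x - s * y, tcons (s * x + c * y, v)).
Proof.
have [[m00 m01] [m10 m11] m0k mk0 mkl] := rot_mxE n c s.
apply: eq_from_tnth => i; rewrite tnth_lin_act !big_ord_recl !tnth_tconsS !tnth_tcons0.
under eq_bigr do rewrite !tnth_tconsS.
case: (unliftP ord0 i) => [j ->|->]; rewrite ?tnth_tconsS ?tnth_tcons0.
  case: (unliftP ord0 j) => [k ->|->]; rewrite ?tnth_tconsS ?tnth_tcons0.
    rewrite (mk0 k).1 (mk0 k).2 !mul0r !add0r.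
    rewrite (bigD1 k)//= mkl eqxx mul1r big1 ?addr0// => l lk.
    by rewrite mkl eq_sym (negbTE lk) mul0r.
  by rewrite m10 m11 big1 ?addr0// => l _; rewrite (m0k l).2 mul0r.
by rewrite m00 m01 big1 ?addr0 ?mulNr// => l _; rewrite (m0k l).1 mul0r.
Qed.

End linear_action.

(** * Orthogonal reductions that preserve the Gaussian measure *)

Section gauss_invariance.
Context (R : realType).
Local Notation T := (measurableTypeR R).

Definition gauss_vec n : probability (n.-tuple T) R := power_prob std_gauss n.

(** Invariance of the Gaussian measure is part of the predicate because it is proved along
    the construction: for the plane rotations directly, and for the other matrices since
    it passes to products. *)
Definition gauss_isom n (M : 'M[R]_n) : Prop := M *m M^T = 1%:M /\
  forall A : set (n.-tuple T), measurable A -> gauss_vec n (lin_act M @^-1` A) = gauss_vec n A.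

Lemma gauss_isomM n (M M' : 'M[R]_n) : gauss_isom M -> gauss_isom M' -> gauss_isom (M *m M').
Proof.
move=> [MM iM] [MM' iM']; split => [|A mA].
  by rewrite trmx_mul mulmxA -(mulmxA M) MM' mulmx1 MM.
have mA' : measurable (lin_act M @^-1` A).
  by apply: measurable_preimage => //; exact: measurable_lin_act.
rewrite -(iM _ mA) -(iM' _ mA').
by congr (gauss_vec n _); apply/seteqP; split => x /=; rewrite lin_actM.
Qed.

Lemma lin_act1 n (x : n.-tuple T) : lin_act 1%:M x = x.
Proof.
apply: eq_from_tnth => i; rewrite tnth_lin_act (bigD1 i)//= mxE eqxx mul1r.
by rewrite big1 ?addr0// => j ji; rewrite mxE eq_sym (negbTE ji) mul0r.
Qed.

Lemma gauss_isom1 n : gauss_isom (1%:M : 'M[R]_n).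
Proof.
split => [|A mA]; first by rewrite trmx1 mulmx1.
by congr (gauss_vec n _); apply/seteqP; split => x /=; rewrite lin_act1.
Qed.

(** The coordinates are independent, so a map that fixes the first one can be applied
    for each value of it separately. *)
Lemma gauss_isom_cons n (M : 'M[R]_n) : gauss_isom M -> gauss_isom (cons_mx M).
Proof.
move=> [MM iM]; split => [|A mA]; first exact: cons_mx_orth.
have mA' : measurable (lin_act (cons_mx M) @^-1` A).
  by apply: measurable_preimage => //; exact: measurable_lin_act.
rewrite (measureE_indic _ mA) (measureE_indic _ mA') /gauss_vec.
have F0 (B : set (n.+1.-tuple T)) v : (0 <= (\1_B v : R)%:E)%E by rewrite lee_fin.
rewrite (integral_power_probS _ _ (F0 _)); last exact/measurable_EFinP/measurable_indic.
rewrite (integral_power_probS _ _ (F0 _)); last exact/measurable_EFinP/measurable_indic.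
apply: eq_integral => x _; pose B := (fun v : n.-tuple T => tcons (x, v)) @^-1` A.
have mB : measurable B.
  by apply: measurable_preimage => //; exact: measurable_tcons_r.
transitivity (gauss_vec n B); last by rewrite (measureE_indic _ mB).
rewrite -iM// measureE_indic; last first.
  by apply: measurable_preimage => //; exact: measurable_lin_act.
apply: eq_integral => v _; congr (_%:E).
rewrite !indicE; congr (nat_of_bool _)%:R.
by apply/idP/idP; rewrite !inE /= lin_act_cons_mx.
Qed.

Lemma gauss_isom_rot n c s : c ^+ 2 + s ^+ 2 = 1 -> gauss_isom (rot_mx n c s).
Proof.
move=> cs; split => [|A mA]; first exact: rot_mx_orth.
have mA' : measurable (lin_act (rot_mx n c s) @^-1` A).
  by apply: measurable_preimage => //; exact: measurable_lin_act.
rewrite (measureE_indic _ mA) (measureE_indic _ mA') /gauss_vec.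
have F0 (B : set (n.+2.-tuple T)) v : (0 <= (\1_B v : R)%:E)%E by rewrite lee_fin.
have mF (B : set (n.+2.-tuple T)) : measurable B -> measurable_fun setT (fun v => (\1_B v : R)%:E).
  by move=> mB; exact/measurable_EFinP/measurable_indic.
rewrite (integral_power_probSS _ (mF _ mA') (F0 _)).
rewrite (integral_power_probSS _ (mF _ mA) (F0 _)).
have mG := measurable_integral_tcons2 std_gauss (mF _ mA) (F0 _).
have G0 (z : T * T) : (0 <= \int[power_prob std_gauss n]_v
    (\1_A (tcons (z.1, tcons (z.2, v))) : R)%:E)%E.
  by apply: integral_ge0 => v _; exact: F0.
apply: (etrans _ (integral_std_gauss_rotation cs mG G0)).
apply: eq_integral => x _; apply: eq_integral => y _; apply: eq_integral => v _ /=.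
congr (_%:E); rewrite !indicE; congr (nat_of_bool _)%:R.
by apply/idP/idP; rewrite !inE /= lin_act_rot_mx.
Qed.

Definition zero_vec n : n.-tuple T := [tuple 0 | i < n].

Lemma dot_tcons n (x y : T) (v w : n.-tuple T) :
  dot (tcons (x, v)) (tcons (y, w)) = x * y + dot v w.
Proof.
rewrite /dot big_ord_recl !tnth_tcons0; congr (_ + _).
by apply: eq_bigr => i _; rewrite !tnth_tconsS.
Qed.

Lemma dotxx_ge0 n (x : n.-tuple T) : 0 <= dot x x.
Proof. by apply: sumr_ge0 => i _; rewrite -expr2 sqr_ge0. Qed.

Lemma sqr_enorm n (x : n.-tuple T) : enorm x ^+ 2 = dot x x.
Proof. by rewrite sqr_sqrtr// dotxx_ge0. Qed.

Lemma enorm_ge0 n (x : n.-tuple T) : 0 <= enorm x.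
Proof. exact: sqrtr_ge0. Qed.

Lemma enorm_tcons n (x : T) (v : n.-tuple T) : enorm (tcons (x, v)) ^+ 2 = x ^+ 2 + enorm v ^+ 2.
Proof. by rewrite !sqr_enorm dot_tcons expr2. Qed.

Lemma enorm_zero_vec n : enorm (zero_vec n) = 0.
Proof.
rewrite /enorm /dot big1 ?sqrtr0// => i _.
by rewrite tnth_mktuple mul0r.
Qed.

Lemma zero_vecS n : zero_vec n.+1 = tcons (0 : T, zero_vec n).
Proof.
apply: eq_from_tnth => i; case: (unliftP ord0 i) => [j ->|->].
  by rewrite tnth_tconsS !tnth_mktuple.
by rewrite tnth_tcons0 tnth_mktuple.
Qed.

(** By induction the tail is brought to its first axis; a rotation of the first two
    coordinates then absorbs it. In dimension 1 no rotation is available, which is why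
    the sign of b is controlled only in higher dimension. *)
Lemma gauss_isom_axis n (x : n.+1.-tuple T) : exists M : 'M[R]_n.+1, exists b : R,
  [/\ gauss_isom M, lin_act M x = tcons (b, zero_vec n), b ^+ 2 = enorm x ^+ 2 &
      (0 < n)%N -> 0 <= b].
Proof.
elim: n x => [|n IH] x.
  exists 1%:M, (tnth x ord0); split => //; first exact: gauss_isom1.
    rewrite lin_act1 [LHS]tcons_eta; congr (tcons (_, _)).
    by apply: eq_from_tnth; case.
  rewrite [in RHS](tcons_eta x) enorm_tcons -[LHS]addr0; congr (_ + _).
  by rewrite /enorm /dot big_ord0 sqrtr0 expr0n.
rewrite (tcons_eta x); set x0 := tnth x ord0; set v := [tuple _ | i < _].
have [M [b [iM Mv bE _]]] := IH v.
pose r := Num.sqrt (x0 ^+ 2 + b ^+ 2).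
have r2 : r ^+ 2 = x0 ^+ 2 + b ^+ 2 by rewrite sqr_sqrtr// addr_ge0// sqr_ge0.
have [c [s [cs cr sr]]] : exists c, exists s,
    [/\ c ^+ 2 + s ^+ 2 = 1, c * x0 - s * b = r & s * x0 + c * b = 0].
  have [r0|r0] := eqVneq r 0.
    exists 1, 0; move: r2; rewrite r0 expr0n/= => /esym/eqP.
    rewrite paddr_eq0 ?sqr_ge0// !sqrf_eq0 => /andP[/eqP -> /eqP ->].
    by split; ring.
  exists (x0 / r), (- b / r); split.
  - rewrite !exprMn sqrrN -mulrDl -r2 exprVn divff//.
    by rewrite expf_neq0.
  - transitivity (r ^+ 2 / r); first by rewrite r2; ring.
    by rewrite expr2 mulfK.
  - ring.
exists (rot_mx n c s *m cons_mx M), r; split.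
- by apply: gauss_isomM; [exact: gauss_isom_rot|exact: gauss_isom_cons].
- by rewrite lin_actM lin_act_cons_mx Mv lin_act_rot_mx cr sr zero_vecS.
- by rewrite enorm_tcons -bE.
- by rewrite sqrtr_ge0.
Qed.

(** A QR decomposition. The first vector is moved to the first axis, and the induction
    hypothesis is applied to the tails of the others, which leaves the first axis fixed.
    Only the last diagonal entry may be negative, because gauss_isom_axis leaves the
    sign free in dimension 1. *)
Lemma gauss_isom_triangular n (u : nat -> n.-tuple T) : exists M : 'M[R]_n,
  gauss_isom M /\ forall i j : 'I_n,
    ((i < j)%N -> tnth (lin_act M (u i)) j = 0) /\
    ((i.+1 < n)%N -> 0 <= tnth (lin_act M (u i)) i).
Proof.
elim: n u => [|n IH] u; first by exists 1%:M; split; [exact: gauss_isom1|case].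
have [M1 [b [iM1 M1u _ b0]]] := gauss_isom_axis (u 0).
pose v i : n.-tuple T := [tuple tnth (lin_act M1 (u i.+1)) (lift ord0 j) | j < n].
have [M [iM Mv]] := IH v.
exists (cons_mx M *m M1); split; first by apply: gauss_isomM => //; exact: gauss_isom_cons.
have Mu i : lin_act (cons_mx M *m M1) (u i.+1) =
    tcons (tnth (lin_act M1 (u i.+1)) ord0, lin_act M (v i)).
  by rewrite lin_actM [X in lin_act _ X]tcons_eta lin_act_cons_mx.
have Mu0 : lin_act (cons_mx M *m M1) (u 0) = tcons (b, zero_vec n).
  rewrite lin_actM M1u lin_act_cons_mx; congr (tcons (_, _)).
  apply: eq_from_tnth => i; rewrite tnth_lin_act tnth_mktuple big1// => j _.
  by rewrite tnth_mktuple mulr0.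
move=> i j; case: (unliftP ord0 i) => [i' ->|->]; last first.
  rewrite Mu0; split => [|n0]; last by rewrite tnth_tcons0 b0.
  case: (unliftP ord0 j) => [j' ->|->//] _.
  by rewrite tnth_tconsS tnth_mktuple.
rewrite lift0 Mu; split => [|n0]; last first.
  by rewrite -lift0 tnth_tconsS; apply: (Mv i' i').2.
case: (unliftP ord0 j) => [j' ->|->//]; rewrite lift0 => ij.
by rewrite tnth_tconsS; apply: (Mv i' j').1.
Qed.

End gauss_invariance.

(** * Gaussian mass of an interval *)

Section gauss_intervals.
Context (R : realType).
Local Notation T := (measurableTypeR R).

Definition gauss_itv (a b : R) : R := fine (std_gauss (`]a, b]%classic : set T)).

Lemma gauss_itvE a b : std_gauss (`]a, b]%classic : set T) = (gauss_itv a b)%:E.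
Proof. by rewrite /gauss_itv fineK// fin_num_measure. Qed.

Lemma gauss_itv_ge0 a b : 0 <= gauss_itv a b.
Proof. by rewrite /gauss_itv fine_ge0. Qed.

Lemma normal_pdf01_le1 (x : R) : normal_pdf 0 1 x <= 1.
Proof.
rewrite normal_pdf01 mulr_ile1 ?expR_ge0 ?invr_ge0 ?sqrtr_ge0//.
  have p1 : 1 <= 2 * pi :> R by have := pi_ge2 R; lra.
  rewrite invf_le1; last by rewrite sqrtr_gt0; lra.
  by rewrite -[leLHS]sqrtr1 ler_sqrt//; lra.
rewrite -[leRHS]expR0 ler_expR.
have := sqr_ge0 x; lra.
Qed.

Lemma gauss_itv_ub a b : a <= b -> gauss_itv a b <= b - a.
Proof.
move=> ab; rewrite -lee_fin -gauss_itvE std_gaussE.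
apply: (@le_trans _ _ (\int[lebesgue_measure]_(x in (`]a, b]%classic : set T)) (cst 1%:E x))%E).
  apply: ge0_le_integral => //=.
  - by move=> x _; rewrite lee_fin normal_pdf_ge0.
  - by apply/measurable_EFinP/measurable_funTS; exact: measurable_normal_pdf.
  - by move=> x _; rewrite lee_fin normal_pdf01_le1.
rewrite integral_cst//= mul1e lebesgue_measure_itv/= lte_fin.
by case: ifPn => // _; rewrite lee_fin subr_ge0.
Qed.

Lemma gauss_itv_lb (K a b : R) : - K <= a -> a <= b -> b <= K ->
  (b - a) * normal_pdf 0 1 K <= gauss_itv a b.
Proof.
move=> Ka ab bK; rewrite -lee_fin -gauss_itvE std_gaussE.
apply: (@le_trans _ _ (\int[lebesgue_measure]_(x in (`]a, b]%classic : set T)) (cst (normal_pdf 0 1 K)%:E x))%E).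
  rewrite integral_cst//= lebesgue_measure_itv/= lte_fin.
  case: ifPn => [_|]; first by rewrite -EFinD -EFinM mulrC.
  by rewrite -leNgt => ba; rewrite (_ : b = a) ?subrr ?mul0r ?mule0//; lra.
apply: ge0_le_integral => //=.
- by move=> x _; rewrite lee_fin normal_pdf_ge0.
- by apply/measurable_EFinP/measurable_funTS; exact: measurable_normal_pdf.
- move=> x; rewrite in_itv/= => /andP[ax xb].
  rewrite lee_fin !normal_pdf01 ler_pM2l ?invr_gt0 ?sqrtr_gt0 ?mulr_gt0 ?pi_gt0//.
  rewrite ler_expR ler_pM2r// lerN2 -[x ^+ 2]real_normK ?num_real//.
  by rewrite lerXn2r ?nnegrE ?normr_ge0// ?ler_norml; lra.
Qed.

Lemma normal_pdf01_gt0 (x : R) : 0 < normal_pdf 0 1 x.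
Proof.
by rewrite normal_pdf01 mulr_gt0 ?expR_gt0// invr_gt0 sqrtr_gt0 mulr_gt0// pi_gt0.
Qed.

Lemma gauss_itv_gt0 a b : a < b -> 0 < gauss_itv a b.
Proof.
move=> ab; pose K := Num.max `|a| `|b|.
have : (b - a) * normal_pdf 0 1 K <= gauss_itv a b.
  apply: gauss_itv_lb; last by rewrite le_max [b <= `|b|]ler_norm orbT.
    by rewrite lerNl le_max -normrN ler_norm.
  exact: ltW.
by apply: lt_le_trans; rewrite mulr_gt0 ?subr_gt0// normal_pdf01_gt0.
Qed.

Lemma gauss_itvD a b c : a <= b -> b <= c ->
  gauss_itv a c = gauss_itv a b + gauss_itv b c.
Proof.
move=> ab bc; apply: EFin_inj; rewrite EFinD -!gauss_itvE -measureU//.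
  congr (std_gauss _); apply/esym; rewrite -itv_bndbnd_setU//.
apply/seteqP; split => // x [] /=; rewrite !in_itv/= => /andP[_ xb] /andP[bx _].
by move: xb; rewrite leNgt bx.
Qed.

Lemma std_gauss_set1 a : std_gauss [set a : T] = 0%E.
Proof.
have /null_content_dominatesP dom := normal_prob_dominates (0 : R) 1.
apply: (dom [set a : T]); first exact: measurable_set1.
exact: lebesgue_measure_set1.
Qed.

(** The density is at most 1, so each endpoint contributes at most h. *)
Lemma gauss_itv_widen a b h : a <= b -> 0 <= h ->
  gauss_itv (a - h) (b + h) <= gauss_itv a b + 2 * h.
Proof.
move=> ab h0; rewrite (@gauss_itvD _ a); [|lra|lra].
rewrite (@gauss_itvD a b); [|lra|lra].
have := @gauss_itv_ub (a - h) a; have := @gauss_itv_ub b (b + h); lra.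
Qed.

Lemma gauss_itv_shrink a b h : a <= b -> 0 <= h ->
  gauss_itv a b <= gauss_itv (a + h) (b - h) + 2 * h.
Proof.
move=> ab h0; have [abh|abh] := leP (a + h) (b - h).
  rewrite (@gauss_itvD _ (a + h)); [|lra|lra].
  rewrite (@gauss_itvD (a + h) (b - h)); [|lra|lra].
  have := @gauss_itv_ub (b - h) b; have := @gauss_itv_ub a (a + h); lra.
by have := gauss_itv_ub ab; have := gauss_itv_ge0 (a + h) (b - h); lra.
Qed.

End gauss_intervals.

(** * Uniqueness of invariant measures by double counting *)

Section kernel_comparison.
Context d (T : measurableType d) (R : realType).
Local Open Scope ereal_scope.

Lemma probability_setI_full (P : probability T R) (A D : set T) :
  measurable A -> measurable D -> P D = 1 -> P (A `&` D) = P A.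
Proof.
move=> mA mD PD; suff PAD : P (A `\` D) = 0.
  by rewrite [RHS](measureDI P mA mD) [X in X + _](PAD : _ = 0) add0e.
apply/eqP; rewrite eq_le measure_ge0 andbT.
have <- : P (~` D) = 0 by rewrite probability_setC// PD subee.
by apply: le_measure; rewrite ?inE; [exact: measurableD|exact: measurableC|move=> x []].
Qed.

Variables (E : set (T * T)) (D : set T).
Hypotheses (mE : measurable E) (mD : measurable D).
Hypothesis symE : forall x y, E (x, y) -> E (y, x).
Hypothesis ED : forall x y, E (x, y) -> D y.

(** The pairs of E that start in A all end in B. Integrating first over the end of the
    pair gives mu A * hnu, integrating first over the start gives at most nu B * hmu. *)
Lemma kernel_double_count (mu nu : probability T R) (hmu hnu : \bar R) (A B : set T) :
  measurable A -> measurable B -> mu D = 1 ->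
  (forall x, D x -> mu (xsection E x) = hmu) ->
  (forall x, D x -> nu (xsection E x) = hnu) ->
  (forall x y, A x -> E (x, y) -> B y) -> 0 <= hmu -> 0 <= hnu ->
  mu A * hnu <= nu B * hmu.
Proof.
move=> mA mB muD Emu Enu AB hmu0 hnu0.
have mAD : measurable (A `&` D) by exact: measurableI.
have mBD : measurable (B `&` D) by exact: measurableI.
rewrite -(probability_setI_full mA mD muD).
apply: (@le_trans _ _ (nu (B `&` D) * hmu)); last first.
  by rewrite lee_wpmul2r// le_measure// ?inE.
pose W1 := E `&` ((A `&` D) `*` setT); pose W2 := E `&` (setT `*` (B `&` D)).
have mW1 : measurable W1 by apply: measurableI => //; exact: measurableX.
have mW2 : measurable W2 by apply: measurableI => //; exact: measurableX.
have -> : mu (A `&` D) * hnu = \int[mu]_x nu (xsection W1 x).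
  rewrite (measureE_indic _ mAD) -ge0_integralZr//; last exact/measurable_EFinP/measurable_indic.
  apply: eq_integral => x _; rewrite indicE; case: (boolP (x \in A `&` D)) => xAD.
    rewrite mul1e -(Enu x); last by move: xAD; rewrite inE => -[].
    congr (nu _); apply/seteqP; split => y; rewrite /xsection/= !inE /W1 /=.
      by move=> Exy; split => //; split => //; rewrite inE in xAD.
    by case.
  rewrite mul0e (_ : xsection W1 x = set0) ?measure0//.
  apply/seteqP; split => // y; rewrite /xsection/= inE /W1/= => -[_ [xAD' _]].
  by rewrite notin_setE in xAD.
have -> : nu (B `&` D) * hmu = \int[nu]_y mu (ysection W2 y).
  rewrite (measureE_indic _ mBD) -ge0_integralZr//; last exact/measurable_EFinP/measurable_indic.
  apply: eq_integral => x _; rewrite indicE; case: (boolP (x \in B `&` D)) => xBD.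
    rewrite mul1e -(Emu x); last by move: xBD; rewrite inE => -[].
    congr (mu _); apply/seteqP; split => y; rewrite /xsection/ysection/= !inE /W2 /=.
      by move=> /symE Exy; split => //; split => //; rewrite inE in xBD.
    by case=> /symE.
  rewrite mul0e (_ : ysection W2 x = set0) ?measure0//.
  apply/seteqP; split => // y; rewrite /ysection/= inE /W2/= => -[_ [_ xBD']].
  by rewrite notin_setE in xBD.
have := @indic_fubini_tonelli _ _ T T R mu nu W2 mW2.
rewrite (indic_fubini_tonelli_FE nu mW2) (indic_fubini_tonelli_GE mu mW2) => <-.
apply: ge0_le_integral => //.
- exact: (measurable_fun_xsection nu mW1).
- exact: (measurable_fun_xsection nu mW2).
move=> x _; rewrite le_measure ?inE//=.
- exact: measurable_xsection.
- exact: measurable_xsection.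
move=> y; rewrite /xsection/= !inE /W1 /W2/= => -[Exy [[Ax Dx] _]].
split => //; split => //; split; first exact: AB Exy.
exact: ED Exy.
Qed.

(** With A and B the whole space, kernel_double_count shows that the sections of E have
    the same mass for both measures; this common factor then cancels. It is the usual
    proof that an invariant measure is unique, with E a neighbourhood of the diagonal:
    instead of letting E shrink, it compares A with a set B that contains its
    E-neighbourhood. *)
Lemma kernel_compare (mu nu : probability T R) (hmu hnu : \bar R) (A B : set T) :
  measurable A -> measurable B -> mu D = 1 -> nu D = 1 ->
  (forall x, D x -> mu (xsection E x) = hmu) ->
  (forall x, D x -> nu (xsection E x) = hnu) ->
  (forall x y, A x -> E (x, y) -> B y) -> 0 < hmu -> hmu <= 1 -> 0 <= hnu ->
  mu A <= nu B /\ nu A <= mu B.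
Proof.
move=> mA mB muD nuD Emu Enu AB hmu0 hmu1 hnu0; have hmu0' := ltW hmu0.
have le1 : 1 * hnu <= 1 * hmu.
  by have := kernel_double_count measurableT measurableT muD Emu Enu (fun _ _ _ _ => I) hmu0' hnu0;
     rewrite !probability_setT.
have le2 : 1 * hmu <= 1 * hnu.
  by have := kernel_double_count measurableT measurableT nuD Enu Emu (fun _ _ _ _ => I) hnu0 hmu0';
     rewrite !probability_setT.
have hE : hnu = hmu by apply/eqP; rewrite eq_le -[hnu]mul1e -[hmu]mul1e le1 le2.
have fh : hmu \is a fin_num.
  by rewrite ge0_fin_numE// (le_lt_trans hmu1)// ltry.
have := kernel_double_count mA mB muD Emu Enu AB hmu0' hnu0.
have := kernel_double_count mA mB nuD Enu Emu AB hnu0 hmu0'.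
by rewrite hE !lee_pmul2r// => -> ->.
Qed.

End kernel_comparison.

(** * Caps, and the direction of a Gaussian vector *)

Section caps.
Context (R : realType).
Local Notation T := (measurableTypeR R).

Lemma measurable_dot d (U : measurableType d) n (f g : U -> n.-tuple T) :
  measurable_fun setT f -> measurable_fun setT g ->
  measurable_fun setT (fun z => dot (f z) (g z)).
Proof.
move=> mf mg; apply: measurable_sum => j.
by apply: measurable_funM;
  [apply: (measurableT_comp (measurable_tnth j))|apply: (measurableT_comp (measurable_tnth j))].
Qed.

Lemma measurable_enorm d (U : measurableType d) n (f : U -> n.-tuple T) :
  measurable_fun setT f -> measurable_fun setT (fun z => enorm (f z)).
Proof.
move=> mf; apply: (measurableT_comp (f := (@Num.sqrt R) : T -> T)).
  by apply: continuous_measurable_fun; exact: sqrt_continuous.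
exact: measurable_dot.
Qed.

Lemma dotC n (x y : n.-tuple T) : dot x y = dot y x.
Proof. by apply: eq_bigr => i _; rewrite mulrC. Qed.

Lemma enorm_eq0 n (x : n.-tuple T) : enorm x = 0 -> forall i, tnth x i = 0.
Proof.
move=> x0 i; have : dot x x = 0 by rewrite -sqr_enorm x0 expr0n.
rewrite /dot => /psumr_eq0P H; apply/eqP; rewrite -sqrf_eq0 expr2.
by apply/eqP/H => // j _; rewrite -expr2 sqr_ge0.
Qed.

Lemma dot_zero_vec n (v : n.-tuple T) : dot (zero_vec R n) v = 0.
Proof. by rewrite /dot big1// => i _; rewrite tnth_mktuple mul0r. Qed.

Lemma enorm_axis n : enorm (tcons (1 : T, zero_vec R n)) = 1.
Proof.
apply/eqP; rewrite -(@eqrXn2 _ 2) ?enorm_ge0//.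
by rewrite enorm_tcons enorm_zero_vec expr1n expr0n addr0.
Qed.

(** Pairs of vectors whose angle has cosine above 1 - delta. The norms are not fixed to
    1, so that the same relation serves for measures carried by the sphere and for the
    Gaussian measure, which charges only the nonzero vectors. *)
Definition cap n (delta : R) : set (n.-tuple T * n.-tuple T) :=
  [set z | (1 - delta) * (enorm z.1 * enorm z.2) < dot z.1 z.2].

Definition nonzero n : set (n.-tuple T) := [set x | 0 < enorm x].

Lemma measurable_cap n delta : measurable (@cap n delta).
Proof.
apply: measurable_setb; apply: measurable_fun_ltr; last exact: measurable_dot.
apply: measurable_funM => //.
by apply: measurable_funM; exact: measurable_enorm.
Qed.

Lemma measurable_nonzero n : measurable (@nonzero n).
Proof.
apply: measurable_setb; apply: measurable_fun_ltr => //.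
exact: measurable_enorm.
Qed.

Lemma measurable_usphere n : measurable (@usphere R n).
Proof.
rewrite (_ : @usphere R n = [set x | enorm x == 1]); last first.
  by apply/seteqP; split => x /=; move/eqP.
apply: measurable_setb; apply: measurable_fun_eqr => //.
exact: measurable_enorm.
Qed.

Lemma cap_sym n delta (x y : n.-tuple T) : cap delta (x, y) -> cap delta (y, x).
Proof. by rewrite /cap/= dotC (mulrC (enorm x)). Qed.

Lemma cap_nonzero n delta (x y : n.-tuple T) : cap delta (x, y) -> nonzero y.
Proof.
rewrite /cap/nonzero/= => H; rewrite lt_neqAle enorm_ge0 andbT.
apply/eqP => /esym y0; move: H; rewrite y0 !mulr0.
by rewrite /dot big1 ?ltxx// => i _; rewrite (enorm_eq0 y0) mulr0.
Qed.

Definition isom_invariant n (P : probability (n.-tuple T) R) := forall M : 'M[R]_n,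
  gauss_isom M -> forall A, measurable A -> P (lin_act M @^-1` A) = P A.

(** An invariant measure gives the same mass to all caps, as any direction can be moved
    to the first axis. *)
Lemma cap_invariant n delta (P : probability (n.+2.-tuple T) R) x :
  isom_invariant P -> nonzero x ->
  P (xsection (cap delta) x) = P (xsection (cap delta) (tcons (1 : T, zero_vec R n.+1))).
Proof.
move=> iP x0; have [M [b [iM Mx b2 b0]]] := gauss_isom_axis x.
have bE : b = enorm x.
  by apply/eqP; rewrite -(@eqrXn2 _ 2) ?b0 ?enorm_ge0//; apply/eqP.
rewrite -[RHS](iP M iM); last by apply: measurable_xsection; exact: measurable_cap.
have key y : cap delta (x, y) = cap delta (tcons (1 : T, zero_vec R n.+1), lin_act M y).
  rewrite /cap/= -(enorm_lin_act y iM.1) -(dot_lin_act x y iM.1) Mx -bE enorm_axis.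
  rewrite (tcons_eta (lin_act M y)) !dot_tcons !dot_zero_vec.
  by rewrite !addr0 !mul1r mulrCA ltr_pM2l// bE.
by congr (P _); apply/seteqP; split => y; rewrite /xsection/= !inE key.
Qed.

Lemma uniform_isom_invariant n (sigma : probability (n.-tuple T) R) :
  uniform_on_usphere sigma -> isom_invariant sigma.
Proof. by move=> [_ iS] M [MM _] A mA; exact: iS. Qed.

Lemma gauss_vec_isom_invariant n : isom_invariant (gauss_vec R n).
Proof. by move=> M [_ iM] A mA; exact: iM. Qed.

Lemma uniform_nonzero n (sigma : probability (n.-tuple T) R) :
  uniform_on_usphere sigma -> sigma (@nonzero n) = 1%E.
Proof.
move=> [s1 _]; apply/eqP; rewrite eq_le probability_le1//=; last exact: measurable_nonzero.
rewrite -s1 le_measure ?inE//; last first.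
- by move=> x /= x1; rewrite /nonzero/= x1.
- exact: measurable_nonzero.
exact: measurable_usphere.
Qed.

Lemma gauss_nonzero n : gauss_vec R n.+1 (@nonzero n.+1) = 1%E.
Proof.
rewrite -[@nonzero _]setCK probability_setC; last by apply: measurableC; exact: measurable_nonzero.
suff -> : gauss_vec R n.+1 (~` @nonzero n.+1) = 0%E by rewrite sube0.
pose A (i : 'I_n.+1) : set T := if i == ord0 then [set 0 : T] else setT.
have mA i : measurable (A i) by rewrite /A; case: ifP.
have : gauss_vec R n.+1 [set t | forall i, A i (tnth t i)] = 0%E.
  by rewrite /gauss_vec power_probE// (bigD1 ord0)//= /A eqxx std_gauss_set1 mul0e.
move=> A0; apply/eqP; rewrite eq_le measure_ge0 andbT -A0 le_measure ?inE//.
- by apply: measurableC; exact: measurable_nonzero.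
- by apply: measurable_forall_ord => i; apply: measurable_preimage => //; exact: measurable_tnth.
- move=> x; rewrite /nonzero/= => /negP; rewrite -leNgt => x0 i.
  rewrite /A; case: eqP => // ->; apply: enorm_eq0; apply/eqP.
  by rewrite eq_le x0 enorm_ge0.
Qed.

(** The cap contains a product of nondegenerate intervals. *)
Lemma gauss_cap_gt0 n delta : 0 < delta -> delta < 1 ->
  (0 < gauss_vec R n.+1 (xsection (cap delta) (tcons (1%R : T, zero_vec R n))))%E.
Proof.
move=> d0 d1.
pose s := delta / n.+1%:R.
have s0 : 0 < s by rewrite divr_gt0.
pose A (i : 'I_n.+1) : set T := if i == ord0 then `]1, 2]%classic else `](-s), s]%classic.
have mA i : measurable (A i) by rewrite /A; case: ifP.
have gA : (0 < gauss_vec R n.+1 [set t | forall i, A i (tnth t i)])%E.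
  rewrite /gauss_vec power_probE//; apply: (big_ind (fun x => 0 < x)%E) => [||i _]; [by rewrite lte01|exact: mule_gt0|].
  rewrite /A; case: ifP => _.
    by rewrite gauss_itvE lte_fin gauss_itv_gt0//; lra.
  by rewrite gauss_itvE lte_fin gauss_itv_gt0//; lra.
apply: (lt_le_trans gA); rewrite le_measure ?inE//.
- by apply: measurable_forall_ord => i; apply: measurable_preimage => //; exact: measurable_tnth.
- by apply: measurable_xsection; exact: measurable_cap.
move=> t tA; rewrite /xsection/= inE /cap/=.
have := tA ord0; rewrite /A eqxx /= in_itv/= => /andP[t1 _].
have tt : dot t t <= (tnth t ord0) ^+ 2 + delta ^+ 2.
  rewrite /dot big_ord_recl -expr2 lerD2l.
  apply: (@le_trans _ _ (\sum_(i < n) s ^+ 2)).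
    apply: ler_sum => i _; rewrite -expr2.
    have := tA (lift ord0 i); rewrite /A /= in_itv/= => /andP[ts1 ts2].
    rewrite -[leLHS]real_normK ?num_real// lerXn2r ?nnegrE//; first exact: ltW.
    by rewrite ler_norml ts2 andbT ltW.
  rewrite sumr_const card_ord -mulr_natr /s expr_div_n -mulrA ler_piMr ?sqr_ge0//.
  rewrite mulrC ler_pdivrMr ?exprn_gt0 ?ltr0n// mul1r -natrX ler_nat.
  by rewrite (leq_trans (leqnSn n))// -{1}(expn1 n.+1) leq_pexp2l.
have -> : dot (tcons (1 : T, zero_vec R n)) t = tnth t ord0.
  by rewrite (tcons_eta t) dot_tcons mul1r tnth_tcons0 dot_zero_vec addr0.
rewrite enorm_axis mul1r; set a := tnth t ord0 in t1 tt *.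
have a0 : 0 <= a by apply: ltW; rewrite (lt_trans _ t1).
rewrite -ltr_sqr ?nnegrE ?mulr_ge0 ?enorm_ge0//; last by rewrite subr_ge0 ltW.
rewrite exprMn sqr_enorm; apply: (@le_lt_trans _ _ ((1 - delta) ^+ 2 * (a ^+ 2 + delta ^+ 2))).
  by rewrite ler_pM2l// exprn_gt0// subr_gt0.
have a1 : 1 < a ^+ 2 by rewrite exprn_egt1.
rewrite -subr_gt0.
have -> : a ^+ 2 - (1 - delta) ^+ 2 * (a ^+ 2 + delta ^+ 2) =
  delta * ((2 - delta) * (a ^+ 2 - 1) + (1 - delta) * 2 + delta * delta * (2 - delta)) by ring.
rewrite mulr_gt0// !addr_gt0 ?mulr_gt0//; lra.
Qed.

(** The direction of a Gaussian vector is uniform. The statement allows for the opening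
    of a cap between A and B, which avoids a limiting argument and costs nothing later
    on, when the windows may be moved slightly anyway. *)
Lemma uniform_gauss_compare n delta (sigma : probability (n.+2.-tuple T) R)
    (A B : set (n.+2.-tuple T)) :
  uniform_on_usphere sigma -> 0 < delta -> delta < 1 ->
  measurable A -> measurable B ->
  (forall x y, A x -> cap delta (x, y) -> B y) ->
  (gauss_vec R n.+2 A <= sigma B)%E /\ (sigma A <= gauss_vec R n.+2 B)%E.
Proof.
move=> sU d0 d1 mA mB AB.
set e := tcons (1 : T, zero_vec R n.+1).
have KC := @kernel_compare _ _ R (cap delta) (@nonzero n.+2) (@measurable_cap n.+2 delta)
  (@measurable_nonzero n.+2) (@cap_sym _ delta) (@cap_nonzero _ delta)
  (gauss_vec R n.+2) sigma (gauss_vec R n.+2 (xsection (cap delta) e))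
  (sigma (xsection (cap delta) e)) A B mA mB.
apply: (KC _ _ _ _ AB).
- exact: gauss_nonzero.
- exact: uniform_nonzero.
- by move=> x; apply: cap_invariant; exact: gauss_vec_isom_invariant.
- by move=> x; apply: cap_invariant; exact: uniform_isom_invariant.
- exact: gauss_cap_gt0.
- by apply: probability_le1; apply: measurable_xsection; exact: measurable_cap.
- exact: measure_ge0.
Qed.

End caps.

(** * Splitting off the first coordinates *)

Section split.
Context d (T : measurableType d) (R : realType) (P : probability T R).

Definition tcat k m (p : k.-tuple T * m.-tuple T) : (k + m).-tuple T :=
  [tuple of p.1 ++ p.2].

Lemma measurable_tcat k m : measurable_fun setT (@tcat k m).
Proof.
apply/measurable_fun_tnthP => i; case: (split_ordP i) => j ->.
  rewrite (_ : _ \o _ = fun p => tnth p.1 j); last first.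
    by apply/funext => p /=; rewrite tnth_lshift.
  exact: (measurableT_comp (measurable_tnth j) measurable_fst).
rewrite (_ : _ \o _ = fun p => tnth p.2 j); last first.
  by apply/funext => p /=; rewrite tnth_rshift.
exact: (measurableT_comp (measurable_tnth j) measurable_snd).
Qed.

Lemma tcat_tcons k m x (y : k.-tuple T) (z : m.-tuple T) :
  tcat (tcons (x, y), z) = tcons (x, tcat (y, z)).
Proof. exact: val_inj. Qed.

(** Fubini for the splitting of k + m independent coordinates into the first k and the
    last m, by moving one coordinate at a time. *)
Lemma integral_power_prob_tcat k m (F : (k + m).-tuple T -> \bar R) :
  measurable_fun setT F -> (forall t, 0 <= F t)%E ->
  (\int[power_prob P (k + m)]_t F t =
   \int[power_prob P m]_z \int[power_prob P k]_y F (tcat (y, z)))%E.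
Proof.
elim: k F => [|k IH] F mF F0.
  apply: eq_integral => z _ /=; rewrite integral_dirac//.
    by rewrite diracT mul1e; congr F; exact: val_inj.
  apply: (measurableT_comp mF).
  by apply: (measurableT_comp (@measurable_tcat 0 m)); exact: measurable_pair2.
rewrite (integral_power_probS P (N := k + m) mF F0).
have mG : measurable_fun setT (fun p : (T * m.-tuple T) * k.-tuple T =>
    F (tcons (p.1.1, tcat (p.2, p.1.2)))).
  apply: (measurableT_comp mF); apply: (measurableT_comp (@measurable_tcons _ T (k + m))).
  apply/measurable_fun_pairP; split => /=.
    exact: (measurableT_comp measurable_fst measurable_fst).
  apply: (measurableT_comp (@measurable_tcat k m)).
  apply/measurable_fun_pairP; split => /=; first exact: measurable_snd.
  exact: (measurableT_comp measurable_snd measurable_fst).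
have mH := measurable_fun_fubini_tonelli_F (m2 := power_prob P k) _ mG (fun p => F0 _).
transitivity (\int[P]_x \int[power_prob P m]_z
    fubini_F (power_prob P k) (fun p : (T * m.-tuple T) * k.-tuple T =>
    F (tcons (p.1.1, tcat (p.2, p.1.2)))) (x, z))%E.
  apply: eq_integral => x _; apply: IH => //.
  exact: (measurableT_comp mF (@measurable_tcons_r _ T (k + m) x)).
rewrite (fubini_tonelli _ mH); last by move=> p; apply: integral_ge0.
apply: eq_integral => z _; have mFz : measurable_fun setT (fun y : k.+1.-tuple T => F (tcat (y, z))).
  apply: (measurableT_comp mF).
  by apply: (measurableT_comp (@measurable_tcat k.+1 m)); exact: measurable_pair2.
apply: (etrans _ (esym (integral_power_probS P mFz (fun y => F0 _)))).
by apply: eq_integral => x _; apply: eq_integral => y _; rewrite tcat_tcons.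
Qed.

End split.

(** * The squared length of a Gaussian vector *)

Section chi_square.
Context (R : realType).
Local Notation T := (measurableTypeR R).

Lemma measurable_expR_sqr (t c : R) : measurable_fun setT (fun x : T => expR (t * (x ^+ 2 - c))).
Proof.
apply: measurableT_comp => //; apply: measurable_funM => //.
by apply: measurable_funB => //; exact: measurable_funX.
Qed.

(** The integrand times the standard density is a multiple of the normal density with
    variance 1 / (1 - 2 * t). *)
Lemma gauss_mgf (t : R) : 2 * t < 1 ->
  (\int[std_gauss]_x (expR (t * (x ^+ 2 - 1)))%:E =
   (expR (- t) * (Num.sqrt (1 - 2 * t))^-1)%:E)%E.
Proof.
move=> t1; pose s := (Num.sqrt (1 - 2 * t))^-1.
have s0 : 0 < s by rewrite invr_gt0 sqrtr_gt0 subr_gt0.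
have s2 : s ^+ 2 = (1 - 2 * t)^-1 by rewrite exprVn sqr_sqrtr// subr_ge0 ltW.
rewrite integral_std_gauss; last 2 first.
- apply/measurable_EFinP; exact: measurable_expR_sqr.
- by move=> x; rewrite lee_fin expR_ge0.
transitivity (\int[lebesgue_measure]_x ((expR (- t) * s)%:E * (normal_pdf 0 s x)%:E))%E.
  apply: eq_integral => x _; rewrite -!EFinM; congr EFin.
  rewrite normal_pdf01 normal_pdfE ?gt_eqF// /normal_peak /normal_fun subr0.
  have -> : Num.sqrt (s ^+ 2 * pi *+ 2) = s * Num.sqrt (2 * pi).
    by rewrite -mulrnAr sqrtrM ?sqr_ge0// sqrtr_sqr gtr0_norm// mulr_natl.
  have -> : - x ^+ 2 / (s ^+ 2 *+ 2) = - x ^+ 2 * (1 - 2 * t) / 2.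
    by rewrite s2 -[_ *+ 2]mulr_natr invfM invrK mulrA.
  rewrite invfM mulrCA -expRD; set q := (Num.sqrt (2 * pi))^-1; set E := expR (_ / 2).
  transitivity (s * s^-1 * (q * (expR (- t) * E))); last by ring.
  by rewrite mulfV ?gt_eqF// mul1r -expRD; congr (_ * expR _); field.
rewrite ge0_integralZl//.
- by rewrite integral_normal_pdf mule1.
- by apply/measurable_EFinP; exact: measurable_normal_pdf.
- by move=> x _; rewrite lee_fin normal_pdf_ge0.
- by rewrite lee_fin mulr_ge0 ?expR_ge0// ltW.
Qed.

(** After squaring, the inequality reads 1 / (1 - r) <= exp (r + 2 * r ^ 2) with
    r = 2 * t. *)
Lemma gauss_mgf_le (t : R) : `|t| <= 4^-1 ->
  (\int[std_gauss]_x (expR (t * (x ^+ 2 - 1)))%:E <= (expR (4 * t ^+ 2))%:E)%E.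
Proof.
rewrite ler_norml => /andP[t1 t2]; rewrite gauss_mgf; last by lra.
rewrite lee_fin; set s := Num.sqrt _.
have s0 : 0 < s by rewrite sqrtr_gt0; lra.
rewrite ler_pdivrMr// -ler_sqr ?nnegrE ?mulr_ge0 ?expR_ge0 ?(ltW s0)//.
rewrite exprMn sqr_sqrtr; last by lra.
rewrite -!expRM_natl.
have h : expR (2 * t + 2 * (2 * t) ^+ 2) * (1 - 2 * t) >= 1.
  apply: (@le_trans _ _ ((1 + (2 * t + 2 * (2 * t) ^+ 2)) * (1 - 2 * t))).
    rewrite -subr_ge0 (_ : _ - _ = (2 * t) ^+ 2 * (1 - 4 * t)); last by ring.
    by rewrite mulr_ge0 ?sqr_ge0//; lra.
  by rewrite ler_wpM2r ?expR_ge1Dx//; lra.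
have -> : expR (2 * (4 * t ^+ 2)) = expR (2 * - t) * expR (2 * t + 2 * (2 * t) ^+ 2).
  by rewrite -expRD; congr expR; ring.
by rewrite -mulrA ler_peMr ?expR_ge0.
Qed.

Lemma gauss_vec_mgf_le m (t : R) : `|t| <= 4^-1 ->
  (\int[gauss_vec R m]_z (expR (t * (dot z z - m%:R)))%:E <=
   (expR (4 * t ^+ 2 * m%:R))%:E)%E.
Proof.
move=> t4.
have mF k : measurable_fun setT (fun z : k.-tuple T => (expR (t * (dot z z - k%:R)))%:E).
  apply/measurable_EFinP; apply: measurableT_comp => //; apply: measurable_funM => //.
  by apply: measurable_funB => //; exact: measurable_dot.
elim: m => [|m IH].
  rewrite /= integral_dirac; [|by []|exact: (mF 0)].
  by rewrite diracT mul1e lee_fin /dot big_ord0 subr0 !mulr0.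
rewrite /gauss_vec (integral_power_probS std_gauss (mF m.+1)); last first.
  by move=> z; rewrite lee_fin expR_ge0.
pose C := expR (4 * t ^+ 2 * m%:R).
apply: (@le_trans _ _ (\int[std_gauss]_x ((expR (t * (x ^+ 2 - 1)))%:E * C%:E))%E).
  have mG := measurableT_comp (mF m.+1) (@measurable_tcons _ T m).
  apply: ge0_le_integral => //.
  - by move=> x _; apply: integral_ge0 => v _; rewrite lee_fin expR_ge0.
  - apply: (measurable_fun_fubini_tonelli_F (m2 := power_prob std_gauss m) _ mG).
    by move=> p /=; rewrite lee_fin expR_ge0.
  - apply: emeasurable_funM => //; apply/measurable_EFinP; exact: measurable_expR_sqr.
  - move=> x _; rewrite (_ : (\int[_]_v _)%E = (\int[power_prob std_gauss m]_v
        ((expR (t * (x ^+ 2 - 1)))%:E * (expR (t * (dot v v - m%:R)))%:E))%E); last first.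
      apply: eq_integral => v _; rewrite dot_tcons -EFinM -expRD; congr (expR _)%:E.
      by rewrite -natr1; ring.
    rewrite ge0_integralZl//.
    + by rewrite lee_wpmul2l// lee_fin expR_ge0.
    + exact: mF.
rewrite ge0_integralZr//; last by rewrite lee_fin expR_ge0.
  2: by apply/measurable_EFinP; exact: measurable_expR_sqr.
apply: (@le_trans _ _ ((expR (4 * t ^+ 2))%:E * C%:E)%E).
  by rewrite lee_wpmul2r ?lee_fin ?expR_ge0//; exact: gauss_mgf_le.
by rewrite -EFinM lee_fin -expRD ler_expR -natr1; lra.
Qed.

End chi_square.

(** * Triangular matrices that are nearly orthogonal *)

Section triangular.
Context (R : realType).
Variables (w : nat -> nat -> R) (k : nat) (kappa : R).
Hypotheses (kappa0 : 0 <= kappa) (kkappa : k%:R * kappa <= 8^-1).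
Hypothesis w_diag : forall i, (i < k)%N -> 0 <= w i i.
Hypothesis w_unit : forall i, (i < k)%N -> \sum_(l < i.+1) w i l ^+ 2 = 1.
Hypothesis w_orth : forall i j, (j < i)%N -> (i < k)%N ->
  `|\sum_(l < j.+1) w i l * w j l| <= kappa.

Let kappa8 i : (i < k)%N -> kappa <= 8^-1.
Proof.
move=> ik; apply: le_trans kkappa; rewrite ler_peMl// ler1n.
exact: leq_trans ik.
Qed.

Let sum_sqr_le (a b : nat -> R) i c : (i <= k)%N ->
  (forall l, (l < i)%N -> `|a l| <= 2 * kappa) -> (forall l, (l < i)%N -> `|b l| <= c) -> 0 <= c ->
  `|\sum_(l < i) a l * b l| <= 2 * k%:R * kappa * c.
Proof.
move=> ik ha hb c0; apply: (le_trans (ler_norm_sum _ _ _)).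
apply: (@le_trans _ _ (\sum_(l < i) (2 * kappa * c))).
  by apply: ler_sum => l _; rewrite normrM ler_pM// ?ha ?hb.
rewrite sumr_const card_ord -[leLHS]mulr_natl -!mulrA mulrCA ler_pM2l//.
by rewrite ler_wpM2r ?mulr_ge0// ler_nat.
Qed.

(** Solving for the coordinates column by column: the scalar product of rows i and j
    determines w i j up to products of entries that are already known to be small, and
    the diagonal entry w j j is close to 1 because row j is a unit vector. *)
Lemma triangular_offdiag_le j i : (j < i)%N -> (i < k)%N -> `|w i j| <= 2 * kappa.
Proof.
elim/ltn_ind: j i => j IH i ji ik.
have jk := ltn_trans ji ik.
have k8 := kappa8 ik.
have IHi l : (l < j)%N -> `|w i l| <= 2 * kappa.
  by move=> lj; apply: IH => //; exact: ltn_trans ji.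
have IHj l : (l < j)%N -> `|w j l| <= 2 * kappa by move=> lj; exact: IH.
have kk0 : 0 <= 2 * kappa by rewrite mulr_ge0.
have hij := sum_sqr_le (ltnW jk) IHi IHj kk0.
have hjj := sum_sqr_le (ltnW jk) IHj IHj kk0.
have := w_unit jk; rewrite big_ord_recr/=.
under eq_bigr do rewrite expr2.
have := w_orth ji ik; rewrite big_ord_recr/=.
have := w_diag jk.
move: hij hjj; set S1 := \sum_(l < j) _; set S2 := \sum_(l < j) _.
have kk : 2 * k%:R * kappa * (2 * kappa) <= kappa / 2.
  have := ler_wpM2r kappa0 kkappa; lra.
move: (2 * _ * _ * _) kk => C kk.
rewrite !ler_norml => /andP[a1 a2] /andP[b1 b2] d0 /andP[c1 c2] e.
have d34 : 3 / 4 <= w j j.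
  have : (w j j) ^+ 2 >= 15 / 16 by lra.
  rewrite leNgt => h; rewrite leNgt; apply: contra h => h; nra.
have : `|w i j| * w j j <= 3 / 2 * kappa.
  by rewrite -[X in _ * X]ger0_norm// -normrM ler_norml; apply/andP; split; lra.
have := normr_ge0 (w i j); rewrite -ler_norml; nra.
Qed.

Lemma triangular_diag_bounds i : (i < k)%N ->
  w i i <= 1 /\ 1 - w i i <= k%:R * kappa / 2.
Proof.
move=> ik; have k8 := kappa8 ik.
have IH l : (l < i)%N -> `|w i l| <= 2 * kappa by move=> li; exact: triangular_offdiag_le.
have kk0 : 0 <= 2 * kappa by rewrite mulr_ge0.
have := sum_sqr_le (ltnW ik) IH IH kk0.
have := w_unit ik; rewrite big_ord_recr/=; under eq_bigr do rewrite expr2.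
have S0 : 0 <= \sum_(l < i) w i l * w i l by apply: sumr_ge0 => l _; rewrite -expr2 sqr_ge0.
have := w_diag ik; move: S0; set S := \sum_(l < i) _ => S0 d0 e.
rewrite ger0_norm// => SC.
have kk : 2 * k%:R * kappa * (2 * kappa) <= k%:R * kappa / 2.
  have : 0 <= k%:R * kappa by rewrite mulr_ge0.
  nra.
have d1 : w i i <= 1 by rewrite leNgt; apply/negP => h; nra.
split => //; nra.
Qed.

Variable y : nat -> R.
Let t i := \sum_(l < i.+1) w i l * y l.

(** The matrix w is close to the identity, so t is close to y. *)
Lemma triangular_apply_close i Y : (i < k)%N -> (forall l, (l <= i)%N -> `|y l| <= Y) ->
  `|t i - y i| <= 4 * k%:R * kappa * Y.
Proof.
move=> ik yY; have Y0 : 0 <= Y by rewrite (le_trans _ (yY 0 _)).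
have h := @sum_sqr_le (w i) y i Y (ltnW ik) (fun l li => triangular_offdiag_le li ik)
  (fun l li => yY l (ltnW li)) Y0.
have [d1 d2] := triangular_diag_bounds ik; have d0 := w_diag ik.
rewrite /t big_ord_recr/= -addrA (le_trans (ler_normD _ _))//.
have -> : w i i * y i - y i = - ((1 - w i i) * y i) by ring.
rewrite normrN normrM (ger0_norm (_ : 0 <= 1 - w i i)) ?subr_ge0//.
have := yY i (leqnn i); have := normr_ge0 (y i).
have : 0 <= k%:R * kappa by rewrite mulr_ge0.
move: h; set S := `|\sum_(l < i) _|; nra.
Qed.

Lemma triangular_solve_le T : (forall i, (i < k)%N -> `|t i| <= T) ->
  forall i, (i < k)%N -> `|y i| <= 2 * T.
Proof.
move=> tT i; elim/ltn_ind: i => i IH ik.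
have T0 : 0 <= T by rewrite (le_trans _ (tT i ik)).
have h := @sum_sqr_le (w i) y i (2 * T) (ltnW ik) (fun l li => triangular_offdiag_le li ik)
  (fun l li => IH l li (ltn_trans li ik)) (mulr_ge0 (ler0n _ _) T0).
have [d1 d2] := triangular_diag_bounds ik; have d0 := w_diag ik.
have := tT i ik; rewrite /t big_ord_recr/=; move: h; set S := \sum_(l < i) _.
move=> h1 h2.
have : `|w i i * y i| <= T + 2 * k%:R * kappa * (2 * T).
  have -> : w i i * y i = (S + w i i * y i) - S by ring.
  by rewrite (le_trans (ler_normB _ _))// lerD.
rewrite normrM (ger0_norm d0).
have kk : 2 * k%:R * kappa * (2 * T) <= T / 2.
  have := ler_wpM2r T0 kkappa; lra.
have d3 : 3 / 4 <= w i i by move: kkappa; lra.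
have := ler_wpM2r (normr_ge0 (y i)) d3; lra.
Qed.

End triangular.

Section radius.
Context (R : realType).

Lemma sqr_close1 (x d : R) : 0 <= x -> `|x ^+ 2 - 1| <= d -> `|x - 1| <= d.
Proof.
move=> x0; rewrite !ler_norml => /andP[h1 h2]; apply/andP; split; nra.
Qed.

Variables (w : nat -> nat -> R) (k : nat) (y lo hi c c' : nat -> R).
Variables (K B s Nr x q : R).
Let t i := \sum_(l < i.+1) w i l * y l.

Hypotheses (K0 : 0 < K) (B0 : 0 <= B) (s0 : 0 < s) (s1 : s <= 1).
Hypotheses (N1 : 1 <= Nr) (kN : k%:R <= Nr).
Hypothesis small : (8 * K + 8 * (K + 1) ^+ 2 + B) * Nr * s <= 8^-1.
Hypothesis w_diag : forall i, (i < k)%N -> 0 <= w i i.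
Hypothesis w_unit : forall i, (i < k)%N -> \sum_(l < i.+1) w i l ^+ 2 = 1.
Hypothesis w_orth : forall i j, (j < i)%N -> (i < k)%N ->
  `|\sum_(l < j.+1) w i l * w j l| <= K * s.
Hypothesis c_itv : forall i, (i < k)%N -> - K <= c i /\ c' i <= K.
Hypothesis lo_close : forall i, (i < k)%N -> `|lo i - c i| <= B * s.
Hypothesis hi_close : forall i, (i < k)%N -> `|hi i - c' i| <= B * s.
Hypotheses (x0 : 0 <= x) (xE : x ^+ 2 = q + s ^+ 2 * \sum_(l < k) y l ^+ 2).

(** A common bound for the constants that appear in box_of_cone and cone_of_box. *)
Definition widening_rate := 16 * K * (K + 1) + 8 * (K + 1) ^+ 3 + 4 * (K + 1)
  + 8 * K ^+ 2 + 2 * K ^+ 3 + 4 * K + B + 1.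
Let eta := widening_rate * (Nr * s + `|q - 1|).

Let Ns0 : 0 <= Nr * s. Proof. by rewrite mulr_ge0 ?(ltW s0)// (le_trans _ N1). Qed.
Let sNs : s <= Nr * s. Proof. by rewrite ler_peMl// ltW. Qed.
Let kappa0 : 0 <= K * s. Proof. by rewrite mulr_ge0 ?ltW. Qed.

Let BNs : 0 <= B * Nr * s. Proof. by rewrite -mulrA mulr_ge0. Qed.
Let KNs : 0 <= K * Nr * s. Proof. by rewrite -mulrA mulr_ge0// ltW. Qed.
Let K1Ns : 0 <= (K + 1) ^+ 2 * Nr * s. Proof. by rewrite -mulrA mulr_ge0// sqr_ge0. Qed.
Let small8 : 8 * (K * Nr * s) <= 8^-1. Proof. move: BNs KNs K1Ns small; lra. Qed.
Let small81 : 8 * ((K + 1) ^+ 2 * Nr * s) <= 8^-1. Proof. move: BNs KNs K1Ns small; lra. Qed.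
Let smallB : B * Nr * s <= 8^-1. Proof. move: BNs KNs K1Ns small; lra. Qed.

Let kkappa : k%:R * (K * s) <= 8^-1.
Proof.
have : k%:R * (K * s) <= Nr * (K * s) by rewrite ler_wpM2r.
by move: small8 KNs; lra.
Qed.

(** Here 1 / s is the square root of the dimension, x is the length of the vector times s,
    q the squared length of its remaining coordinates times s ^ 2, and t i its scalar
    products with the given vectors. The cone condition says that the ratios t i / x lie
    in the windows. They differ from the coordinates y i for two reasons: the given vectors
    are not quite the axes, an effect of order Nr * s, and x is not quite 1, an effect of
    order |q - 1|. *)
Lemma box_of_cone : (forall i, (i < k)%N -> lo i * x < t i /\ t i < hi i * x) ->
  forall i, (i < k)%N -> c i - eta < y i /\ y i <= c' i + eta.
Proof.
move=> tlh i ik.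
have [K0' B0' s0' s1' N1'] := And5 K0 B0 (ltW s0) s1 N1.
have x_gt0 : 0 < x.
  rewrite lt_neqAle x0 andbT; apply/eqP => x00.
  by have [] := tlh i ik; rewrite -x00 !mulr0 => h1 h2; have := lt_trans h1 h2; rewrite ltxx.
pose K1 := K + 1.
have K10 : 0 < K1 by rewrite /K1; lra.
have lh j : (j < k)%N -> - K1 <= lo j /\ hi j <= K1.
  move=> jk; have [c1 c2] := c_itv jk; have := lo_close jk; have := hi_close jk.
  have Bs : B * s <= 1 by have := ler_wpM2l B0 sNs; move: smallB; lra.
  by rewrite !ler_norml /K1 => /andP[] ? ? /andP[] ? ?; split; lra.
have tT j : (j < k)%N -> `|t j| <= K1 * x.
  move=> jk; have [l1 h1] := lh j jk; have [t1 t2] := tlh j jk.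
  rewrite ler_norml -mulNr; apply/andP; split.
    by apply: le_trans (ltW t1); rewrite ler_wpM2r.
  by apply: (le_trans (ltW t2)); rewrite ler_wpM2r.
have yT := triangular_solve_le kappa0 kkappa w_diag w_unit w_orth tT.
have ti := triangular_apply_close kappa0 kkappa w_diag w_unit w_orth ik
  (fun l li => yT l (leq_ltn_trans li ik)).
rewrite -/(t i) in ti.
pose Q := `|q - 1|.
have Q0 : 0 <= Q by exact: normr_ge0.
pose b := 4 * K1 ^+ 2 * (Nr * s) * s.
have b0 : 0 <= b by rewrite mulr_ge0// mulr_ge0// mulr_ge0// sqr_ge0.
have b1 : b <= 2^-1.
  have := ler_wpM2l (_ : 0 <= 4 * K1 ^+ 2 * (Nr * s)) s1.
  rewrite mulr1 /b => h; apply: (le_trans (h _)); [|move: small81; rewrite /K1; lra].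
  by rewrite mulr_ge0// mulr_ge0// sqr_ge0.
have ysum : 0 <= s ^+ 2 * \sum_(l < k) y l ^+ 2 <= b * x ^+ 2.
  apply/andP; split; first by rewrite mulr_ge0 ?sqr_ge0// sumr_ge0// => l _; rewrite sqr_ge0.
  have : \sum_(l < k) y l ^+ 2 <= \sum_(l < k) (2 * (K1 * x)) ^+ 2.
    apply: ler_sum => l _; rewrite -[y l ^+ 2]real_normK ?num_real//.
    by rewrite lerXn2r ?nnegrE// ?yT// mulr_ge0// mulr_ge0// ltW.
  rewrite sumr_const card_ord -[X in _ <= X]mulr_natl => h.
  apply: (le_trans (ler_wpM2l (sqr_ge0 s) h)).
  rewrite -subr_ge0 (_ : _ - _ = 4 * (Nr - k%:R) * (s * K1 * x) ^+ 2).
    by rewrite mulr_ge0 ?sqr_ge0// mulr_ge0// subr_ge0.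
  by rewrite /b; ring.
move: ysum xE; set Y := s ^+ 2 * _ => /andP[Y0 Yb] xq.
have q1 : q <= 1 + Q by have := ler_norm (q - 1); rewrite -/Q; lra.
have q2 : 1 - Q <= q by have := ler_norm (- (q - 1)); rewrite normrN -/Q; lra.
have X2 : x ^+ 2 <= 2 * q by have := sqr_ge0 x; nra.
have X1 : `|x ^+ 2 - 1| <= 2 * Q + 2 * b.
  by rewrite ler_norml; apply/andP; split; nra.
have xc := sqr_close1 x0 X1.
have xc' : x <= 2 + 2 * Q by have := ler_norm (x - 1); lra.
pose th := t i / x.
have thE : t i = th * x by rewrite divfK// gt_eqF.
have thK : `|th| <= K1.
  by rewrite -(ler_pM2r x_gt0) -[X in _ * X <= _]gtr0_norm// -normrM -thE tT.
have [t1 t2] := tlh i ik; have [c1 c2] := c_itv ik.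
have th1 : lo i < th by rewrite ltr_pdivlMr.
have th2 : th < hi i by rewrite ltr_pdivrMr.
have tth : `|t i - th| <= K1 * (2 * Q + 2 * b).
  by rewrite thE -[X in _ - X]mulr1 -mulrBr normrM ler_pM.
have yth : `|y i - th| <= (16 * K * K1 + 8 * K1 ^+ 3) * (Nr * s) + 4 * K1 * Q.
  have -> : y i - th = (t i - th) - (t i - y i) by ring.
  apply: (le_trans (ler_normB _ _)); apply: (le_trans (lerD tth ti)).
  have h1 : 4 * k%:R * (K * s) * (2 * (K1 * x)) <= 16 * K * K1 * (Nr * s) + 2 * K1 * Q.
    apply: (@le_trans _ _ (8 * K * K1 * (Nr * s) * x)).
      rewrite -subr_ge0 (_ : _ - _ = 8 * (Nr - k%:R) * (K * s) * K1 * x); last by ring.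
      by rewrite mulr_ge0// mulr_ge0 ?(ltW K10)// mulr_ge0// mulr_ge0// subr_ge0.
    apply: (@le_trans _ _ (8 * K * K1 * (Nr * s) * (2 + 2 * Q))).
      by rewrite ler_wpM2l// mulr_ge0// mulr_ge0 ?(ltW K10)// mulr_ge0// ltW.
    have KQ := mulr_ge0 (ltW K10) Q0; have := ler_wpM2r KQ small8; lra.
  have h2 : 2 * K1 * b <= 8 * K1 ^+ 3 * (Nr * s).
    have := ler_wpM2l (_ : 0 <= 8 * K1 ^+ 3 * (Nr * s)) s1.
    by rewrite mulr1 /b => h; apply: le_trans (h _); [lra|rewrite mulr_ge0// mulr_ge0// exprn_ge0// ltW].
  lra.
have etaE : (16 * K * K1 + 8 * K1 ^+ 3) * (Nr * s) + 4 * K1 * Q + B * s <= eta.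
  rewrite /eta /widening_rate -/K1 -/Q.
  have h1 : B * s <= B * (Nr * s) by rewrite ler_wpM2l.
  have Kge := ltW K0; have K1ge := ltW K10.
  have e1 : 0 <= (4 * K1 + 8 * K ^+ 2 + 2 * K ^+ 3 + 4 * K + 1) * (Nr * s).
    by rewrite mulr_ge0// !addr_ge0// !mulr_ge0// ?exprn_ge0.
  have e2 : 0 <= (16 * K * K1 + 8 * K1 ^+ 3 + 8 * K ^+ 2 + 2 * K ^+ 3 + 4 * K + B + 1) * Q.
    by rewrite mulr_ge0// !addr_ge0// !mulr_ge0// ?exprn_ge0.
  lra.
have := lo_close ik; have := hi_close ik; move: yth.
rewrite !ler_norml => /andP[y1 y2] /andP[g1 g2] /andP[g3 g4]; split; lra.
Qed.

(** The converse of box_of_cone. A nonempty box forces eta <= K, which confines q to a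
    neighbourhood of 1, so that division by x is harmless. *)
Lemma cone_of_box : (forall i, (i < k)%N -> c i + eta < y i /\ y i <= c' i - eta) ->
  forall i, (i < k)%N -> lo i * x < t i /\ t i < hi i * x.
Proof.
move=> ybox i ik.
have [K0' B0' s0' s1' N1'] := And5 K0 B0 (ltW s0) s1 N1.
have Kge := ltW K0'.
have K1ge : 0 <= K + 1 by rewrite addr_ge0.
pose Q := `|q - 1|.
have Q0 : 0 <= Q by exact: normr_ge0.
pose E1 := (8 * K ^+ 2 + 2 * K ^+ 3 + B) * (Nr * s).
pose E2 := (16 * K * (K + 1) + 8 * (K + 1) ^+ 3 + 4 * (K + 1) + 4 * K + 1) * (Nr * s)
  + (16 * K * (K + 1) + 8 * (K + 1) ^+ 3 + 4 * (K + 1) + 8 * K ^+ 2 + 2 * K ^+ 3 + B + 1) * Q.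
have etaE : eta = E1 + 4 * K * Q + E2 by rewrite /eta /widening_rate /E1 /E2 -/Q; ring.
have E10 : 0 <= E1 by rewrite mulr_ge0// !addr_ge0// !mulr_ge0// ?exprn_ge0.
have E20 : Nr * s + Q <= E2.
  rewrite /E2 -subr_ge0.
  have -> : (16 * K * (K + 1) + 8 * (K + 1) ^+ 3 + 4 * (K + 1) + 4 * K + 1) * (Nr * s)
      + (16 * K * (K + 1) + 8 * (K + 1) ^+ 3 + 4 * (K + 1) + 8 * K ^+ 2 + 2 * K ^+ 3 + B + 1) * Q
      - (Nr * s + Q) =
    (16 * K * (K + 1) + 8 * (K + 1) ^+ 3 + 4 * (K + 1) + 4 * K) * (Nr * s)
      + (16 * K * (K + 1) + 8 * (K + 1) ^+ 3 + 4 * (K + 1) + 8 * K ^+ 2 + 2 * K ^+ 3 + B) * Q.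
    by ring.
  by rewrite addr_ge0// mulr_ge0// !addr_ge0// !mulr_ge0// ?exprn_ge0.
have KQ0 : 0 <= K * Q by rewrite mulr_ge0.
have Ns0' := Ns0.
have eta0 : 0 <= eta by move: etaE E10 E20; lra.
have yK l : (l < k)%N -> `|y l| <= K.
  move=> lk; have [y1 y2] := ybox l lk; have [c1 c2] := c_itv lk.
  by rewrite ler_norml; apply/andP; split; move: y1 y2 c1 c2 eta0; lra.
have Q4 : Q <= 4^-1.
  have [y1 y2] := ybox i ik; have [c1 c2] := c_itv ik.
  have eK : eta <= K by move: y1 y2 c1 c2; lra.
  by rewrite -(ler_pM2l K0'); move: etaE eK E10 E20; lra.
have ti := triangular_apply_close kappa0 kkappa w_diag w_unit w_orth ik
  (fun l li => yK l (leq_ltn_trans li ik)).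
rewrite -/(t i) in ti.
have ti' : `|t i - y i| <= 4 * K ^+ 2 * (Nr * s).
  apply: (le_trans ti); rewrite -subr_ge0 (_ : _ - _ = 4 * (Nr - k%:R) * (K ^+ 2 * s)); last by ring.
  by rewrite mulr_ge0// ?mulr_ge0 ?subr_ge0 ?sqr_ge0.
have ysum : 0 <= s ^+ 2 * \sum_(l < k) y l ^+ 2 <= K ^+ 2 * (Nr * s) * s.
  apply/andP; split; first by rewrite mulr_ge0 ?sqr_ge0// sumr_ge0// => l _; rewrite sqr_ge0.
  have : \sum_(l < k) y l ^+ 2 <= \sum_(l < k) K ^+ 2.
    apply: ler_sum => l _; rewrite -[y l ^+ 2]real_normK ?num_real//.
    by rewrite lerXn2r ?nnegrE// ?yK.
  rewrite sumr_const card_ord -[X in _ <= X]mulr_natl => h.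
  apply: (le_trans (ler_wpM2l (sqr_ge0 s) h)).
  rewrite -subr_ge0 (_ : _ - _ = (Nr - k%:R) * (s * K) ^+ 2); last by ring.
  by rewrite mulr_ge0 ?sqr_ge0// subr_ge0.
have ysum' : s ^+ 2 * \sum_(l < k) y l ^+ 2 <= K ^+ 2 * (Nr * s).
  have /andP[_ h] := ysum; apply: (le_trans h); rewrite -[leRHS]mulr1 ler_wpM2l//.
  by rewrite mulr_ge0// sqr_ge0.
have K2N : K ^+ 2 * (Nr * s) <= 4^-1.
  have h := mulr_ge0 Kge Ns0'; move: small81; lra.
move: ysum ysum' xE; set Y := s ^+ 2 * _ => /andP[Y0 _] Yb xq.
have q1 : q <= 1 + Q by have := ler_norm (q - 1); rewrite -/Q; lra.
have q2 : 1 - Q <= q by have := ler_norm (- (q - 1)); rewrite normrN -/Q; lra.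
have X1 : `|x ^+ 2 - 1| <= Q + K ^+ 2 * (Nr * s).
  by rewrite ler_norml; apply/andP; split; move: xq Y0 Yb q1 q2; lra.
have xc := sqr_close1 x0 X1.
have x2 : 2^-1 <= x by move: xc; rewrite ler_norml => /andP[h _]; move: h; lra.
have x_gt0 : 0 < x by move: x2; lra.
pose th := t i / x.
have thE : t i = th * x by rewrite divfK// gt_eqF.
have yth : `|th - y i| * x <= 4 * K ^+ 2 * (Nr * s) + K * (Q + K ^+ 2 * (Nr * s)).
  rewrite -[X in _ * X]gtr0_norm// -normrM mulrBl -thE.
  have -> : t i - y i * x = (t i - y i) - y i * (x - 1) by ring.
  by apply: (le_trans (ler_normB _ _)); rewrite lerD// normrM ler_pM// yK.
have yth' : `|th - y i| <= 8 * K ^+ 2 * (Nr * s) + 2 * K ^+ 3 * (Nr * s) + 2 * K * Q.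
  have := ler_wpM2l (normr_ge0 (th - y i)) x2; move: yth; lra.
have BNs' : B * s <= B * (Nr * s) by rewrite ler_wpM2l.
have gap : `|th - y i| + B * s < eta.
  have NQ : 0 < Nr * s + Q.
    by rewrite ltr_wpDr// mulr_gt0// (lt_le_trans ltr01).
  move: etaE E20 yth' BNs' NQ; rewrite /E1; lra.
have := lo_close ik; have := hi_close ik; move: gap.
have [y1 y2] := ybox i ik.
have := ler_norm (th - y i); have := ler_norm (- (th - y i)); rewrite normrN.
rewrite !ler_norml thE !ltr_pM2r// => n1 n2 gap /andP[g1 g2] /andP[g3 g4].
split; move: y1 y2 n1 n2 gap g1 g2 g3 g4; lra.
Qed.

End radius.

(** * Perturbation of products *)

Section elementary.
Context (R : realType).

(** Convexity of the exponential between 0 and a. *)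
Lemma expR_scale_le (tau a : R) : 0 <= tau -> tau <= 1 ->
  expR (tau * a) <= 1 - tau + tau * expR a.
Proof.
move=> t0 t1.
have h : 1 <= (1 - tau) * expR (- (tau * a)) + tau * expR (a - tau * a).
  have h1 := ler_wpM2l (_ : 0 <= 1 - tau) (expR_ge1Dx (- (tau * a))).
  have h2 := ler_wpM2l t0 (expR_ge1Dx (a - tau * a)).
  have := h1; rewrite subr_ge0 => /(_ t1); lra.
have := ler_wpM2l (expR_ge0 (tau * a)) h.
rewrite mulr1 mulrDr (mulrCA _ (1 - tau)) (mulrCA _ tau) -!expRD.
by rewrite subrr expR0 mulr1 (_ : tau * a + (a - tau * a) = a)//; ring.
Qed.

Lemma norm_le_expR_sum (X : R) : `|X| <= expR X + expR (- X).
Proof.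
have h1 := expR_ge1Dx X; have h2 := expR_ge1Dx (- X).
have h3 := expR_ge0 X; have h4 := expR_ge0 (- X).
by rewrite ler_norml; apply/andP; split; lra.
Qed.

Lemma expR_norm_le (tau X : R) : 0 <= tau -> tau <= 1 ->
  expR (tau * `|X|) <= 1 + tau * (expR X + expR (- X)).
Proof.
move=> t0 t1; apply: (le_trans (expR_scale_le _ t0 t1)).
have : expR `|X| <= expR X + expR (- X).
  have [X0|X0] := leP 0 X; first by rewrite ger0_norm// lerDl expR_ge0.
  by rewrite ltr0_norm// lerDr expR_ge0.
move=> h; have := ler_wpM2l t0 h; lra.
Qed.

Lemma prod_ge_sub_sum k (g p : 'I_k -> R) (x : R) : 0 <= x ->
  (forall i, 0 <= g i) -> (forall i, 0 <= p i) -> (forall i, g i * (1 - x) <= p i) ->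
  \prod_i g i <= \prod_i p i + \prod_i g i * (k%:R * x).
Proof.
elim: k g p => [|k IH] g p x0 g0 p0 gp; first by rewrite !big_ord0 mul0r mulr0 addr0.
rewrite !big_ord_recl/=.
have := IH (fun i => g (lift ord0 i)) (fun i => p (lift ord0 i)) x0
   (fun i => g0 _) (fun i => p0 _) (fun i => gp _).
have G0 : 0 <= \prod_(i < k) g (lift ord0 i) by exact: prodr_ge0.
have P0 : 0 <= \prod_(i < k) p (lift ord0 i) by exact: prodr_ge0.
move: G0 P0 (gp ord0) (p0 ord0) (g0 ord0); rewrite -natr1.
move: (g ord0) (p ord0) (\prod_(i < k) _) (\prod_(i < k) _) => a b P G G0 P0 ab b0 a0 h.
have [ax|ax] := leP (1 - x) 0.
  have : 0 <= a * G * (k%:R * x) by rewrite !mulr_ge0.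
  have : 0 <= a * G * (x - 1) by rewrite !mulr_ge0//; lra.
  have : 0 <= b * P by rewrite mulr_ge0.
  lra.
have h1 := ler_wpM2l (mulr_ge0 a0 (ltW ax)) h.
have h2 := ler_wpM2r P0 ab.
have : 0 <= a * G * (k%:R * x) * x by rewrite !mulr_ge0.
lra.
Qed.

Lemma prod_le_expR k (g p : 'I_k -> R) (x : R) :
  (forall i, 0 <= g i) -> (forall i, 0 <= p i) -> (forall i, p i <= g i * expR x) ->
  \prod_i p i <= \prod_i g i * expR (k%:R * x).
Proof.
move=> g0 p0 gp; apply: (@le_trans _ _ (\prod_i (g i * expR x))).
  by apply: ler_prod => i _; rewrite p0 gp.
by rewrite big_split/= prodr_const card_ord expRM_natl.
Qed.

End elementary.

Section interval_products.
Context (R : realType).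
Variables (K eps : R) (k : nat) (c c' : nat -> R).
Hypotheses (eps0 : 0 < eps).
Hypothesis c_itv : forall i, (i < k)%N -> [/\ - K <= c i, c i + eps <= c' i & c' i <= K].

(** Every window has at least this mass: eps bounds its length, and the density is least at
    the end points of [-K, K]. *)
Definition min_itv_mass := eps * normal_pdf 0 1 K.

Lemma min_itv_mass_gt0 : 0 < min_itv_mass.
Proof. by rewrite mulr_gt0// normal_pdf01_gt0. Qed.

Lemma min_itv_mass_le i : (i < k)%N -> min_itv_mass <= gauss_itv (c i) (c' i).
Proof.
move=> ik; have [c1 c2 c3] := c_itv ik.
have cc : c i <= c' i by apply: le_trans c2; rewrite lerDl ltW.
apply: le_trans (gauss_itv_lb c1 cc c3).
by apply: ler_wpM2r; [exact/ltW/normal_pdf01_gt0|lra].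
Qed.

Let g (i : 'I_k) := gauss_itv (c i) (c' i).

Lemma gauss_itv_prod_widen h : 0 <= h ->
  \prod_(i < k) gauss_itv (c i - h) (c' i + h) <=
  \prod_(i < k) gauss_itv (c i) (c' i) * expR (k%:R * (2 * h / min_itv_mass)).
Proof.
move=> h0; apply: prod_le_expR => i; try exact: gauss_itv_ge0.
have [c1 c2 c3] := c_itv (ltn_ord i).
have cc : c i <= c' i by apply: le_trans c2; rewrite lerDl ltW.
apply: (le_trans (gauss_itv_widen cc h0)).
have mg := min_itv_mass_le (ltn_ord i); have m0 := min_itv_mass_gt0.
have x0 : 0 <= 2 * h / min_itv_mass by rewrite divr_ge0 ?(ltW m0)// mulr_ge0.
apply: (@le_trans _ _ (gauss_itv (c i) (c' i) * (1 + 2 * h / min_itv_mass))).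
  rewrite mulrDr mulr1 lerD2l.
  by rewrite -[leLHS](divfK (lt0r_neq0 m0)) mulrC ler_wpM2r.
by rewrite ler_wpM2l ?gauss_itv_ge0// expR_ge1Dx.
Qed.

Lemma gauss_itv_prod_shrink h : 0 <= h ->
  \prod_(i < k) gauss_itv (c i) (c' i) <= \prod_(i < k) gauss_itv (c i + h) (c' i - h) +
  \prod_(i < k) gauss_itv (c i) (c' i) * (k%:R * (2 * h / min_itv_mass)).
Proof.
move=> h0; have m0 := min_itv_mass_gt0.
apply: prod_ge_sub_sum => [|i|i|i]; try exact: gauss_itv_ge0.
  by rewrite divr_ge0 ?(ltW m0)// mulr_ge0.
have [c1 c2 c3] := c_itv (ltn_ord i).
have cc : c i <= c' i by apply: le_trans c2; rewrite lerDl ltW.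
have := gauss_itv_shrink cc h0.
have mg := min_itv_mass_le (ltn_ord i).
have x0 : 0 <= 2 * h / min_itv_mass by rewrite divr_ge0 ?(ltW m0)// mulr_ge0.
have : 2 * h <= gauss_itv (c i) (c' i) * (2 * h / min_itv_mass).
  by rewrite -[leLHS](divfK (lt0r_neq0 m0)) mulrC ler_wpM2r.
lra.
Qed.

End interval_products.

(** * Boxes around given windows *)

Section boxes.
Context (R : realType).
Local Notation T := (measurableTypeR R).
Variables (k m : nat) (c c' : nat -> R).

(** The margin h may depend on the vector; it will be a function of the coordinates with
    index at least k, so that conditionally on these the box is a product of intervals. *)
Definition box (h : (k + m).-tuple T -> R) : set ((k + m).-tuple T) :=
  [set v | forall i : 'I_k, c i - h v < nth 0 v i <= c' i + h v].

Lemma measurable_nth n l : measurable_fun setT (fun v : n.-tuple T => (nth 0 v l : T)).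
Proof.
have [ln|nl] := ltnP l n; last first.
  rewrite (_ : (fun _ => _) = cst 0)//.
  by apply/funext => v; rewrite nth_default// size_tuple.
rewrite (_ : (fun _ => _) = fun v : n.-tuple T => tnth v (Ordinal ln)).
  exact: measurable_tnth.
by apply/funext => v; rewrite (tnth_nth 0).
Qed.

Lemma measurable_box h : measurable_fun setT h -> measurable (box h).
Proof.
move=> mh; apply: measurable_forall_ord => i; apply: measurable_between_oc.
- exact: measurable_funB.
- exact: measurable_nth.
- exact: measurable_funD.
Qed.

Section slices.
Variables (h : (k + m).-tuple T -> R) (hz : m.-tuple T -> R).
Hypothesis mh : measurable_fun setT h.
Hypothesis hE : forall y z, h (tcat (y, z)) = hz z.

Lemma box_slice z : (\int[gauss_vec R k]_y (\1_(box h) (tcat (y, z)) : R)%:E =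
  (\prod_(i < k) gauss_itv (c i - hz z) (c' i + hz z))%:E)%E.
Proof.
pose A (i : 'I_k) : set T := `]c i - hz z, c' i + hz z]%classic.
have mA i : measurable (A i) by exact: measurable_itv.
transitivity (gauss_vec R k [set y | forall i, A i (tnth y i)]); last first.
  rewrite /gauss_vec power_probE// -prodEFin; apply: eq_bigr => i _; exact: gauss_itvE.
rewrite measureE_indic; last first.
  by apply: measurable_forall_ord => i; apply: measurable_preimage => //; exact: measurable_tnth.
apply: eq_integral => y _; congr (_%:E); rewrite !indicE; congr (nat_of_bool _)%:R.
have e (i : 'I_k) : nth 0 (tcat (y, z)) i = tnth y i.
  by rewrite (tnth_nth 0) /= nth_cat size_tuple ltn_ord.
apply/idP/idP; rewrite !inE /box /A /= => yA i; have := yA i;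
  by rewrite hE e in_itv.
Qed.

Let mF : measurable_fun setT (fun v => (\1_(box h) v : R)%:E).
Proof. by apply/measurable_EFinP; apply: measurable_indic; exact: measurable_box. Qed.

Let F0 v : (0 <= (\1_(box h) v : R)%:E)%E. Proof. by rewrite lee_fin. Qed.

Lemma measurable_box_slice : measurable_fun setT (fun z =>
  (\prod_(i < k) gauss_itv (c i - hz z) (c' i + hz z))%:E).
Proof.
under eq_fun do rewrite -box_slice.
exact: (measurable_fun_fubini_tonelli_G (m1 := gauss_vec R k) _
  (measurableT_comp mF (@measurable_tcat _ T k m)) (fun p => F0 _)).
Qed.

(** Conditionally on the last coordinates the first k ones are independent Gaussians. *)
Lemma gauss_vec_box : gauss_vec R (k + m) (box h) =
  (\int[gauss_vec R m]_z (\prod_(i < k) gauss_itv (c i - hz z) (c' i + hz z))%:E)%E.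
Proof.
rewrite (measureE_indic _ (measurable_box mh)) /gauss_vec.
rewrite (integral_power_prob_tcat std_gauss mF F0).
by apply: eq_integral => z _; exact: box_slice.
Qed.

End slices.

Definition tail_sq (v : (k + m).-tuple T) : R := \sum_(j < m) nth 0 v (k + j) ^+ 2.

Lemma measurable_tail_sq : measurable_fun setT tail_sq.
Proof.
apply: measurable_sum => j; apply: measurable_funX; exact: measurable_nth.
Qed.

Lemma tail_sq_tcat y z : tail_sq (tcat (y, z)) = dot z z.
Proof.
apply: eq_bigr => j _; rewrite (tnth_nth 0) /= nth_cat size_tuple.
by rewrite ltnNge leq_addr/= addKn expr2.
Qed.

Lemma dot_tail_sq (v : (k + m).-tuple T) :
  dot v v = \sum_(l < k) nth 0 v l ^+ 2 + tail_sq v.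
Proof.
rewrite /dot big_split_ord/=; congr (_ + _); apply: eq_bigr => i _;
  by rewrite (tnth_nth 0) /= expr2.
Qed.

End boxes.

Lemma dot_triangular (R : realType) n (w v : n.-tuple (measurableTypeR R)) i : (i < n)%N ->
  (forall j : 'I_n, (i < j)%N -> tnth w j = 0) ->
  dot w v = \sum_(l < i.+1) nth 0 w l * nth 0 v l.
Proof.
move=> ni wi; rewrite (big_ord_widen n (fun l => nth 0 w l * nth 0 v l) ni).
rewrite [RHS]big_mkcond /dot; apply: eq_bigr => j _; rewrite !(tnth_nth 0).
by case: ltnP => // ij; rewrite -(tnth_nth 0 w) wi// mul0r.
Qed.

(** * Cones and boxes *)

Section cone_boxes.
Context (R : realType).
Local Notation T := (measurableTypeR R).
Variables (k m N : nat) (K B s : R) (c c' lo hi : nat -> R).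

(** The condition on v is homogeneous, hence concerns only its direction. The scale s is
    the inverse square root of the dimension, which makes enorm v * s close to 1. *)
Definition cone n (u : nat -> n.-tuple T) : set (n.-tuple T) :=
  [set v | forall i : 'I_k, lo i * (enorm v * s) < dot (u i) v < hi i * (enorm v * s)].

Lemma measurable_cone n (u : nat -> n.-tuple T) : measurable (cone u).
Proof.
apply: measurable_forall_ord => i.
have me a : measurable_fun setT (fun v : n.-tuple T => a * (enorm v * s)).
  by apply: measurable_funM => //; apply: measurable_funM => //; exact: measurable_enorm.
by apply: measurable_between_oo => //; exact: measurable_dot.
Qed.

(** The margin of box_of_cone, as a function of the squared length of the last
    coordinates. *)
Definition eta_of (rho : R) : R := widening_rate K B * (N%:R * s + `|rho * s ^+ 2 - 1|).

Lemma measurable_eta_of r :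
  measurable_fun setT (fun v : (k + r).-tuple T => eta_of (tail_sq v)).
Proof.
apply: measurable_funM => //; apply: measurable_funD => //.
apply: measurableT_comp => //; apply: measurable_funB => //; apply: measurable_funM => //.
exact: measurable_tail_sq.
Qed.

Hypotheses (K0 : 0 < K) (B0 : 0 <= B) (s0 : 0 < s) (s1 : s <= 1).
Hypotheses (N1 : (0 < N)%N) (kN : (k <= N)%N).
Hypothesis small : (8 * K + 8 * (K + 1) ^+ 2 + B) * N%:R * s <= 8^-1.
Hypothesis c_itv : forall i, (i < k)%N -> - K <= c i /\ c' i <= K.
Hypothesis lo_close : forall i, (i < k)%N -> `|lo i - c i| <= B * s.
Hypothesis hi_close : forall i, (i < k)%N -> `|hi i - c' i| <= B * s.

Variable w : nat -> (k + m.+1).-tuple T.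
Hypothesis w_triangular : forall i (j : 'I_(k + m.+1)), (i < k)%N -> (i < j)%N -> tnth (w i) j = 0.
Hypothesis w_diag : forall i, (i < k)%N -> 0 <= nth 0 (w i) i.
Hypothesis w_unit : forall i, (i < k)%N -> enorm (w i) = 1.
Hypothesis w_orth : forall i j, (j < i)%N -> (i < k)%N -> `|dot (w j) (w i)| <= K * s.

Let W i l : R := nth 0 (w i) l.

Let kmk i : (i < k)%N -> (i < k + m.+1)%N.
Proof. by move=> ik; rewrite ltn_addr. Qed.

Let dotW i v : (i < k)%N -> dot (w i) v = \sum_(l < i.+1) W i l * nth 0 v l.
Proof. by move=> ik; apply: dot_triangular => [|j ij]; [exact: kmk|exact: w_triangular]. Qed.

Let W_unit i : (i < k)%N -> \sum_(l < i.+1) W i l ^+ 2 = 1.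
Proof.
move=> ik; transitivity (dot (w i) (w i)); last by rewrite -sqr_enorm w_unit// expr1n.
by rewrite dotW//; apply: eq_bigr => l _; rewrite expr2.
Qed.

Let W_orth i j : (j < i)%N -> (i < k)%N -> `|\sum_(l < j.+1) W i l * W j l| <= K * s.
Proof.
move=> ji ik; have := w_orth ji ik; rewrite dotW; last exact: ltn_trans ik.
by under eq_bigr do rewrite mulrC.
Qed.

Let N1' : 1 <= N%:R :> R. Proof. by rewrite ler1n. Qed.
Let kN' : k%:R <= N%:R :> R. Proof. by rewrite ler_nat. Qed.

Let radiusE (v : (k + m.+1).-tuple T) :
  (enorm v * s) ^+ 2 = tail_sq v * s ^+ 2 + s ^+ 2 * \sum_(l < k) nth 0 v l ^+ 2.
Proof. by rewrite exprMn sqr_enorm dot_tail_sq; ring. Qed.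

Let radius0 n (v : n.-tuple T) : 0 <= enorm v * s.
Proof. by rewrite mulr_ge0 ?enorm_ge0// ltW. Qed.

Lemma cone_sub_box : cone w `<=` box c c' (fun v => eta_of (tail_sq v)).
Proof.
move=> v cv.
have := @box_of_cone R W k (nth 0 v) lo hi c c' K B s N%:R (enorm v * s)
  (tail_sq v * s ^+ 2) K0 B0 s0 s1 N1' kN' small w_diag W_unit W_orth c_itv lo_close hi_close
  (radius0 v) (radiusE v).
move=> /(_ _)/(_ _ (ltn_ord _)) H i; apply/andP; apply: H => j jk.
by have /andP := cv (Ordinal jk); rewrite dotW.
Qed.

Lemma box_sub_cone : box c c' (fun v => - eta_of (tail_sq v)) `<=` cone w.
Proof.
move=> v cv.
have := @cone_of_box R W k (nth 0 v) lo hi c c' K B s N%:R (enorm v * s)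
  (tail_sq v * s ^+ 2) K0 B0 s0 s1 N1' kN' small w_diag W_unit W_orth c_itv lo_close hi_close
  (radius0 v) (radiusE v).
move=> /(_ _)/(_ _ (ltn_ord _)) H i; rewrite dotW//; apply/andP; apply: H => j jk.
by have /andP := cv (Ordinal jk); rewrite /= opprK.
Qed.

End cone_boxes.

(** * Gaussian mass of the boxes *)

Section box_bounds.
Context (R : realType).
Local Notation T := (measurableTypeR R).

(** The squared length of a Gaussian vector in dimension m deviates from m by the order
    of the square root of m; the exponential moments bound all the averages that are
    needed. *)
Lemma gauss_radius_average m (s a b : R) : `|s| <= 4^-1 -> s ^+ 2 * m%:R <= 1 ->
  0 <= a -> 0 <= b ->
  (\int[gauss_vec R m]_z (a + b * (expR ((dot z z - m%:R) * s) +
     expR (- ((dot z z - m%:R) * s))))%:E <= (a + 2 * b * expR 4)%:E)%E.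
Proof.
move=> s4 sm; rewrite -!lee_fin => a0 b0.
have mX t : measurable_fun setT (fun z : m.-tuple T => (expR (t * (dot z z - m%:R)))%:E).
  apply/measurable_EFinP; apply: measurableT_comp => //; apply: measurable_funM => //.
  by apply: measurable_funB => //; exact: measurable_dot.
have X0 t (z : m.-tuple T) : (0 <= (expR (t * (dot z z - m%:R)))%:E)%E by rewrite lee_fin expR_ge0.
have mbX t : measurable_fun setT (fun z : m.-tuple T => (b%:E * (expR (t * (dot z z - m%:R)))%:E)%E).
  exact: emeasurable_funM.
have bX0 t (z : m.-tuple T) : (0 <= b%:E * (expR (t * (dot z z - m%:R)))%:E)%E by rewrite mule_ge0// lee_fin.
have bX t : t ^+ 2 = s ^+ 2 -> `|t| = `|s| ->
    (\int[gauss_vec R m]_z (b%:E * (expR (t * (dot z z - m%:R)))%:E) <= (b * expR 4)%:E)%E.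
  move=> t2 tn; rewrite ge0_integralZl//.
  rewrite EFinM lee_wpmul2l ?lee_fin//.
  apply: (le_trans (gauss_vec_mgf_le m _)); first by rewrite tn.
  rewrite lee_fin ler_expR t2; lra.
rewrite (_ : (\int[_]_z _)%E = (\int[gauss_vec R m]_z (a%:E +
    (b%:E * (expR (s * (dot z z - m%:R)))%:E + b%:E * (expR (- s * (dot z z - m%:R)))%:E)))%E); last first.
  apply: eq_integral => z _; rewrite -!EFinM -!EFinD mulrDr mulNr.
  by rewrite [s * _]mulrC.
have pX0 (z : m.-tuple T) : (0 <= b%:E * (expR (s * (dot z z - m%:R)))%:E + b%:E * (expR (- s * (dot z z - m%:R)))%:E)%E.
  exact: (adde_ge0 (bX0 _ _) (bX0 _ _)).
rewrite (ge0_integralD _ measurableT (fun _ _ => a0) (measurable_cst _) (fun z _ => pX0 z)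
  (emeasurable_funD (mbX s) (mbX (- s)))).
rewrite (ge0_integralD _ measurableT (fun z _ => bX0 s z) (mbX s) (fun z _ => bX0 (- s) z) (mbX (- s))).
rewrite integral_cst// [X in (a%:E * X)%E](_ : _ = 1%E) ?mule1; last exact: probability_setT.
rewrite EFinD leeD2l//.
have -> : 2 * b * expR 4 = b * expR 4 + b * expR 4 by ring.
by rewrite EFinD leeD// bX// ?sqrrN ?normrN.
Qed.

Variables (k m N : nat) (K eps B s : R) (c c' : nat -> R).
Let A := widening_rate K B.
Let g0 := min_itv_mass K eps.
(** A margin eta changes the mass of a window by a factor of at most
    1 + 2 * eta / min_itv_mass. *)
Definition mass_rate := 2 * widening_rate K B / min_itv_mass K eps.
(** The factor expR 4 comes from the exponential moments of the squared length. *)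
Definition cone_rate := 2 * mass_rate * (2 * expR 4 + expR 4 ^+ 2).
Let D := mass_rate.
Let G := \prod_(i < k) gauss_itv (c i) (c' i).

Hypotheses (K0 : 0 < K) (eps0 : 0 < eps) (B0 : 0 <= B) (s0 : 0 < s) (s4 : s <= 4^-1).
Hypotheses (N1 : (0 < N)%N) (kN : (k <= N)%N).
Hypothesis sn : s ^+ 2 * (k + m)%:R = 1.
Hypothesis DN1 : 2 * mass_rate * N%:R ^+ 2 * s <= 1.
Hypothesis c_itv : forall i, (i < k)%N -> [/\ - K <= c i, c i + eps <= c' i & c' i <= K].

Lemma widening_rate_gt0 : 0 < widening_rate K B.
Proof.
have K1 : 0 <= K + 1 by rewrite addr_ge0// ltW.
have K0' := ltW K0.
by rewrite /widening_rate ltr_wpDl// !addr_ge0// !mulr_ge0// ?exprn_ge0.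
Qed.

Lemma mass_rate_gt0 : 0 < mass_rate.
Proof. by rewrite divr_gt0 ?min_itv_mass_gt0// mulr_gt0// widening_rate_gt0. Qed.

Let N1' : 1 <= N%:R :> R. Proof. by rewrite ler1n. Qed.
Let kN' : k%:R <= N%:R :> R. Proof. by rewrite ler_nat. Qed.
Let G0 : 0 <= G. Proof. by apply: prodr_ge0 => i _; exact: gauss_itv_ge0. Qed.
Let F1 : 1 <= expR 4 :> R. Proof. by rewrite -[leLHS]expR0 ler_expR. Qed.

Let X (z : m.-tuple T) := (dot z z - m%:R) * s.
Let sigma := 2 * D * N%:R ^+ 2 * s.
Let tau := D * N%:R * s.

Let D0 : 0 <= D. Proof. exact/ltW/mass_rate_gt0. Qed.
Let sigma0 : 0 <= sigma.
Proof. by rewrite /sigma mulr_ge0 ?(ltW s0)// mulr_ge0 ?sqr_ge0// mulr_ge0. Qed.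
Let tau0 : 0 <= tau. Proof. by rewrite /tau mulr_ge0 ?(ltW s0)// mulr_ge0. Qed.
Let tau_sigma : 2 * tau <= sigma.
Proof.
rewrite /tau /sigma -subr_ge0.
have -> : 2 * D * N%:R ^+ 2 * s - 2 * (D * N%:R * s) = 2 * (D * N%:R) * (N%:R - 1) * s by ring.
by rewrite mulr_ge0 ?(ltW s0)// mulr_ge0 ?subr_ge0// mulr_ge0// mulr_ge0.
Qed.
Let tau1 : tau <= 1.
Proof. by have := tau_sigma; have := tau0; move: DN1; rewrite -/D -/sigma; lra. Qed.

Let eta0 rho : 0 <= eta_of N K B s rho.
Proof.
rewrite /eta_of mulr_ge0 ?(ltW widening_rate_gt0)// addr_ge0// mulr_ge0 ?(ltW s0)//.
Qed.

Let eta_le z : k%:R * (2 * eta_of N K B s (dot z z) / g0) <= sigma + tau * `|X z|.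
Proof.
have -> : k%:R * (2 * eta_of N K B s (dot z z) / g0) =
   D * k%:R * (N%:R * s + `|dot z z * s ^+ 2 - 1|).
  by rewrite /eta_of /D /mass_rate /g0; ring.
have e : `|dot z z * s ^+ 2 - 1| <= s * `|X z| + N%:R * s ^+ 2.
  have -> : dot z z * s ^+ 2 - 1 = s * X z - k%:R * s ^+ 2.
    by rewrite /X -[X in _ - X = _]sn natrD; ring.
  apply: (le_trans (ler_normB _ _)).
  apply: lerD; first by rewrite normrM gtr0_norm.
  have ks : 0 <= k%:R * s ^+ 2 by apply: mulr_ge0; rewrite ?ler0n ?sqr_ge0.
  by rewrite (ger0_norm ks); apply: ler_wpM2r; rewrite ?sqr_ge0.
apply: (@le_trans _ _ (D * N%:R * (N%:R * s + (s * `|X z| + N%:R * s ^+ 2)))).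
  rewrite ler_pM//.
  - by rewrite mulr_ge0.
  - by rewrite addr_ge0// mulr_ge0// ltW.
  - by rewrite ler_wpM2l.
  - by rewrite lerD2l.
rewrite /sigma /tau -subr_ge0.
have -> : 2 * D * N%:R ^+ 2 * s + D * N%:R * s * `|X z| -
   D * N%:R * (N%:R * s + (s * `|X z| + N%:R * s ^+ 2)) = D * N%:R ^+ 2 * s * (1 - s) by ring.
rewrite mulr_ge0//; last by have := s4; lra.
by rewrite mulr_ge0 ?(ltW s0)// mulr_ge0// sqr_ge0.
Qed.

Let mtail : measurable_fun setT (fun v : (k + m).-tuple T => eta_of N K B s (tail_sq v)).
Proof. exact: measurable_eta_of. Qed.

Let mX : measurable_fun setT X.
Proof.
apply: measurable_funM => //; apply: measurable_funB => //; exact: measurable_dot.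
Qed.

Let mXX a b : measurable_fun setT (fun z => (a + b * (expR (X z) + expR (- X z)))%:E).
Proof.
apply/measurable_EFinP; apply: measurable_funD => //; apply: measurable_funM => //.
by apply: measurable_funD; apply: measurableT_comp => //; exact: measurableT_comp.
Qed.

Let s4' : `|s| <= 4^-1. Proof. by rewrite gtr0_norm. Qed.
Let sm : s ^+ 2 * m%:R <= 1.
Proof. by rewrite -[leRHS]sn; apply: ler_wpM2l; rewrite ?sqr_ge0// ler_nat leq_addl. Qed.

(** The product of the widened masses is at most G times the exponential of
    sigma + tau * |X|, where X is the normalised deviation of the squared length of the
    last coordinates; gauss_radius_average bounds its mean. *)
Lemma gauss_box_le : (gauss_vec R (k + m) (box c c' (fun v => eta_of N K B s (tail_sq v))) <=
  (G * (1 + cone_rate * (N%:R ^+ 2 * s)))%:E)%E.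
Proof.
have hE (y : k.-tuple T) (z : m.-tuple T) : eta_of N K B s (tail_sq (tcat (y, z))) = eta_of N K B s (dot z z).
  by rewrite tail_sq_tcat.
rewrite (gauss_vec_box c c' mtail hE).
pose a := G * expR sigma.
have a0 : 0 <= a by rewrite mulr_ge0 ?expR_ge0.
apply: (@le_trans _ _ (\int[gauss_vec R m]_z (a + a * tau * (expR (X z) + expR (- X z)))%:E)%E).
  apply: ge0_le_integral => //.
  - by move=> z _; rewrite lee_fin prodr_ge0// => i _; exact: gauss_itv_ge0.
  - exact: (measurable_box_slice c c' mtail hE).
  - move=> z _; rewrite lee_fin.
    apply: (le_trans (gauss_itv_prod_widen eps0 c_itv (eta0 _))).
    rewrite -/G.
    have -> : a + a * tau * (expR (X z) + expR (- X z)) =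
       G * (expR sigma * (1 + tau * (expR (X z) + expR (- X z)))) by rewrite /a; ring.
    rewrite ler_wpM2l//; apply: (@le_trans _ _ (expR sigma * expR (tau * `|X z|))).
      by rewrite -expRD ler_expR; exact: eta_le.
    by rewrite ler_wpM2l ?expR_ge0// expR_norm_le.
apply: (le_trans (gauss_radius_average s4' sm a0 (mulr_ge0 a0 tau0))).
rewrite lee_fin /a.
have -> : G * expR sigma + 2 * (G * expR sigma * tau) * expR 4 =
  G * (expR sigma * (1 + 2 * tau * expR 4)) by ring.
rewrite ler_wpM2l//.
have sg1 : sigma <= 1 by exact: DN1.
have e1 : expR sigma <= 1 + sigma * expR 4.
  have := expR_scale_le 1 sigma0 sg1; rewrite mulr1 => h; apply: (le_trans h).
  have h1 : sigma * expR 1 <= sigma * expR 4 by rewrite ler_wpM2l// ler_expR ler1n.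
  move: h1 sigma0; lra.
have e2 : 1 + 2 * tau * expR 4 <= 1 + sigma * expR 4.
  by rewrite lerD2l ler_wpM2r// expR_ge0.
have F0 := expR_ge0 (4 : R).
apply: (@le_trans _ _ ((1 + sigma * expR 4) * (1 + sigma * expR 4))).
  apply: ler_pM => //.
  by rewrite addr_ge0// mulr_ge0// mulr_ge0.
rewrite -subr_ge0.
have -> : 1 + cone_rate * (N%:R ^+ 2 * s) -
   (1 + sigma * expR 4) * (1 + sigma * expR 4) = sigma * (1 - sigma) * expR 4 ^+ 2.
  by rewrite /cone_rate /sigma /D; ring.
by rewrite mulr_ge0 ?sqr_ge0// mulr_ge0// subr_ge0.
Qed.

(** The same as gauss_box_le, with the exponential replaced by the union bound
    prod_ge_sub_sum, so that the averaged function stays nonnegative. *)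
Lemma gauss_box_ge : ((G * (1 - cone_rate * (N%:R ^+ 2 * s)))%:E <=
  gauss_vec R (k + m) (box c c' (fun v => - eta_of N K B s (tail_sq v))%R))%E.
Proof.
have hE (y : k.-tuple T) (z : m.-tuple T) : - eta_of N K B s (tail_sq (tcat (y, z))) = - eta_of N K B s (dot z z).
  by rewrite tail_sq_tcat.
have mtN : measurable_fun setT (fun v : (k + m).-tuple T => - eta_of N K B s (tail_sq v)).
  exact: measurableT_comp.
rewrite (gauss_vec_box c c' mtN hE).
have mS := measurable_box_slice c c' mtN hE.
set S := (fun z => (\prod_(i < k) _)%:E) in mS *.
have S0 z : (0 <= S z)%E by rewrite lee_fin prodr_ge0// => i _; exact: gauss_itv_ge0.
pose f z := (G * sigma + G * tau * (expR (X z) + expR (- X z)))%:E.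
have f0 z : (0 <= f z)%E.
  rewrite lee_fin; apply: addr_ge0; first exact: mulr_ge0.
  by apply: mulr_ge0; [exact: mulr_ge0|apply: addr_ge0; exact: expR_ge0].
have h1 : (G%:E <= \int[gauss_vec R m]_z S z + \int[gauss_vec R m]_z f z)%E.
  rewrite -ge0_integralD//; last exact: mXX.
  apply: (@le_trans _ _ (\int[gauss_vec R m]_z (cst G%:E z))%E).
    by rewrite integral_cst// [X in (_ <= G%:E * X)%E](_ : _ = 1%E) ?mule1//; exact: probability_setT.
  apply: ge0_le_integral => //.
  - by apply: emeasurable_funD => //; exact: mXX.
  - move=> z _; rewrite /S /f -EFinD lee_fin.
    have := gauss_itv_prod_shrink eps0 c_itv (eta0 (dot z z)); rewrite -/G -/g0 => h.
    rewrite opprK in h *.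
    apply: (le_trans h); rewrite lerD2l.
    have -> : G * sigma + G * tau * (expR (X z) + expR (- X z)) =
      G * (sigma + tau * (expR (X z) + expR (- X z))) by ring.
    rewrite ler_wpM2l//; apply: (le_trans (eta_le z)).
    by rewrite lerD2l ler_wpM2l// norm_le_expR_sum.
have h2 := gauss_radius_average s4' sm (mulr_ge0 G0 sigma0) (mulr_ge0 G0 tau0).
have h3 : (G%:E <= \int[gauss_vec R m]_z S z + (G * sigma + 2 * (G * tau) * expR 4)%:E)%E.
  by apply: (le_trans h1); rewrite leeD2l.
rewrite -leeBlDr// -EFinB in h3; apply: le_trans h3; rewrite lee_fin.
rewrite -subr_ge0.
have -> : G - (G * sigma + 2 * (G * tau) * expR 4) - G * (1 - cone_rate * (N%:R ^+ 2 * s)) =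
  G * (sigma * expR 4 ^+ 2 + sigma * (expR 4 - 1) + (sigma - 2 * tau) * expR 4).
  by rewrite /cone_rate /sigma /D; ring.
apply: mulr_ge0 => //; apply: addr_ge0; [apply: addr_ge0|]; apply: mulr_ge0 => //;
  by rewrite ?subr_ge0 ?sqr_ge0 ?expR_ge0.
Qed.

End box_bounds.

(** * Gaussian mass of a cone *)

Section cone_bounds.
Context (R : realType).
Local Notation T := (measurableTypeR R).

(** After a rotation the vectors u i are triangular, and the cone lies between two boxes
    whose masses are known. *)
Lemma gauss_cone_bounds n k N (K eps B s : R) (c c' lo hi : nat -> R) (u : nat -> n.-tuple T) :
  (k < n)%N -> 0 < K -> 0 < eps -> 0 <= B -> 0 < s -> s <= 4^-1 -> s ^+ 2 * n%:R = 1 ->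
  (0 < N)%N -> (k <= N)%N ->
  (8 * K + 8 * (K + 1) ^+ 2 + B) * N%:R * s <= 8^-1 ->
  2 * mass_rate K eps B * N%:R ^+ 2 * s <= 1 ->
  (forall i, (i < k)%N -> [/\ - K <= c i, c i + eps <= c' i & c' i <= K]) ->
  (forall i, (i < k)%N -> `|lo i - c i| <= B * s) ->
  (forall i, (i < k)%N -> `|hi i - c' i| <= B * s) ->
  (forall i, (i < k)%N -> enorm (u i) = 1) ->
  (forall i j, (j < i)%N -> (i < k)%N -> `|dot (u j) (u i)| <= K * s) ->
  let G := \prod_(i < k) gauss_itv (c i) (c' i) in
  let e := cone_rate K eps B * (N%:R ^+ 2 * s) in
  ((G * (1 - e))%:E <= gauss_vec R n (cone k s lo hi u))%E /\
  (gauss_vec R n (cone k s lo hi u) <= (G * (1 + e))%:E)%E.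
Proof.
move=> kn K0 eps0 B0 s0 s4 sn N1 kN small DN1 c_itv lo_close hi_close u1 uo /=.
have En : n = (k + (n - k.+1).+1)%N by rewrite addnS -addSn subnKC.
move: (n - k.+1)%N En => m En; subst n.
have [M [iM Mu]] := gauss_isom_triangular u; pose w i := lin_act M (u i).
have wE : cone k s lo hi u = lin_act M @^-1` cone k s lo hi w.
  by apply/seteqP; split => v cv i; have := cv i;
    rewrite (dot_lin_act _ _ iM.1) (enorm_lin_act _ iM.1).
have [_ gM] := iM; rewrite wE gM; last exact: measurable_cone.
have kmk i : (i < k)%N -> (i < k + m.+1)%N by move=> ik; rewrite ltn_addr.
have s1 : s <= 1 by lra.
have c_itv' i : (i < k)%N -> - K <= c i /\ c' i <= K by move=> /c_itv[].
have w_triangular i (j : 'I_(k + m.+1)) : (i < k)%N -> (i < j)%N -> tnth (w i) j = 0.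
  by move=> ik ij; apply: (Mu (Ordinal (kmk i ik)) j).1.
have w_diag i : (i < k)%N -> 0 <= nth 0 (w i) i.
  move=> ik; have := (Mu (Ordinal (kmk i ik)) (Ordinal (kmk i ik))).2.
  by rewrite (tnth_nth 0) /=; apply; rewrite addnS ltnS ltn_addr.
have w_unit i : (i < k)%N -> enorm (w i) = 1.
  by move=> ik; rewrite (enorm_lin_act _ iM.1) u1.
have w_orth i j : (j < i)%N -> (i < k)%N -> `|dot (w j) (w i)| <= K * s.
  by move=> ji ik; rewrite (dot_lin_act _ _ iM.1) uo.
have mt : measurable_fun setT (fun v : (k + m.+1).-tuple T => eta_of N K B s (tail_sq v)).
  exact: measurable_eta_of.
split.
  have := gauss_box_ge K0 eps0 B0 s0 s4 N1 kN sn c_itv => /le_trans; apply.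
  apply: le_measure; rewrite ?inE; last 1 first.
  - exact: (box_sub_cone K0 B0 s0 s1 N1 kN small c_itv' lo_close hi_close w_triangular w_diag w_unit w_orth).
  - by apply: measurable_box; exact: measurableT_comp.
  - exact: measurable_cone.
have := gauss_box_le K0 eps0 B0 s0 s4 N1 kN sn DN1 c_itv; apply: le_trans.
apply: le_measure; rewrite ?inE; last 1 first.
- exact: (cone_sub_box K0 B0 s0 s1 N1 kN small c_itv' lo_close hi_close w_triangular w_diag w_unit w_orth).
- exact: measurable_cone.
- exact: measurable_box.
Qed.

End cone_bounds.

(** * Scalar products, caps and angles *)

Section sphere_geometry.
Context (R : realType).
Local Notation T := (measurableTypeR R).

Definition lin_comb n (a b : R) (x v : n.-tuple T) : n.-tuple T :=
  [tuple a * tnth x i + b * tnth v i | i < n].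

Lemma dot_lin_comb n a b (u x v : n.-tuple T) :
  dot u (lin_comb a b x v) = a * dot u x + b * dot u v.
Proof.
rewrite /dot !big_distrr/= -big_split/=; apply: eq_bigr => i _.
by rewrite tnth_mktuple; ring.
Qed.

Lemma cauchy_schwarz_unit n (u z : n.-tuple T) : enorm u = 1 -> dot u z ^+ 2 <= dot z z.
Proof.
move=> u1; have uu : dot u u = 1 by rewrite -sqr_enorm u1 expr1n.
have := dotxx_ge0 (lin_comb 1 (- dot u z) z u).
rewrite dot_lin_comb !(dotC (lin_comb _ _ _ _)) !dot_lin_comb uu (dotC z u).
have -> : 1 * (1 * dot z z + - dot u z * dot u z) +
  - dot u z * (1 * dot u z + - dot u z * 1) = dot z z - dot u z ^+ 2 by ring.
by rewrite subr_ge0.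
Qed.

Lemma dot_unit_le1 n (u v : n.-tuple T) : enorm u = 1 -> enorm v = 1 -> - 1 <= dot u v <= 1.
Proof.
move=> u1 v1; have := cauchy_schwarz_unit v u1; rewrite -sqr_enorm v1 expr1n => h.
by rewrite -ler_norml -(@ler_sqr _ _ 1) ?nnegrE// expr1n real_normK// num_real.
Qed.

(** Cauchy-Schwarz for u and the difference of x and v, each scaled by the norm of the
    other. *)
Lemma cap_close n (r : R) (u x v : n.-tuple T) : enorm u = 1 -> 0 < r ->
  cap (r ^+ 2 / 2) (x, v) ->
  `|dot u x * enorm v - dot u v * enorm x| < r * (enorm x * enorm v).
Proof.
move=> u1 r0 cxv.
have v0 : 0 < enorm v := cap_nonzero cxv.
have x0 : 0 < enorm x := cap_nonzero (cap_sym cxv).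
have xv0 : 0 < enorm x * enorm v by rewrite mulr_gt0.
have := cauchy_schwarz_unit (lin_comb (enorm v) (- enorm x) x v) u1.
rewrite !dot_lin_comb !(dotC (lin_comb _ _ _ _)) !dot_lin_comb -!sqr_enorm (dotC v x).
move: cxv; rewrite /cap/= => cxv h.
rewrite -ltr_sqr ?nnegrE ?mulr_ge0 ?enorm_ge0 ?(ltW r0)// real_normK ?num_real//.
have -> : dot u x * enorm v - dot u v * enorm x =
  enorm v * dot u x + - enorm x * dot u v by ring.
apply: (le_lt_trans h); rewrite -subr_gt0.
have -> : (r * (enorm x * enorm v)) ^+ 2 - (enorm v * (enorm v * enorm x ^+ 2 + - enorm x * dot x v) +
   - enorm x * (enorm v * dot x v + - enorm x * enorm v ^+ 2)) =
   2 * (enorm x * enorm v) * (dot x v - (1 - r ^+ 2 / 2) * (enorm x * enorm v)) by field.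
by rewrite mulr_gt0 ?mulr_gt0// subr_gt0.
Qed.

Lemma norm_one_sub_cos (x : R) : 0 <= x -> `|1 - cos x| <= x.
Proof.
rewrite le_eqVlt => /orP[/eqP <-|x0]; first by rewrite cos0 subrr normr0.
have [y _] := @MVT R cos (fun z => - sin z) 0 x x0 (fun z _ => is_derive_cos z)
  (continuous_subspaceT (@continuous_cos R)).
rewrite cos0 subr0 distrC => ->; rewrite normrM normrN (gtr0_norm x0).
by rewrite ler_piMl ?(ltW x0)// sin_max.
Qed.

Lemma sin_sub_id_le (x : R) : `|sin x - x| <= x ^+ 2.
Proof.
wlog x0 : x / 0 <= x.
  move=> H; have [|x0] := leP 0 x; first exact: H.
  have := H (- x); rewrite sinN sqrrN -opprD normrN; apply.
  by rewrite oppr_ge0 ltW.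
move: x0; rewrite le_eqVlt => /orP[/eqP <-|x0].
  by rewrite sin0 subrr normr0 expr0n.
have [y] := @MVT R sin cos 0 x x0 (fun z _ => is_derive_sin z)
  (continuous_subspaceT (@continuous_sin R)).
rewrite in_itv/= sin0 !subr0 => /andP[y0 yx] ->.
have -> : cos y * x - x = - ((1 - cos y) * x) by ring.
rewrite normrN normrM (gtr0_norm x0) expr2 ler_wpM2r ?(ltW x0)//.
by rewrite (le_trans (norm_one_sub_cos (ltW y0)))// ltW.
Qed.

Lemma norm_sin_le (x : R) : `|sin x| <= `|x|.
Proof.
wlog x0 : x / 0 <= x.
  move=> H; have [|x0] := leP 0 x; first exact: H.
  by rewrite -normrN -sinN -[X in _ <= X]normrN; apply: H; rewrite oppr_ge0 ltW.
move: x0; rewrite le_eqVlt => /orP[/eqP <-|x0]; first by rewrite sin0.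
have [y _] := @MVT R sin cos 0 x x0 (fun z _ => is_derive_sin z)
  (continuous_subspaceT (@continuous_sin R)).
rewrite sin0 !subr0 => ->.
by rewrite normrM ler_piMl// cos_max.
Qed.

(** The map d |-> acos d - pi / 2 is the inverse of d |-> - sin d. *)
Lemma acos_itv (a b d : R) : -1 <= d <= 1 ->
  - (pi / 2) <= a <= pi / 2 -> - (pi / 2) <= b <= pi / 2 ->
  (a < acos d - pi / 2 <= b) = (sin a < - d <= sin b).
Proof.
move=> d1 a1 b1; pose t := acos d - pi / 2.
have t1 : - (pi / 2) <= t <= pi / 2.
  rewrite /t; have := acos_ge0 d1; have := acos_lepi d1.
  by move=> h1 h2; apply/andP; split; lra.
have st : sin t = - d by rewrite sinBpihalf acosK// in_itv.
rewrite -/t -st ltr_sin ?in_itv//.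
by congr (_ && _); rewrite !leNgt; congr negb; rewrite ltr_sin ?in_itv.
Qed.

End sphere_geometry.

(** * One new vector on the sphere *)

Section sphere_windows.
Context (R : realType).
Local Notation T := (measurableTypeR R).

(** The cone over the set of unit vectors whose angles with the u i lie in the windows,
    for s the inverse square root of the dimension. *)
Definition angle_cone n k (s : R) (c c' : nat -> R) (u : nat -> n.-tuple T) : set (n.-tuple T) :=
  [set v | forall i : 'I_k, sin (c i * s) * enorm v < - dot v (u i) <= sin (c' i * s) * enorm v].

Lemma measurable_angle_cone n k s c c' (u : nat -> n.-tuple T) : measurable (angle_cone k s c c' u).
Proof.
apply: measurable_forall_ord => i.
have me a : measurable_fun setT (fun v : n.-tuple T => a * enorm v).
  by apply: measurable_funM => //; exact: measurable_enorm.
apply: measurable_between_oc => //.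
by apply: measurableT_comp => //; exact: measurable_dot.
Qed.

Lemma angle_windowE n (s a b : R) (v u : n.-tuple T) :
  0 < s -> s ^-1 = Num.sqrt n%:R ->
  `|a * s| <= 1 -> `|b * s| <= 1 -> enorm v = 1 -> enorm u = 1 ->
  (a < alpha_tilde v u <= b) = (sin (a * s) * enorm v < - dot v u <= sin (b * s) * enorm v).
Proof.
move=> s0 sE; rewrite !ler_norml => /andP[a1 a2] /andP[b1 b2] v1 u1.
have p2 : 1 <= pi / 2 :> R by have := pi_ge2 R; lra.
rewrite v1 !mulr1 -acos_itv; first last.
- by apply/andP; split; lra.
- by apply/andP; split; lra.
- exact: dot_unit_le1.
rewrite /alpha_tilde /angle v1 u1 mulr1 divr1 -sE.
by rewrite [s^-1 * _]mulrC ltr_pdivlMr// ler_pdivrMr.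
Qed.

Lemma angle_cone_on_usphere n k (s K : R) c c' (u : nat -> n.-tuple T) :
  0 < s -> s ^-1 = Num.sqrt n%:R -> K * s <= 1 ->
  (forall i, (i < k)%N -> - K <= c i <= K /\ - K <= c' i <= K) ->
  (forall i, (i < k)%N -> enorm (u i) = 1) ->
  [set v | usphere v /\ forall i : 'I_k, c i < alpha_tilde v (u i) <= c' i] =
  angle_cone k s c c' u `&` @usphere R n.
Proof.
move=> s0 sE Ks cK u1.
have H (i : 'I_k) : `|c i * s| <= 1 /\ `|c' i * s| <= 1.
  have [c1 c2] := cK i (ltn_ord i).
  by split; rewrite normrM (gtr0_norm s0); apply: le_trans Ks; rewrite ler_wpM2r ?(ltW s0)// ler_norml.
apply/seteqP; split => v /= [v1 v2]; split => // i; have [h1 h2] := H i.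
  by rewrite -(angle_windowE s0 sE h1 h2 v1 (u1 _ (ltn_ord i))).
by rewrite (angle_windowE s0 sE h1 h2 v2 (u1 _ (ltn_ord i))).
Qed.

Lemma uniform_gauss_compare_gt1 n delta (sigma : probability (n.-tuple T) R)
    (A B : set (n.-tuple T)) : (1 < n)%N ->
  uniform_on_usphere sigma -> 0 < delta -> delta < 1 ->
  measurable A -> measurable B ->
  (forall x y, A x -> cap delta (x, y) -> B y) ->
  (gauss_vec R n A <= sigma B)%E /\ (sigma A <= gauss_vec R n B)%E.
Proof.
move: sigma A B; case: n => [//|[//|n]] sigma A B _; exact: uniform_gauss_compare.
Qed.

Definition opp_vec n (x : n.-tuple T) : n.-tuple T := lin_comb (-1) 0 x x.

Lemma dot_opp_vec n (x v : n.-tuple T) : dot v (opp_vec x) = - dot v x.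
Proof. by rewrite dot_lin_comb mul0r addr0 mulN1r. Qed.

Lemma enorm_opp_vec n (x : n.-tuple T) : enorm (opp_vec x) = enorm x.
Proof. by rewrite /enorm dot_opp_vec dotC dot_opp_vec opprK. Qed.

(** K ^ 2 accounts for replacing the sine by its argument, 1 for the opening of the caps. *)
Definition angle_slack (K : R) := K ^+ 2 + 1.

(** One new vector against k given ones that are nearly orthogonal. The angle condition
    is enclosed between two cones for the opposite vectors: an angle larger than pi / 2
    corresponds to a negative scalar product. *)
Lemma uniform_windows_bounds n k N (K eps s : R) (sigma : probability (n.-tuple T) R)
    (c c' : nat -> R) (u : nat -> n.-tuple T) :
  let B := angle_slack K in
  uniform_on_usphere sigma ->
  (1 < n)%N -> (k < n)%N -> 0 < K -> 0 < eps -> 0 < s -> s <= 4^-1 -> s ^-1 = Num.sqrt n%:R ->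
  K * s <= 1 -> (0 < N)%N -> (k <= N)%N ->
  (8 * K + 8 * (K + 1) ^+ 2 + B) * N%:R * s <= 8^-1 ->
  2 * mass_rate K eps B * N%:R ^+ 2 * s <= 1 ->
  (forall i, (i < k)%N -> [/\ - K <= c i, c i + eps <= c' i & c' i <= K]) ->
  (forall i, (i < k)%N -> enorm (u i) = 1) ->
  (forall i j, (j < i)%N -> (i < k)%N -> `|dot (u j) (u i)| <= K * s) ->
  let G := \prod_(i < k) gauss_itv (c i) (c' i) in
  let e := cone_rate K eps B * (N%:R ^+ 2 * s) in
  let S := [set v | usphere v /\ forall i : 'I_k, c i < alpha_tilde v (u i) <= c' i] in
  ((G * (1 - e))%:E <= sigma S)%E /\ (sigma S <= (G * (1 + e))%:E)%E.
Proof.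
move=> B sU n1 kn K0 eps0 s0 s4 sE Ks N1 kN small DN1 c_itv u1 uo G e S.
have B0 : 0 <= B by rewrite addr_ge0// sqr_ge0.
have sn : s ^+ 2 * n%:R = 1.
  rewrite -[n%:R]sqr_sqrtr// -sE exprVn mulfV// expf_neq0// gt_eqF//.
have cK i : (i < k)%N -> - K <= c i <= K /\ - K <= c' i <= K.
  by move=> /c_itv[h1 h2 h3]; split; apply/andP; split; lra.
pose S' := angle_cone k s c c' u.
have SE : S = S' `&` @usphere R n by exact: (angle_cone_on_usphere s0 sE Ks cK u1).
have mS' : measurable S' by exact: measurable_angle_cone.
have -> : sigma S = sigma S'.
  by rewrite SE; apply: probability_setI_full => //; [exact: measurable_usphere|case: sU].
pose u' i := opp_vec (u i).
have u1' i : (i < k)%N -> enorm (u' i) = 1 by move=> ik; rewrite enorm_opp_vec u1.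
have uo' i j : (j < i)%N -> (i < k)%N -> `|dot (u' j) (u' i)| <= K * s.
  by move=> ji ik; rewrite dot_opp_vec dotC dot_opp_vec dotC opprK uo.
(* a cap of opening r ^ 2 / 2 moves normalised scalar products by less than r = s ^ 2 *)
have r0 : 0 < s ^+ 2 by rewrite exprn_gt0.
have r1 : s ^+ 2 <= 16^-1.
  by have := sqr_ge0 s; have := ler_pM (ltW s0) (ltW s0) s4 s4; rewrite -expr2; lra.
have d0 : 0 < (s ^+ 2) ^+ 2 / 2 by rewrite divr_gt0// exprn_gt0.
have d1 : (s ^+ 2) ^+ 2 / 2 < 1.
  by have := ler_pM (ltW r0) (ltW r0) r1 r1; rewrite -expr2; lra.
have close (f : R -> R) (cc : nat -> R) : (forall x, `|f x - x| <= s ^+ 2) ->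
    (forall i, (i < k)%N -> - K <= cc i <= K) ->
    forall i, (i < k)%N -> `|f (sin (cc i * s)) / s - cc i| <= B * s.
  move=> fx ccK i ik; rewrite -(ler_pM2r s0) -[X in _ * X <= _](gtr0_norm s0) -normrM mulrBl divfK ?gt_eqF//.
  have h1 := fx (sin (cc i * s)); have h2 := sin_sub_id_le (cc i * s).
  have h3 : (cc i * s) ^+ 2 <= K ^+ 2 * s ^+ 2.
    rewrite exprMn ler_wpM2r ?sqr_ge0// -[cc i ^+ 2]real_normK ?num_real//.
    by rewrite lerXn2r ?nnegrE ?(ltW K0)// ler_norml ccK.
  have -> : f (sin (cc i * s)) - cc i * s = (f (sin (cc i * s)) - sin (cc i * s)) + (sin (cc i * s) - cc i * s) by ring.
  apply: (le_trans (ler_normD _ _)); apply: (le_trans (lerD h1 h2)).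
  by rewrite /B /angle_slack; lra.
have fm x : `|x - s ^+ 2 - x| <= s ^+ 2.
  by rewrite addrAC subrr add0r normrN gtr0_norm.
have fp x : `|x + s ^+ 2 - x| <= s ^+ 2.
  by rewrite addrAC subrr add0r gtr0_norm.
have cK1 i : (i < k)%N -> - K <= c i <= K by move=> /cK[].
have cK2 i : (i < k)%N -> - K <= c' i <= K by move=> /cK[].
have capuv x v (i : 'I_k) : cap ((s ^+ 2) ^+ 2 / 2) (x, v) ->
    [/\ 0 < enorm x, 0 < enorm v,
     (- dot x (u i)) * enorm v < (dot (u' i) v + s ^+ 2 * enorm v) * enorm x &
     (dot (u' i) v - s ^+ 2 * enorm v) * enorm x < (- dot x (u i)) * enorm v].
  move=> cxv; have := cap_close (u1' i (ltn_ord i)) r0 cxv.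
  rewrite -dot_opp_vec -/(u' i) (dotC x) ltr_norml => /andP[h1 h2].
  split; [exact: cap_nonzero (cap_sym cxv)|exact: cap_nonzero cxv|lra|lra].
have fs y a : y / s * (a * s) = y * a by rewrite -mulrA [s^-1 * _]mulrC mulfK// gt_eqF.
split.
- have [GB _] := gauss_cone_bounds kn K0 eps0 B0 s0 s4 sn N1 kN small DN1 c_itv
    (close (fun x => x + s ^+ 2) c fp cK1) (close (fun x => x - s ^+ 2) c' fm cK2) u1' uo'.
  apply: (le_trans GB).
  apply: (uniform_gauss_compare_gt1 n1 sU d0 d1 _ mS' _).1; first exact: measurable_cone.
  move=> x v xA /cap_sym cvx i; have [v0 x0 h1 h2] := capuv v x i cvx.
  have /andP[] := xA i; rewrite !fs => l1 l2; apply/andP; split.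
    rewrite -(ltr_pM2r x0); apply: lt_trans h2.
    have := l1; rewrite -(ltr_pM2r v0); lra.
  apply: ltW; rewrite -(ltr_pM2r x0); apply: (lt_trans h1).
  have := l2; rewrite -(ltr_pM2r v0); lra.
- have [_ GB] := gauss_cone_bounds kn K0 eps0 B0 s0 s4 sn N1 kN small DN1 c_itv
    (close (fun x => x - s ^+ 2) c fm cK1) (close (fun x => x + s ^+ 2) c' fp cK2) u1' uo'.
  apply: le_trans GB.
  apply: (uniform_gauss_compare_gt1 n1 sU d0 d1 mS' _ _).2; first exact: measurable_cone.
  move=> x v xA cxv i; have [x0 v0 h1 h2] := capuv x v i cxv.
  have /andP[l1 l2] := xA i; rewrite !fs /=; apply/andP; split; rewrite -(ltr_pM2r x0).
    have l3 : sin (c i * s) * enorm x * enorm v < - dot x (u i) * enorm v by rewrite ltr_pM2r.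
    lra.
  have l3 := ler_wpM2r (ltW v0) l2. lra.
Qed.

End sphere_windows.

(** * The product of Gaussian window probabilities *)

Lemma index_pairsS N : index_pairs N.+1 =
  [seq (0%N, j.+1) | j <- iota 0 N] ++ [seq (p.1.+1, p.2.+1) | p <- index_pairs N].
Proof.
rewrite /index_pairs /= subn1; congr (_ ++ _).
  by rewrite (iotaDl 1 0) -map_comp.
rewrite (iotaDl 1 0) map_flatten -!map_comp; congr flatten; apply: eq_map => i /=.
by rewrite subSS add1n (iotaDl 1 i.+1) -!map_comp; apply: eq_map.
Qed.

Lemma index_pairs_lt N p : p \in index_pairs N -> (p.1 < p.2)%N.
Proof.
move=> /allpairsPdep[i [j [_ + ->]]] /=.
by rewrite mem_iota => /andP[].
Qed.

Lemma index_pairs_uniq N : uniq (index_pairs N).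
Proof.
elim: N => // N IH; rewrite index_pairsS cat_uniq !map_inj_uniq ?iota_uniq//.
- rewrite IH andbT /=; apply/hasPn => p /mapP[q _ ->] /=.
  by apply/negP => /mapP[j _] [].
- by move=> [i j] [i' j'] [-> ->].
- by move=> i j [].
Qed.

Lemma size_index_pairs N : size (index_pairs N) = 'C(N, 2).
Proof.
elim: N => // N IH.
by rewrite index_pairsS size_cat !size_map size_iota IH binS bin1 addnC.
Qed.

Section gaussian_product.
Context (R : realType).
Local Notation T := (measurableTypeR R).
Implicit Types (c : nat -> nat -> R) (f : nat * nat -> R -> R).

(** The recursion removes the index 0, as the first entry of a tuple is the vector that
    is added last. *)
Fixpoint window_prob N c c' : R :=
  if N is N'.+1 then
    \prod_(j < N') gauss_itv (c 0 j.+1) (c' 0 j.+1) *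
    window_prob N' (fun i j => c i.+1 j.+1) (fun i j => c' i.+1 j.+1)
  else 1.

(** Each integration affects a single factor of the product; the factors outside s keep
    the values prescribed by t. *)
Lemma iterated_integral_prod (K : R) f (l s : seq (nat * nat)) (t : nat * nat -> R) :
  (forall p, lebesgue_measure.-integrable `[- K, K] (EFin \o f p)) ->
  uniq l -> uniq s -> {subset s <= l} ->
  iterated_integral K s (fun t => \prod_(p <- l) f p (t p)) t =
  \prod_(p <- l | p \notin s) f p (t p) *
  \prod_(p <- s) \int[lebesgue_measure]_(x in `[- K, K]) f p x.
Proof.
move=> fi ul; elim: s t => [|p s IH] t /=.
  by move=> _ _; rewrite big_nil mulr1; apply: eq_bigl.
move=> /andP[ps us] sl; have pl : p \in l by apply: sl; rewrite mem_head.
have sl' : {subset s <= l} by move=> q qs; apply: sl; rewrite inE qs orbT.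
transitivity (\int[lebesgue_measure]_(x in `[- K, K]) (f p x *
   (\prod_(q <- l | q \notin p :: s) f q (t q) *
    \prod_(q <- s) \int[lebesgue_measure]_(x in `[- K, K]) f q x))).
  apply: eq_Rintegral => x _; rewrite IH// mulrA; congr (_ * _).
  rewrite big_mkcond (bigD1_seq p)//= ps eqxx; congr (_ * _).
  rewrite [RHS]big_mkcond [RHS](bigD1_seq p)//= inE eqxx mul1r.
  by apply: eq_bigr => q qp; rewrite inE (negbTE qp).
by rewrite RintegralZr// big_cons mulrCA.
Qed.

Lemma Rintegral_gauss_window (K a b : R) : - K <= a -> b <= K ->
  \int[lebesgue_measure]_(x in `[- K, K]) ((\1_(`]a, b] : set R) x) * expR (- x ^+ 2 / 2)) =
  Num.sqrt (2 * pi) * gauss_itv a b.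
Proof.
move=> Ka bK.
have q0 : 0 < Num.sqrt (2 * pi) :> R by rewrite sqrtr_gt0 mulr_gt0// pi_gt0.
rewrite /Rintegral.
have -> : (\int[lebesgue_measure]_(x in `[(- K)%R, K]) ((\1_(`]a, b] : set R) x) * expR (- x ^+ 2 / 2))%:E =
  \int[lebesgue_measure]_(x in `]a, b]) ((Num.sqrt (2 * pi))%:E * (normal_pdf 0 1 x)%:E))%E.
  rewrite integral_mkcond [RHS]integral_mkcond; apply: eq_integral => x _.
  rewrite !patchE indicE; case: (boolP (x \in `]a, b]%classic)) => xab.
    rewrite ifT; last first.
      move: xab; rewrite !inE /= !in_itv/= => /andP[xa xb].
      by apply/andP; split; lra.
    by rewrite mul1r normal_pdf01 -EFinM mulVKf ?gt_eqF.
  by rewrite mul0r; case: ifP.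
have mp : measurable_fun (`]a, b]%classic : set T) (fun x => (normal_pdf 0 1 x : R)%:E).
  by apply/measurable_EFinP/measurable_funTS; exact: measurable_normal_pdf.
have p0 (x : T) : (`]a, b]%classic : set T) x -> (0 <= (normal_pdf 0 1 x : R)%:E)%E.
  by move=> _; rewrite lee_fin normal_pdf_ge0.
have q0' : (0 <= (Num.sqrt (2 * pi) : R)%:E)%E by rewrite lee_fin ltW.
have E := ge0_integralZl lebesgue_measure (measurable_itv _) mp p0 q0'.
by apply: (etrans (congr1 fine E)); rewrite -std_gaussE gauss_itvE.
Qed.

Lemma integrable_gauss_window (K a b : R) :
  lebesgue_measure.-integrable `[- K, K]
    (EFin \o (fun x => (\1_(`]a, b] : set R) x) * expR (- x ^+ 2 / 2))).
Proof.
apply: measurable_bounded_integrable => //.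
- rewrite [X in (X < _)%E]lebesgue_measure_itv/=; by case: ifP; rewrite ltry.
- apply: measurable_funTS; apply: measurable_funM; first exact: measurable_indic.
  apply: measurableT_comp => //; apply: measurable_funM => //.
  by apply: measurableT_comp => //; exact: measurable_funX.
exists 1; split => // M M1 x _; apply: le_trans (ltW M1).
rewrite normrM indicE ger0_norm// [`|expR _|]ger0_norm ?expR_ge0//.
rewrite mulr_ile1 ?expR_ge0//; first by case: (_ \in _).
by rewrite -[leRHS]expR0 ler_expR; have := sqr_ge0 x; lra.
Qed.

Lemma window_probE N c c' :
  \prod_(p <- index_pairs N) gauss_itv (c p.1 p.2) (c' p.1 p.2) = window_prob N c c'.
Proof.
elim: N c c' => [|N IH] c c'; first by rewrite /index_pairs big_nil.
rewrite index_pairsS big_cat !big_map/=; congr (_ * _); last exact: IH.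
have -> : iota 0 N = index_iota 0 N by rewrite /index_iota subn0.
by rewrite big_mkord.
Qed.

Lemma window_prob_gt0 N c c' : (forall i j, (i < j)%N -> c i j < c' i j) ->
  0 < window_prob N c c'.
Proof.
elim: N c c' => //= N IH c c' cc.
rewrite mulr_gt0 ?IH//; last by move=> i j ij; apply: cc.
by apply: prodr_gt0 => i _; apply: gauss_itv_gt0; exact: cc.
Qed.

Lemma gauss_prob_window K N c c' :
  (forall i j, (i < j)%N -> - K <= c i j /\ c' i j <= K) ->
  gauss_prob K N c c' = window_prob N c c'.
Proof.
move=> cK; have q0 : 0 < Num.sqrt (2 * pi) :> R by rewrite sqrtr_gt0 mulr_gt0// pi_gt0.
rewrite /gauss_prob (@iterated_integral_prod K (fun p x =>
  (\1_(`]c p.1 p.2, c' p.1 p.2] : set R) x) * expR (- x ^+ 2 / 2)) _ _ _ _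
  (index_pairs_uniq N) (index_pairs_uniq N))//; last by move=> p; exact: integrable_gauss_window.
rewrite big_seq_cond big_pred0 ?mul1r; last by move=> p; rewrite andbN.
rewrite -window_probE -size_index_pairs.
rewrite [X in _ * X](_ : _ = \prod_(p <- index_pairs N)
    (Num.sqrt (2 * pi) * gauss_itv (c p.1 p.2) (c' p.1 p.2))); last first.
  rewrite big_seq [RHS]big_seq; apply: eq_bigr => p /index_pairs_lt pp.
  by have [c1 c2] := cK _ _ pp; exact: Rintegral_gauss_window.
rewrite big_split/= big_const_seq count_predT iter_mulr_1.
by rewrite exprVn mulKf// expf_neq0// gt_eqF.
Qed.

End gaussian_product.

(** * Adding the vectors one at a time *)

Section angle_events.
Context (R : realType) (n : nat).
Local Notation T := (measurableTypeR R).
Variables (sigma : probability (n.-tuple T) R) (K eps s : R) (M : nat).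
Let B := angle_slack K.
Let e := cone_rate K eps B * (M%:R ^+ 2 * s).

Definition windows (c c' : nat -> nat -> R) := forall i j, (i < j)%N ->
  [/\ - K <= c i j, c i j + eps <= c' i j & c' i j <= K].

Hypotheses (sU : uniform_on_usphere sigma) (n1 : (1 < n)%N).
Hypotheses (K0 : 0 < K) (eps0 : 0 < eps) (s0 : 0 < s) (s4 : s <= 4^-1).
Hypotheses (sE : s ^-1 = Num.sqrt n%:R) (Ks : K * s <= 1).
Hypotheses (M1 : (0 < M)%N) (Mn : (M <= n)%N).
Hypothesis small : (8 * K + 8 * (K + 1) ^+ 2 + B) * M%:R * s <= 8^-1.
Hypothesis DM1 : 2 * mass_rate K eps B * M%:R ^+ 2 * s <= 1.
Hypothesis e1 : e <= 1.

Lemma windows_norm c c' i j : windows c c' -> (i < j)%N ->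
  `|c i j * s| <= K * s /\ `|c' i j * s| <= K * s.
Proof.
move=> W ij; have [h1 h2 h3] := W i j ij.
have c1 : `|c i j| <= K by rewrite ler_norml; apply/andP; split; move: eps0 h1 h2 h3; lra.
have c2 : `|c' i j| <= K by rewrite ler_norml; apply/andP; split; move: eps0 h1 h2 h3; lra.
by rewrite !normrM (gtr0_norm s0) !ler_wpM2r ?(ltW s0).
Qed.

Lemma angle_eventE k c c' : windows c c' ->
  @angle_event R n k c c' = [set u | (forall i : 'I_k, usphere (tnth u i)) /\
     forall i j : 'I_k, (i < j)%N ->
       sin (c i j * s) < - dot (tnth u i) (tnth u j) <= sin (c' i j * s)].
Proof.
move=> W; apply/seteqP; split => u [u1 uw]; split => // i j ij; have := uw i j ij;
  have [/le_trans/(_ Ks) h1 /le_trans/(_ Ks) h2] := windows_norm W ij;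
  by rewrite (angle_windowE s0 sE h1 h2 (u1 i) (u1 j)) (u1 i : enorm _ = 1) !mulr1.
Qed.

Lemma measurable_angle_event k c c' : windows c c' -> measurable (@angle_event R n k c c').
Proof.
move=> W; rewrite (angle_eventE _ W).
have mt i : measurable_fun setT (fun u : k.-tuple (n.-tuple T) => tnth u i).
  exact: measurable_tnth.
apply: measurableI; apply: measurable_forall_ord => i.
  by apply: measurable_preimage => //; exact: measurable_usphere.
apply: measurable_forall_ord => j.
have [ij|ij] := boolP (i < j)%N; last first.
  by rewrite [X in measurable X](_ : _ = setT)//; apply/seteqP; split.
rewrite [X in measurable X](_ : _ = [set u : k.-tuple (n.-tuple T) |
    sin (c i j * s) < - dot (tnth u i) (tnth u j) <= sin (c' i j * s)]); last first.
  by apply/seteqP; split => u //=; apply.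
apply: measurable_between_oc => //.
by apply: measurableT_comp => //; exact: measurable_dot.
Qed.

Lemma angle_error_ge0 : 0 <= e.
Proof.
have B0 : 0 <= B by rewrite addr_ge0// sqr_ge0.
have D0 := ltW (mass_rate_gt0 K0 eps0 B0).
apply: mulr_ge0; last by rewrite mulr_ge0 ?sqr_ge0// ltW.
by apply: mulr_ge0; [exact: mulr_ge0|rewrite addr_ge0 ?sqr_ge0// mulr_ge0// expR_ge0].
Qed.

Let shift (c : nat -> nat -> R) i j := c i.+1 j.+1.

Lemma windows_shift c c' : windows c c' -> windows (shift c) (shift c').
Proof. by move=> W i j ij; exact: W. Qed.

Lemma angle_event_tcons k c c' (v : n.-tuple T) (u : k.-tuple (n.-tuple T)) :
  @angle_event R n k.+1 c c' (tcons (v, u)) <->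
  (usphere v /\ forall j : 'I_k, c 0 j.+1 < alpha_tilde v (tnth u j) <= c' 0 j.+1) /\
  @angle_event R n k (shift c) (shift c') u.
Proof.
split=> [[u1 uw]|[[v1 vw] [u1 uw]]].
  split; split.
  - exact: (u1 ord0).
  - by move=> j; have := uw ord0 (lift ord0 j) isT; rewrite tnth_tconsS tnth_tcons0 lift0.
  - by move=> i; have := u1 (lift ord0 i); rewrite tnth_tconsS.
  - move=> i j ij; have := uw (lift ord0 i) (lift ord0 j) ij.
    by rewrite !tnth_tconsS !lift0.
split=> [i|i j].
  by case: (unliftP ord0 i) => [i' ->|->]; rewrite ?tnth_tconsS ?tnth_tcons0.
case: (unliftP ord0 i) => [i' ->|->]; case: (unliftP ord0 j) => [j' ->|->] //;
  rewrite ?tnth_tconsS ?tnth_tcons0 ?lift0 // => ij.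
exact: uw.
Qed.

(** The angle windows make the vectors of u nearly orthogonal, so that
    uniform_windows_bounds applies with the same error for every such u. *)
Lemma next_vector_bounds k c c' (u : k.-tuple (n.-tuple T)) : (k < M)%N -> windows c c' ->
  @angle_event R n k (shift c) (shift c') u ->
  let g := \prod_(j < k) gauss_itv (c 0 j.+1) (c' 0 j.+1) in
  let S := [set v | usphere v /\ forall j : 'I_k, c 0 j.+1 < alpha_tilde v (tnth u j) <= c' 0 j.+1] in
  ((g * (1 - e))%:E <= sigma S)%E /\ (sigma S <= (g * (1 + e))%:E)%E.
Proof.
move=> kM W uE g S; pose w i := nth (zero_vec R n) u i.
have wE (i : 'I_k) : tnth u i = w i by rewrite (tnth_nth (zero_vec R n)).
have -> : S = [set v | usphere v /\ forall i : 'I_k, c 0 i.+1 < alpha_tilde v (w i) <= c' 0 i.+1].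
  by apply/seteqP; split => v [v1 vw]; split => // i; have := vw i; rewrite wE.
have := uE; rewrite (angle_eventE _ (windows_shift W)) => -[u1 uw].
apply: (@uniform_windows_bounds R n k M K eps s sigma (fun j => c 0 j.+1) (fun j => c' 0 j.+1) w) => //.
- exact: leq_trans kM Mn.
- exact: ltnW.
- by move=> i _; exact: W.
- by move=> i ik; have := u1 (Ordinal ik); rewrite wE.
- move=> i j ji ik; have jk := ltn_trans ji ik.
  have := uw (Ordinal jk) (Ordinal ik) ji; rewrite !wE /= => /andP[h1 h2].
  have [h3 h4] := windows_norm (windows_shift W) ji.
  have h5 := le_trans (norm_sin_le _) h3; have h6 := le_trans (norm_sin_le _) h4.
  move: h5 h6; rewrite !ler_norml => /andP[g1 g2] /andP[g3 g4].
  by apply/andP; split; lra.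
Qed.

(** Integrating next_vector_bounds over the previous vectors multiplies the probability
    by the next factor of window_prob, up to 1 - e and 1 + e. *)
Lemma angle_event_bounds k c c' : (k <= M)%N -> windows c c' ->
  ((window_prob k c c' * (1 - e) ^+ k)%:E <= power_prob sigma k (@angle_event R n k c c'))%E /\
  (power_prob sigma k (@angle_event R n k c c') <= (window_prob k c c' * (1 + e) ^+ k)%:E)%E.
Proof.
have e0 : 0 <= 1 - e by rewrite subr_ge0.
have Q0 k' d d' : (0 <= power_prob sigma k' (@angle_event R n k' d d'))%E by exact: measure_ge0.
elim: k c c' => [|k IH] c c' kM W.
  rewrite /= !expr0 mulr1.
  have -> : @angle_event R n 0 c c' = setT.
    by apply/seteqP; split => // u _; split=> [|] [].
  by rewrite diracT.
have [IH1 IH2] := IH _ _ (ltnW kM) (windows_shift W).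
pose ev := @angle_event R n k (shift c) (shift c').
have mev : measurable ev by exact: measurable_angle_event (windows_shift W).
have mE : measurable (@angle_event R n k.+1 c c') by exact: measurable_angle_event.
pose g := \prod_(j < k) gauss_itv (c 0 j.+1) (c' 0 j.+1).
have g0 : 0 <= g by apply: prodr_ge0 => i _; exact: gauss_itv_ge0.
pose F := (fun u => (\1_(@angle_event R n k.+1 c c') u : R)%:E).
have mF : measurable_fun setT F by exact/measurable_EFinP/measurable_indic.
have F0 u : (0 <= F u)%E by rewrite lee_fin.
have mI : measurable_fun setT (fun u => \int[sigma]_v F (tcons (v, u)))%E.
  exact: (measurable_fun_fubini_tonelli_G (m1 := sigma) _
    (measurableT_comp mF (@measurable_tcons _ _ k)) (fun p => F0 _)).
have inner u : (\int[sigma]_v F (tcons (v, u)))%E =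
    sigma [set v | @angle_event R n k.+1 c c' (tcons (v, u))].
  rewrite [RHS]measureE_indic//.
  by apply: measurable_preimage => //; exact: measurable_tcons_l.
have inner_le u : ((\1_ev u : R)%:E * (g * (1 - e))%:E <= \int[sigma]_v F (tcons (v, u)))%E /\
    (\int[sigma]_v F (tcons (v, u)) <= (\1_ev u : R)%:E * (g * (1 + e))%:E)%E.
  rewrite inner indicE; have [uev|uev] := boolP (u \in ev).
    rewrite !mul1e; move: uev; rewrite inE => uev.
    have -> : [set v | @angle_event R n k.+1 c c' (tcons (v, u))] =
        [set v | usphere v /\ forall j : 'I_k, c 0 j.+1 < alpha_tilde v (tnth u j) <= c' 0 j.+1].
      apply/seteqP; split => v; first by case/angle_event_tcons.
      by move=> vS; apply/angle_event_tcons.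
    exact: next_vector_bounds.
  rewrite (_ : [set v | _] = set0) ?measure0 ?mul0e//.
  apply/seteqP; split => // v /angle_event_tcons[_ uev'].
  by rewrite notin_setE in uev.
have total a : 0 <= a -> (\int[power_prob sigma k]_u ((\1_ev u : R)%:E * a%:E) =
    power_prob sigma k ev * a%:E)%E.
  move=> a0; rewrite ge0_integralZr//; last exact/measurable_EFinP/measurable_indic.
  by rewrite -measureE_indic.
rewrite (measureE_indic _ mE) (integral_power_probS_swap sigma mF F0).
have ge1 : 0 <= g * (1 - e) by exact: mulr_ge0.
have ge2 : 0 <= g * (1 + e) by apply: mulr_ge0 => //; rewrite addr_ge0// angle_error_ge0.
have m1 a : measurable_fun setT (fun u => (\1_ev u : R)%:E * a%:E)%E.
  by apply: emeasurable_funM => //; exact/measurable_EFinP/measurable_indic.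
have p1 a u : 0 <= a -> (0 <= (\1_ev u : R)%:E * a%:E)%E.
  by move=> a0; rewrite mule_ge0// lee_fin.
split.
  apply: (@le_trans _ _ (power_prob sigma k ev * (g * (1 - e))%:E)%E).
    have -> : window_prob k.+1 c c' * (1 - e) ^+ k.+1 =
        window_prob k (shift c) (shift c') * (1 - e) ^+ k * (g * (1 - e)).
      by rewrite /= exprS /g /shift; ring.
    by rewrite [leLHS]EFinM; apply: lee_wpmul2r; rewrite ?lee_fin.
  rewrite -total//; apply: ge0_le_integral => //.
  - by move=> u _; exact: p1.
  - by move=> u _; exact: (inner_le u).1.
apply: (@le_trans _ _ (power_prob sigma k ev * (g * (1 + e))%:E)%E).
  rewrite -total//; apply: ge0_le_integral => //.
  - by move=> u _; apply: integral_ge0.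
  - by move=> u _; exact: (inner_le u).2.
have -> : window_prob k.+1 c c' * (1 + e) ^+ k.+1 =
    window_prob k (shift c) (shift c') * (1 + e) ^+ k * (g * (1 + e)).
  by rewrite /= exprS /g /shift; ring.
by rewrite [leRHS]EFinM; apply: lee_wpmul2r; rewrite ?lee_fin.
Qed.

End angle_events.

(** * The relative error *)

Section final_estimate.
Context (R : realType).

Lemma bernoulli_sub (e : R) k : 0 <= e -> e <= 1 -> 1 - k%:R * e <= (1 - e) ^+ k.
Proof.
move=> e0 e1; elim: k => [|k IH]; first by rewrite mul0r subr0 expr0.
rewrite exprS -natr1; apply: (@le_trans _ _ ((1 - e) * (1 - k%:R * e))).
  have : 0 <= k%:R * e ^+ 2 by rewrite mulr_ge0// sqr_ge0.
  by rewrite expr2; lra.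
by rewrite ler_wpM2l// subr_ge0.
Qed.

Lemma expr1D_le (e : R) k : 0 <= e -> k%:R * e <= 1 ->
  (1 + e) ^+ k <= 1 + k%:R * e * expR 1.
Proof.
move=> e0 ke; have ke0 : 0 <= k%:R * e by rewrite mulr_ge0.
apply: (@le_trans _ _ (expR (k%:R * e))).
  rewrite expRM_natl lerXn2r ?nnegrE ?expR_ge0 ?expR_ge1Dx//.
  by rewrite addr_ge0.
have := expR_scale_le 1 ke0 ke; rewrite mulr1; lra.
Qed.

(** The k relative errors add up, as long as their sum stays below 1. *)
Lemma ratio_sub1_le (q W e : R) k : 0 < W -> 0 <= e -> e <= 1 -> k%:R * e <= 1 ->
  W * (1 - e) ^+ k <= q -> q <= W * (1 + e) ^+ k -> `|q / W - 1| <= k%:R * e * expR 1.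
Proof.
move=> W0 e0 e1 ke h1 h2; have ke0 : 0 <= k%:R * e by rewrite mulr_ge0.
have l1 : (1 - e) ^+ k <= q / W by rewrite ler_pdivlMr// mulrC.
have l2 : q / W <= (1 + e) ^+ k by rewrite ler_pdivrMr// mulrC.
have l3 := le_trans (bernoulli_sub k e0 e1) l1.
have l4 := le_trans l2 (expr1D_le e0 ke).
have F1 : 1 <= expR 1 :> R by rewrite -[leLHS]expR0 ler_expR.
have l5 := ler_wpM2l ke0 F1.
by rewrite ler_norml; apply/andP; split; lra.
Qed.

Lemma littleo_cube (N : nat -> nat) (d : R) : 0 < d -> d <= 1 ->
  (fun n : nat => (N n)%:R : R^o) =o_\oo (fun n : nat => n%:R `^ 6^-1 : R^o) ->
  \forall n \near \oo, (N n)%:R ^+ 3 <= d * Num.sqrt n%:R.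
Proof.
move=> d0 d1 /eqoP/(_ _ d0); apply: filterS => n.
rewrite /= ger0_norm// ger0_norm ?powR_ge0// => h.
apply: (@le_trans _ _ ((d * n%:R `^ 6^-1) ^+ 3)).
  by rewrite lerXn2r ?nnegrE ?mulr_ge0 ?powR_ge0 ?(ltW d0).
have -> : (d * n%:R `^ 6^-1) ^+ 3 = d ^+ 3 * Num.sqrt n%:R.
  rewrite exprMn -[X in _ * X = _]powR_mulrn ?powR_ge0// -powRrM -powR12_sqrt//.
  by congr (_ * _ `^ _); field.
rewrite ler_wpM2r ?sqrtr_ge0// exprS ler_piMr ?(ltW d0)//.
by rewrite exprn_ile1// ltW.
Qed.

End final_estimate.

Theorem theorem2p1 (R : realType)
    (sigma : forall n : nat, probability (n.-tuple (measurableTypeR R)) R)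
    (sigma_unif : forall n : nat, (0 < n)%N -> uniform_on_usphere (sigma n))
    (K eps : R) (K_gt0 : 0 < K) (eps_gt0 : 0 < eps) :
  exists C : R, 0 < C /\
    forall N : nat -> nat,
      (fun n : nat => (N n)%:R : R^o) =o_\oo (fun n : nat => n%:R `^ 6^-1 : R^o) ->
      \forall n \near \oo,
        forall c c' : nat -> nat -> R,
          (forall i j : nat, (i < j)%N ->
             [/\ - K <= c i j, c i j < c' i j & c' i j <= K]) ->
          eps <= inf [set c' p.1 p.2 - c p.1 p.2 | p in [set p | (p.1 < p.2)%N]] ->
          `| sphere_prob (sigma n) (N n) c c' / gauss_prob K (N n) c c' - 1 |
            <= C * ((N n)%:R ^+ 3 / Num.sqrt n%:R).
Proof.
pose B := angle_slack K; pose D := mass_rate K eps B; pose cr := cone_rate K eps B.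
have B0 : 0 <= B by rewrite addr_ge0// sqr_ge0.
have D0 : 0 < D by exact: mass_rate_gt0.
have cr0 : 0 < cr.
  apply: mulr_gt0; first exact: mulr_gt0.
  by rewrite addr_gt0 ?exprn_gt0 ?mulr_gt0 ?expR_gt0.
exists (cr * expR 1); split; first by rewrite mulr_gt0// expR_gt0.
move=> N No; pose A := 8 * K + 8 * (K + 1) ^+ 2 + B.
have A0 : 0 <= A.
  by rewrite !addr_ge0// mulr_ge0 ?sqr_ge0// ltW.
(* all the smallness conditions follow from N^3 / sqrt n <= 1 / P *)
pose P := 8 * A + 2 * D + cr + K + 4.
have P1 : 1 <= P by rewrite /P; lra.
have P0 : 0 < P by lra.
have d0 : 0 < P^-1 by rewrite invr_gt0.
have d1 : P^-1 <= 1 by rewrite invf_le1.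
have := littleo_cube d0 d1 No; apply: filterS => n N3 c c' cc cinf.
have W : windows K eps c c'.
  move=> i j ij; have [h1 h2 h3] := cc i j ij; split => //.
  rewrite addrC -lerBrDr; apply: (le_trans cinf); apply: ge_inf; last by exists (i, j).
  by exists 0 => _ [[a b] /= ab <-]; have [_ ? _] := cc a b ab; rewrite subr_ge0 ltW.
rewrite gauss_prob_window; last by move=> i j ij; have [? _ ?] := cc i j ij.
rewrite /sphere_prob; case: (posnP (N n)) => [->|N0].
  rewrite (_ : angle_event c c' = setT); last first.
    by apply/seteqP; split => // u _; split => [|] [].
  by rewrite probability_setT/= divr1 subrr normr0 expr0n mul0r mulr0.
set k := N n in N0 N3 *.
have k1 : 1 <= k%:R :> R by rewrite ler1n.
have n0 : (0 < n)%N.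
  rewrite lt0n; apply/eqP => n00; move: N3; rewrite n00 sqrtr0 mulr0.
  by apply/negP; rewrite -ltNge exprn_gt0// (lt_le_trans ltr01).
have rt0 : 0 < Num.sqrt n%:R :> R by rewrite sqrtr_gt0 ltr0n.
pose s := (Num.sqrt n%:R : R)^-1.
have s0 : 0 < s by rewrite invr_gt0.
have sE : s^-1 = Num.sqrt n%:R by rewrite invrK.
have ks : P * (k%:R ^+ 3 * s) <= 1.
  by rewrite -ler_pdivlMl// mulr1 ler_pdivrMr.
have k13 : k%:R * s <= k%:R ^+ 3 * s.
  by rewrite ler_wpM2r ?(ltW s0)// exprS ler_peMr// exprn_ege1.
have k23 : k%:R ^+ 2 * s <= k%:R ^+ 3 * s.
  by rewrite ler_wpM2r ?(ltW s0)// [X in _ <= X]exprS ler_peMl// sqr_ge0.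
have k03 : s <= k%:R ^+ 3 * s by rewrite ler_peMl ?(ltW s0)// exprn_ege1.
have le_scaled a x : 0 <= a -> x <= k%:R ^+ 3 * s -> a * x <= a * (k%:R ^+ 3 * s).
  by move=> a0 hx; rewrite ler_wpM2l.
have x0 : 0 <= k%:R ^+ 3 * s by apply: le_trans k03; exact: ltW.
have a1 := le_scaled A _ A0 k13; have a2 := le_scaled D _ (ltW D0) k23.
have a3 := le_scaled K _ (ltW K_gt0) k03; have a4 := le_scaled cr _ (ltW cr0) k23.
have p1 := mulr_ge0 A0 x0; have p2 := mulr_ge0 (ltW D0) x0.
have p3 := mulr_ge0 (ltW K_gt0) x0; have p4 := mulr_ge0 (ltW cr0) x0.
rewrite /P in ks.
have s4 : s <= 4^-1 by lra.
have Ks : K * s <= 1 by lra.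
have n1 : (1 < n)%N.
  rewrite ltnNge; apply/negP => n1; have nE : n = 1%N by apply/eqP; rewrite eqn_leq n1.
  by move: s4; rewrite /s nE sqrtr1 invr1; lra.
have kn : (k <= n)%N.
  rewrite -(ler_nat R) -[n%:R]sqr_sqrtr// -sE.
  apply: (@le_trans _ _ s^-1).
    by rewrite -[leRHS]mul1r ler_pdivlMr//; lra.
  by rewrite expr2 ler_peMl ?invr_ge0 ?(ltW s0)// invf_ge1//; lra.
have small : A * k%:R * s <= 8^-1 by lra.
have DM : 2 * D * k%:R ^+ 2 * s <= 1 by lra.
have e1 : cr * (k%:R ^+ 2 * s) <= 1 by lra.
have ke1 : k%:R * (cr * (k%:R ^+ 2 * s)) <= 1.
  have -> : k%:R * (cr * (k%:R ^+ 2 * s)) = cr * (k%:R ^+ 3 * s) by ring.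
  lra.
have [b1 b2] := angle_event_bounds (sigma_unif n n0) n1 K_gt0 eps_gt0 s0 s4 sE Ks N0 kn
  small DM e1 (leqnn k) W.
set q := power_prob _ _ _ in b1 b2 *.
have qf : q = (fine q)%:E.
  by rewrite fineK// fin_num_measure//; apply: (measurable_angle_event eps_gt0 s0 sE Ks W).
rewrite qf !lee_fin in b1 b2.
have W0 : 0 < window_prob k c c' by apply: window_prob_gt0 => i j /cc[].
have e0 : 0 <= cr * (k%:R ^+ 2 * s) by rewrite mulr_ge0 ?(ltW cr0)// mulr_ge0 ?sqr_ge0// ltW.
apply: (le_trans (ratio_sub1_le W0 e0 e1 ke1 b1 b2)).
by rewrite le_eqVlt -/s; apply/orP; left; apply/eqP; ring.
Qed.
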